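(* Fix $\varepsilon\in(0,1)$, $\alpha\in(0,1)$ and an integer $K\ge1$. Suppose that conditions (A1), (A2), (A3) of the context hold. Also suppose that $\lambda_1(\boldsymbol\Sigma)>\dots>\lambda_K(\boldsymbol\Sigma)$ are fixed with respect to $n$, and that for all large $n$ the alternative $$\mathsf H_{1,n}(K):\quad \lambda_j(\boldsymbol\Sigma)\ge\frac1{(1-\varepsilon)\xi_{n,j}}\ \text{ for } j=1,\dots,K,\quad\text{and}\quad \lambda_{K+1}(\boldsymbol\Sigma)\le\frac1{(1+\varepsilon)\xi_{n,K}}$$ holds. Then $$\lim_{n\to\infty}\mathbb P(T_n>q_{1-\alpha})=1.$$
   Context: Setting. For each $n$ let $p=p_n\in\mathbb N$, $y_n=p/n$, and let $\boldsymbol\Sigma=\boldsymbol\Sigma_n$ be a deterministic symmetric positive semidefinite $p\times p$ matrix. Eigenvalues of a symmetric matrix $A$ are written $\lambda_1(A)\ge\lambda_2(A)\ge\cdots$. $H_n$ is the empirical distribution of $\lambda_1(\boldsymbol\Sigma),\dots,\lambda_p(\boldsymbol\Sigma)$. The conditions are: (A1) $y_n\to y$ for some $y\in(0,\infty)\setminus\{1\}$. (A2) The data matrix is $\mathbf Y=\mathbf X\boldsymbol\Sigma^{1/2}\in\mathbb R^{n\times p}$, where $\mathbf X$ is the upper-left $n\times p$ block of a doubly-infinite array of i.i.d. real random variables $\{x_{ij}:i,j\ge1\}$ with $\mathbb E(x_{11})=0$, $\mathbb E(x_{11}^2)=1$ and $\sup_{q\ge1}q^{-1/\beta}(\mathbb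 E|x_{11}|^q)^{1/q}<\infty$ for some $\beta>0$. (A3) As $n\to\infty$, $H_n$ has a weak limit $H$; the support of $H$ is a finite union of closed intervals in $(0,\infty)$; and there is a fixed compact interval in $(0,\infty)$ containing the support of $H_n$ for all large $n$. The sample covariance matrix is $\hat{\boldsymbol\Sigma}=\frac1n\mathbf Y^\top\mathbf Y$ and its companion is the $n\times n$ matrix $\underline{\hat{\boldsymbol\Sigma}}=\frac1n\mathbf Y\mathbf Y^\top$. Critical parameters. For $k\in\{0,\dots,p-1\}$ with $\lambda_{k+1}(\boldsymbol\Sigma)>0$, $\xi_{n,k}$ is the unique value in $(0,1/\lambda_{k+1}(\boldsymbol\Sigma))$ solving $\frac1p\sum_{j=k+1}^p\big(\frac{\lambda_j(\boldsymbol\Sigma)\xi_{n,k}}{1-\lambda_j(\boldsymbol\Sigma)\xi_{n,k}}\big)^2=\frac np$. Estimators. Let $\tilde{\underline s}_n(z)=\frac1n\sum_{j=2}^n\frac1{\lambda_j(\underline{\hat{\boldsymbol\Sigma}})-z}$. Put $\hat\xi_n=-\tilde{\underline s}_n(\lambda_1(\hat{\boldsymbol\Sigma}))$ if $\lambda_1(\hat{\boldsymbol\Sigma})>\lambda_2(\hat{\boldsymbol\Sigma})$, and $\hat\xi_n=-\tilde{\underline s}_n(\lambda_1(\hat{\boldsymbol\Sigma})+1)$ if $\lambda_1(\hat{\boldsymbol\Sigma})=\lambda_2(\hat{\boldsymbol\Sigma})$. QuEST estimator (Ledoit–Wolf): for $t\in[0,\infty)^p$ and $z\in\mathbb C^+$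 let $m=m^t(z)$ be the unique solution in $\{m\in\mathbb C:-\frac{1-p/n}{z}+\frac pn m\in\mathbb C^+\}$ of $m=\frac1p\sum_{i=1}^p\frac{1}{t_i(1-\frac pn-\frac pn zm)-z}$; it is the Stieltjes transform $\int(\lambda-z)^{-1}dF^t(\lambda)$ of a distribution function $F^t$ on $[0,\infty)$. Let $q^i(t)=p\int_{(i-1)/p}^{i/p}(F^t)^{-1}(u)\,du$ with $(F^t)^{-1}(u)=\sup\{x:F^t(x)\le u\}$, and let $\hat\tau$ be a (measurable) minimizer over $t\in[0,\infty)^p$ of $\frac1p\sum_{i=1}^p(q^i(t)-\ell_i)^2$, where $\ell_1\le\dots\le\ell_p$ are the eigenvalues of $\hat{\boldsymbol\Sigma}$ in increasing order. The QuEST estimator of $H_n$ is the empirical distribution of the coordinates of $\hat\tau$; $\tilde\lambda_{j,Q}$ denotes its $j/p$-quantile, $j=1,\dots,p$. Let $\tilde\lambda_j=\min\{\tilde\lambda_{j,Q},\frac1{\hat\xi_n(1+\varepsilon)}\}$ and let $\tilde H_n$ be the empirical distribution of $\tilde\lambda_1,\dots,\tilde\lambda_p$. Define $\hat\sigma_n>0$ by $\hat\sigma_n^3=\frac1{\hat\xi_n^3}\Big(1+y_n\int\big(\frac{\lambda\hat\xi_n}{1-\lambda\hat\xi_n}\big)^3d\tilde H_n(\lambda)\Big)$. Test statistic: $T_n=\frac{n^{2/3}}{\hat\sigma_n}\big(\lambda_1(\hat{\boldsymbol\Sigma})-\lambda_2(\hat{\boldsymbol\Sigma})\big)$. Critical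 value: $q_{1-\alpha}$ is the $(1-\alpha)$-quantile of $\zeta-\zeta'$, where $(\zeta,\zeta')$ has the two-dimensional Tracy-Widom distribution, i.e. the weak limit, as $N\to\infty$, of $N^{2/3}(\lambda_j(\mathbf W)-2)_{1\le j\le2}$, where $\mathbf W=\frac1{\sqrt{2N}}(\mathbf G+\mathbf G^\top)$ and $\mathbf G\in\mathbb R^{N\times N}$ has i.i.d. $\mathcal N(0,1)$ entries. *)

(* Defs.v *)
From HB Require Import structures.
From mathcomp Require Import all_boot all_order all_algebra.
From mathcomp Require Import all_classical all_reals all_analysis.
From mathcomp.real_closed Require Import complex.

Set Implicit Arguments.
Unset Strict Implicit.
Unset Printing Implicit Defensive.

Import Order.TTheory GRing.Theory Num.Theory.
Import numFieldNormedType.Exports.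

Local Open Scope classical_set_scope.
Local Open Scope ring_scope.
Local Open Scope complex_scope.

Section LinearAlgebra.
Context {R : realType}.

Definition psd n (A : 'M[R]_n) : Prop :=
  A^T = A /\ forall u : 'cV[R]_n, 0 <= (u^T *m A *m u) 0 0.

Definition psd_sqrt n (A : 'M[R]_n) : 'M[R]_n :=
  xget 0 [set B | psd B /\ B *m B = A].

(* For symmetric [A] such a list exists and is unique; eigenvalues are
   repeated according to multiplicity, in nonincreasing order. *)
Definition eigenvals n (A : 'M[R]_n) : seq R :=
  xget [::] [set s | sorted >=%R s /\
                     char_poly A = \prod_(a <- s) ('X - a%:P)].

(* [eigval A j] is the [j]-th largest eigenvalue, [j] counted from 1. *)
Definition eigval n (A : 'M[R]_n) (j : nat) : R := (eigenvals A)`_j.-1.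

End LinearAlgebra.

Section Probability.
Context {R : realType}.

Definition mutually_independent d (T : measurableType d) (P : probability T R)
    (I : eqType) (X : I -> {RV P >-> R}) : Prop :=
  forall (s : seq I) (A : I -> set R), uniq s ->
    (forall i, measurable (A i)) ->
    P (\bigcap_(i in [set` s]) X i @^-1` A i) =
    (\prod_(i <- s) P (X i @^-1` A i))%E.

Definition identically_distributed d (T : measurableType d)
    (P : probability T R) (I : eqType) (X : I -> {RV P >-> R}) : Prop :=
  forall i j (A : set R), measurable A ->
    distribution P (X i) A = distribution P (X j) A.

(* The array [x i j], [i, j >= 1], is indexed here by pairs of naturals from
   0. *)
Definition iid_array d (T : measurableType d) (P : probability T R)
    (x : nat * nat -> {RV P >-> R}) : Prop :=
  mutually_independent x /\ identically_distributed x.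

Definition empirical (s : seq R) : {measure set R -> \bar R} :=
  mscale ((size s)%:R^-1)%:nng (msum (fun i => \d_(s`_i)) (size s)).

Definition weak_cvg (mu_ : nat -> {measure set R -> \bar R})
    (mu : {measure set R -> \bar R}) : Prop :=
  forall f : R -> R, continuous f -> bounded_fun f ->
    (\int[mu_ n]_x f x)%R @[n --> \oo] --> (\int[mu]_x f x)%R.

Definition msupport (mu : {measure set R -> \bar R}) : set R :=
  [set x | forall U : set R, open U -> U x -> (0 < mu U)%E].

Definition quantile (mu : {measure set R -> \bar R}) (u : R) : R :=
  inf [set x | (u%:E <= mu `]-oo, x]%classic)%E].

End Probability.

Section TracyWidom.
Context {R : realType}.

Definition wigner d (T : measurableType d) (P : probability T R)
    (g : nat * nat -> {RV P >-> R}) (N : nat) (w : T) : 'M[R]_N :=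
  let G := \matrix_(i < N, j < N) g (i : nat, j : nat) w in
  (Num.sqrt (2 * N%:R))^-1 *: (G + G^T).

Definition scaled_edge d (T : measurableType d) (P : probability T R)
    (g : nat * nat -> {RV P >-> R}) (N : nat) (w : T) : R * R :=
  let e j := N%:R `^ (2 / 3) * (eigval (wigner g N w) j - 2) in
  (e 1%N, e 2%N).

(* Only the law of each N x N block matters, so realizing all of them inside
   one Gaussian array is no restriction. *)
Definition tracy_widom2 (mu : probability (R * R)%type R) : Prop :=
  exists d (T : measurableType d) (P : probability T R)
         (g : nat * nat -> {RV P >-> R}),
  [/\ mutually_independent g,
      forall i (A : set R), measurable A ->
        distribution P (g i) A = normal_prob 0 1 A &
      forall f : R * R -> R, continuous f -> bounded_fun f ->
        ('E_P[fun w => f (scaled_edge g N w)] @[N --> \oo]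
           --> \int[mu]_z (f z)%:E)%E].

Definition subp (z : R * R) : R := z.1 - z.2.

Lemma measurable_subp : measurable_fun setT subp.
Proof. by apply: measurable_realfun.measurable_funB. Qed.

HB.instance Definition _ :=
  isMeasurableFun.Build _ _ _ _ subp measurable_subp.

Definition gap_quantile (mu : probability (R * R)%type R) (u : R) : R :=
  quantile (distribution mu subp) u.

End TracyWidom.

Section Model.
Context {R : realType}.

(* Junk value 0 if there is no solution; the solution is unique as soon as
   [k < p] and [eigval Sigma k.+1 > 0]. *)
Definition crit n p (Sigma : 'M[R]_p) (k : nat) : R :=
  xget 0 [set xi | 0 < xi < (eigval Sigma k.+1)^-1 /\
    p%:R^-1 * \sum_(k.+1 <= j < p.+1)
      (eigval Sigma j * xi / (1 - eigval Sigma j * xi)) ^+ 2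
    = n%:R / p%:R].

Definition sample_cov n p (Y : 'M[R]_(n, p)) : 'M[R]_p :=
  n%:R^-1 *: (Y^T *m Y).

Definition companion_cov n p (Y : 'M[R]_(n, p)) : 'M[R]_n :=
  n%:R^-1 *: (Y *m Y^T).

Definition trimmed_stieltjes n p (Y : 'M[R]_(n, p)) (z : R) : R :=
  n%:R^-1 * \sum_(2 <= j < n.+1) (eigval (companion_cov Y) j - z)^-1.

Definition xi_hat n p (Y : 'M[R]_(n, p)) : R :=
  let l := eigval (sample_cov Y) in
  if l 2%N < l 1%N then - trimmed_stieltjes Y (l 1%N)
  else - trimmed_stieltjes Y (l 1%N + 1).

Definition stieltjes (nu : {measure set R -> \bar R}) (z : R[i]) : R[i] :=
  (\int[nu]_x complex.Re ((x%:C - z)^-1)) +i*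
  (\int[nu]_x complex.Im ((x%:C - z)^-1)).

(* The solution [m] exists and is unique when [0 < Im z] and [0 <= t]. *)
Definition quest_stieltjes n p (t : 'rV[R]_p) (z : R[i]) : R[i] :=
  let c : R[i] := p%:R / n%:R in
  xget 0 [set m |
    0 < complex.Im (- ((1 - c) / z) + c * m) /\
    m = p%:R^-1 * \sum_i ((t 0 i)%:C * (1 - c - c * z * m) - z)^-1].

(* The distribution function on [0, +oo[ whose Stieltjes transform on the upper
   half-plane is [quest_stieltjes n t]; unique by Stieltjes inversion. *)
Definition quest_cdf n p (t : 'rV[R]_p) : R -> R :=
  xget (cst 0) [set F | exists nu : probability R R,
    [/\ nu `[0, +oo[%classic = 1%E,
        forall z : R[i], 0 < complex.Im z ->
          stieltjes nu z = quest_stieltjes n t z &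
        forall x, F x = fine (nu `]-oo, x]%classic)]].

(* [i : 'I_p] counts from 0, so the integral is over [i/p, (i+1)/p]. *)
Definition quest_quantile n p (t : 'rV[R]_p) (i : 'I_p) : R :=
  p%:R * \int[lebesgue_measure]_(u in `[i%:R / p%:R, i.+1%:R / p%:R])
           sup [set x | quest_cdf n t x <= u].

Definition quest_loss n p (Y : 'M[R]_(n, p)) (t : 'rV[R]_p) : R :=
  p%:R^-1 * \sum_(i < p)
    (quest_quantile n t i - (rev (eigenvals (sample_cov Y)))`_i) ^+ 2.

Definition quest_minimizer n p (Y : 'M[R]_(n, p)) (t : 'rV[R]_p) : Prop :=
  (forall i, 0 <= t 0 i) /\
  forall t' : 'rV[R]_p, (forall i, 0 <= t' 0 i) ->
    quest_loss Y t <= quest_loss Y t'.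

(* Below, [t] is the minimizer that determines the QuEST estimator. *)
Definition tilde_eigenvals n p (eps : R) (Y : 'M[R]_(n, p)) (t : 'rV[R]_p) :
    seq R :=
  [seq Num.min
         (quantile (empirical [seq t 0 i | i <- enum 'I_p]) (j%:R / p%:R))
         (xi_hat Y * (1 + eps))^-1
  | j <- iota 1 p].

(* The base of the cube root is positive for [0 <= t], [0 < eps], [1 < n]. *)
Definition sigma_hat n p (eps : R) (Y : 'M[R]_(n, p)) (t : 'rV[R]_p) : R :=
  let xi := xi_hat Y in
  ((xi ^+ 3)^-1 *
   (1 + p%:R / n%:R *
      \int[empirical (tilde_eigenvals eps Y t)]_l
        (l * xi / (1 - l * xi)) ^+ 3)) `^ (3^-1).

Definition test_stat n p (eps : R) (Y : 'M[R]_(n, p)) (t : 'rV[R]_p) : R :=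
  n%:R `^ (2 / 3) / sigma_hat eps Y t *
  (eigval (sample_cov Y) 1 - eigval (sample_cov Y) 2).

Definition data_matrix d (T : measurableType d) (P : probability T R)
    (x : nat * nat -> {RV P >-> R}) n p (Sigma : 'M[R]_p) (w : T) :
    'M[R]_(n, p) :=
  (\matrix_(i < n, j < p) x (i : nat, j : nat) w) *m psd_sqrt Sigma.

Definition alternative n p (eps : R) (K : nat) (Sigma : 'M[R]_p) : Prop :=
  (forall j : nat, (1 <= j <= K)%N ->
     ((1 - eps) * crit n Sigma j)^-1 <= eigval Sigma j) /\
  eigval Sigma K.+1 <= ((1 + eps) * crit n Sigma K)^-1.

End Model.

(* Main.v *)
(* Let [h x = 1/x + (1/n) sum_(j >= 2) l_j / (1 - l_j x)] and [xi = 1/l_1].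
   Since [xi] stays below the critical point by a factor [1 - eps],
   [h xi - h ((1 + eps) xi)] exceeds a fixed positive constant.  The top sample
   eigenvalue is nearly at least [h xi], the second one is nearly at most
   [h ((1 + eps) xi)], and [sigma_hat] is bounded; so the statistic is at least
   of order [n^(2/3)].

   Both eigenvalue estimates compare the quadratic form of [S = X^T X / n] with
   deterministic ones by adding the rows of [X] one at a time to a barrier
   matrix, as in the argument of Batson, Spielman and Srivastava, with four-moment
   bounds on quadratic forms.  From above: a shift slightly larger than
   [1 / (n (1 - m0))] per row, [m0] being the normalized trace of [D^-1], keeps
   [D + shift - S] positive definite.  From below: with exactly that shift the
   resolvent neither grows nor shrinks along any fixed direction [e]; if [S] were
   smaller than [D + (1 / (1 - m0) - b) I], then [e D^-1 e^T] would be bounded by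
   about [1/b], which fails for [D] nearly singular in the spike direction. *)

Require Import Defs.
From HB Require Import structures.
From mathcomp Require Import all_boot all_order all_algebra.
From mathcomp Require Import all_classical all_reals all_analysis.
From mathcomp Require Import measurable_realfun.
From mathcomp Require Import ring lra.

Set Implicit Arguments.
Unset Strict Implicit.
Unset Printing Implicit Defensive.

Import Order.TTheory GRing.Theory Num.Theory.
Import numFieldNormedType.Exports.

Local Open Scope classical_set_scope.
Local Open Scope ring_scope.

(** * Spectral decomposition *)

Section Dot.
Context {R : realType}.

(** With [u = v Sigma^(1/2)], bounds on the sample covariance become comparisons of [S] with
    [t Sigma^-1]. The matrix to start from is [D = h(x) Sigma^-1 - c] with [c = x h(x)]: off the
    spike [D^-1] has eigenvalues [l_j x / (c (1 - l_j x))], of normalized trace [1 - 1/c], so the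
    total shift [1 / (1 - m0)] equals [c] and leads back to [h(x) Sigma^-1]. At [x = 1/l_1] the
    spike eigenvalue of [D] is 0; a small lift makes it positive.

    The obstacle is the estimate from below, where nothing in the exact shift keeps the matrix
    positive. It is compared with the barrier from above started at [D - g]. Lowering [D] by [g]
    raises [1 / (1 - m0)] by about [g c^2 tr(D^-2) / n], the trace taken off the spike; being
    subcritical makes this at most [(1 - eps)^2 g], so the lower process stays ahead.

    Fourth moments are used because the probability of an exceptional row must be a small multiple
    of [tr(W^2) / n^2], [W] being the current resolvent, which is what the surplus of the shift
    gains; second moments give only a constant multiple. *)

Definition dot {n} (u v : 'rV[R]_n) : R := (u *m v^T) 0 0.

Lemma dotE n (u v : 'rV[R]_n) : dot u v = \sum_i u 0 i * v 0 i.
Proof. by rewrite /dot mxE; apply: eq_bigr => i _; rewrite !mxE. Qed.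

Lemma dotC n (u v : 'rV[R]_n) : dot u v = dot v u.
Proof. by rewrite !dotE; apply: eq_bigr => i _; rewrite mulrC. Qed.

Lemma dotDl n (u v w : 'rV[R]_n) : dot (u + v) w = dot u w + dot v w.
Proof. by rewrite /dot mulmxDl mxE. Qed.

Lemma dotDr n (u v w : 'rV[R]_n) : dot w (u + v) = dot w u + dot w v.
Proof. by rewrite dotC dotDl !(dotC w). Qed.

Lemma dotZl n k (u v : 'rV[R]_n) : dot (k *: u) v = k * dot u v.
Proof. by rewrite /dot -scalemxAl mxE. Qed.

Lemma dotZr n k (u v : 'rV[R]_n) : dot u (k *: v) = k * dot u v.
Proof. by rewrite dotC dotZl dotC. Qed.

Lemma dotNl n (u v : 'rV[R]_n) : dot (- u) v = - dot u v.
Proof. by rewrite -scaleN1r dotZl mulN1r. Qed.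

Lemma dotBl n (u v w : 'rV[R]_n) : dot (u - v) w = dot u w - dot v w.
Proof. by rewrite dotDl dotNl. Qed.

Lemma dot0l n (u : 'rV[R]_n) : dot 0 u = 0.
Proof. by rewrite -(scale0r 0) dotZl mul0r. Qed.

Lemma dot_mull m n (u : 'rV[R]_m) (M : 'M[R]_(m, n)) (v : 'rV[R]_n) :
  dot (u *m M) v = dot u (v *m M^T).
Proof. by rewrite /dot trmx_mul trmxK mulmxA. Qed.

Lemma dot_ge0 n (u : 'rV[R]_n) : 0 <= dot u u.
Proof. by rewrite dotE; apply: sumr_ge0 => i _; rewrite -expr2 sqr_ge0. Qed.

Lemma dot_eq0 n (u : 'rV[R]_n) : (dot u u == 0) = (u == 0).
Proof.
apply/idP/eqP => [|->]; last by rewrite dot0l.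
rewrite dotE psumr_eq0 => [/allP u0|i _]; last by rewrite -expr2 sqr_ge0.
apply/rowP => i; rewrite mxE; apply/eqP.
by have := u0 i (mem_index_enum _); rewrite -expr2 sqrf_eq0.
Qed.

Lemma dot_gt0 n (u : 'rV[R]_n) : (0 < dot u u) = (u != 0).
Proof. by rewrite lt_neqAle dot_ge0 andbT eq_sym dot_eq0. Qed.

Lemma dot_CS n (u v : 'rV[R]_n) : dot u v ^+ 2 <= dot u u * dot v v.
Proof.
have [->|v0] := eqVneq v 0; first by rewrite dotC !dot0l expr0n mulr0.
rewrite -dot_gt0 in v0.
have := dot_ge0 (dot v v *: u - dot u v *: v).
rewrite dotBl !dotZl !(dotC _ (_ - _)) !dotBl !dotZl (dotC v u) => H.
have {}H : 0 <= dot v v * (dot u u * dot v v - dot u v ^+ 2).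
  by rewrite (le_trans H) // le_eqVlt; apply/orP; left; apply/eqP; ring.
by rewrite pmulr_rge0 // subr_ge0 in H.
Qed.

(** The first-order condition at a maximum of the Rayleigh quotient: for [t] a small multiple of
    [b], a nonzero linear term would dominate the quadratic one. *)
Lemma sqr_perturb (b c : R) : (forall t, 2 * t * b + t ^+ 2 * c <= 0) -> b = 0.
Proof.
move=> H; have [//|b0] := eqVneq b 0.
have cp : 0 < 1 + `|c| by rewrite ltr_pwDl.
have := H (b / (1 + `|c|)); have -> : 2 * (b / (1 + `|c|)) * b +
    (b / (1 + `|c|)) ^+ 2 * c = (b / (1 + `|c|)) ^+ 2 * (2 * (1 + `|c|) + c).
  by field; rewrite gt_eqF.
rewrite leNgt mulr_gt0 //.
  by rewrite exprn_even_gt0 //= mulf_neq0 // invr_neq0 // gt_eqF.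
by have := ler_norm (- c); rewrite normrN; have := normr_ge0 c; lra.
Qed.

Lemma exists_orth n k (v : nat -> 'rV[R]_n) : (k < n)%N ->
  exists2 u, dot u u = 1 & forall i, (i < k)%N -> dot u (v i) = 0.
Proof.
move=> kn; pose V : 'M[R]_(k, n) := \matrix_(i < k) v i.
have : kermx V^T != 0.
  by rewrite kermx_eq0 -row_leq_rank -ltnNge mxrank_tr (leq_ltn_trans (rank_leq_row _)).
case/matrix0Pn => i [j nz].
pose u := row i (kermx V^T).
have u0 : u != 0 by apply/eqP => /rowP/(_ j); rewrite mxE [RHS]mxE; apply/eqP.
have uV : u *m V^T = 0 by rewrite -row_mul mulmx_ker row0.
move: u u0 uV => u u0 uV {nz}.
have du : 0 < Num.sqrt (dot u u) by rewrite sqrtr_gt0 dot_gt0.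
exists ((Num.sqrt (dot u u))^-1 *: u).
  rewrite dotZl dotZr mulrA -invfM -expr2 sqr_sqrtr ?dot_ge0 // mulVf //.
  by rewrite dot_eq0.
move=> l lk; rewrite dotZl; suff -> : dot u (v l) = 0 by rewrite mulr0.
rewrite dotE.
transitivity ((u *m V^T) 0 (Ordinal lk)); last by rewrite uV mxE.
by rewrite [RHS]mxE; apply: eq_bigr => a _; rewrite !mxE.
Qed.

Lemma continuous_quad n (M : 'M[R]_n.+1) :
  continuous (fun u : 'rV[R]_n.+1 => dot (u *m M) u).
Proof.
have -> : (fun u : 'rV[R]_n.+1 => dot (u *m M) u) =
    (fun u => \sum_i \sum_j u 0 i * (M i j * u 0 j)).
  apply/funext => u; rewrite dotE exchange_big; apply: eq_bigr => i _ /=.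
  by rewrite mxE mulr_suml; apply: eq_bigr => j _; rewrite mulrA.
move=> u; have Fu : Filter (nbhs u) := nbhs_filter u.
apply: cvg_big => [|i _]; first exact: add_continuous.
apply: cvg_big => [|j _]; first exact: add_continuous.
apply: cvgM; first exact: coord_continuous.
by apply: cvgMr; exact: coord_continuous.
Qed.

Lemma continuous_dotr n (v : 'rV[R]_n.+1) : continuous (fun u : 'rV[R]_n.+1 => dot u v).
Proof.
have -> : (fun u : 'rV[R]_n.+1 => dot u v) = (fun u => \sum_i u 0 i * v 0 i).
  by apply/funext => u; rewrite dotE.
move=> u; have Fu : Filter (nbhs u) := nbhs_filter u.
apply: cvg_big => [|i _]; first exact: add_continuous.
by apply: cvgMl; exact: coord_continuous.
Qed.

(* [u] maximizes the Rayleigh quotient on the orthogonal complement of [v]. *)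
Lemma rayleigh_step n k (M : 'M[R]_n) (v : nat -> 'rV[R]_n) (d : nat -> R) :
  M^T = M -> (k < n)%N -> (forall i, (i < k)%N -> v i *m M = d i *: v i) ->
  exists u r, [/\ dot u u = 1, forall i, (i < k)%N -> dot u (v i) = 0,
    u *m M = r *: u & forall t, (forall i, (i < k)%N -> dot t (v i) = 0) ->
      dot (t *m M) t <= r * dot t t].
Proof.
case: n M v => [//|n] M v symM kn ev.
pose K := [set u : 'rV[R]_n.+1 | dot u u = 1 /\
                               forall i, (i < k)%N -> dot u (v i) = 0].
have K0 : K !=set0 by have [u u1 uv] := exists_orth v kn; exists u.
have cK : compact K.
  apply: bounded_closed_compact.
    exists 1; split; first exact: num_real.
    move=> M' M1 u [u1 _]; apply: le_trans (ltW M1).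
    rewrite [leLHS]/Num.norm /= mx_normrE; apply/bigmax_leP; split => //= -[a b] _ /=.
    rewrite -(@ler_pXn2r _ 2) ?nnegrE // expr1n -u1 dotE real_normK ?num_real //.
    rewrite (ord1 a) (bigD1 b) //= expr2 lerDl; apply: sumr_ge0 => i _.
    by rewrite -expr2 sqr_ge0.
  have -> : K = (fun u => dot (u *m 1%:M) u) @^-1` [set 1] `&`
      \bigcap_(i in [set i | (i < k)%N]) ((fun u => dot u (v i)) @^-1` [set 0]).
    by apply/seteqP; split => u /=; rewrite mulmx1.
  apply: closedI.
    by apply: closed_comp => [u _|]; [exact: continuous_quad|exact: closed_eq].
  apply: closed_bigI => i _.
  by apply: closed_comp => [u _|]; [exact: continuous_dotr|exact: closed_eq].
have [|u /[!inE] -[u1 uv] umax] := @EVT_max_rV R n.+1 (fun u => dot (u *m M) u) K K0 cK.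
  by apply: continuous_subspaceT; exact: continuous_quad.
pose r := dot (u *m M) u.
have bnd t : (forall i, (i < k)%N -> dot t (v i) = 0) ->
    dot (t *m M) t <= r * dot t t.
  move=> tv; have [->|t0] := eqVneq t 0; first by rewrite mul0mx !dot0l mulr0.
  have dt : 0 < dot t t by rewrite dot_gt0.
  have st : 0 < Num.sqrt (dot t t) by rewrite sqrtr_gt0.
  have /umax : (Num.sqrt (dot t t))^-1 *: t \in K.
    rewrite inE; split=> [|i ik]; last by rewrite dotZl tv // mulr0.
    by rewrite dotZl dotZr mulrA -invfM -expr2 sqr_sqrtr ?ltW // mulVf // gt_eqF.
  rewrite -scalemxAl dotZl dotZr mulrA -invfM -expr2 sqr_sqrtr ?(ltW dt) //.
  by rewrite ler_pdivrMl // mulrC.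
have symdot s t : dot (s *m M) t = dot (t *m M) s by rewrite dot_mull symM dotC.
exists u, r; split => //.
(* The first variation vanishes in every direction of the complement. Since [M] is symmetric and
   fixes the earlier eigenlines, the residual [u *m M - r *: u] lies in the complement itself, so it
   is orthogonal to itself. *)
have orth t : (forall i, (i < k)%N -> dot t (v i) = 0) -> dot (u *m M - r *: u) t = 0.
  move=> tv; apply: (@sqr_perturb _ (dot (t *m M) t - r * dot t t)) => c.
  have cv i : (i < k)%N -> dot (u + c *: t) (v i) = 0.
    by move=> ik; rewrite dotDl dotZl uv // tv // mulr0 addr0.
  have := bnd _ cv; rewrite mulmxDl -scalemxAl !(dotDl, dotDr, dotZl, dotZr).
  rewrite dotNl dotZl (symdot t u) (dotC t u) u1 -/r; lra.
apply/eqP; rewrite -subr_eq0 -dot_eq0; apply/eqP/orth => i ik.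
by rewrite dotBl dotZl uv // mulr0 subr0 symdot ev // dotZl dotC uv // mulr0.
Qed.

(* The eigenvectors are the rows of [Q]. *)
Definition spectral n (M Q : 'M[R]_n) (d : 'rV[R]_n) : Prop :=
  [/\ Q *m Q^T = 1%:M, M = Q^T *m diag_mx d *m Q &
      forall i j : 'I_n, (i <= j)%N -> d 0 j <= d 0 i].

(** Eigenvectors are produced one at a time, indexed by naturals so that the family extends without
    casts. Maximality stays in the invariant because the ordering of the eigenvalues comes from
    testing the [i]-th maximum on a later [v j]. *)
Lemma sym_spectral n (M : 'M[R]_n) : M^T = M -> exists Q d, spectral M Q d.
Proof.
move=> symM.
have [v [d H]] : exists (v : nat -> 'rV[R]_n) (d : nat -> R), forall j, (j < n)%N ->
    [/\ dot (v j) (v j) = 1, forall i, (i < j)%N -> dot (v j) (v i) = 0,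
    v j *m M = d j *: v j & forall t, (forall i, (i < j)%N -> dot t (v i) = 0) ->
      dot (t *m M) t <= d j * dot t t].
  suff {}H k : (k <= n)%N ->
      exists (v : nat -> 'rV[R]_n) (d : nat -> R), forall j, (j < k)%N ->
    [/\ dot (v j) (v j) = 1, forall i, (i < j)%N -> dot (v j) (v i) = 0,
    v j *m M = d j *: v j & forall t, (forall i, (i < j)%N -> dot t (v i) = 0) ->
      dot (t *m M) t <= d j * dot t t] by exact: H.
  elim: k => [_|k IH kn]; first by exists (fun=> 0), (fun=> 0).
  have [v [d vd]] := IH (ltnW kn).
  have [|u [r [u1 uv uM umax]]] := rayleigh_step symM kn (v := v) (d := d).
    by move=> i /vd[].
  exists (fun j => if j == k then u else v j), (fun j => if j == k then r else d j).
  move=> j; rewrite ltnS leq_eqVlt => /predU1P[->|jk].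
    rewrite eqxx; split => // [i ik|t tv]; first by rewrite ltn_eqF // uv.
    by apply: umax => i ik; have := tv i ik; rewrite ltn_eqF.
  rewrite ltn_eqF //; have [v1 vv vM vmax] := vd _ jk; split => // [i ij|t tv].
    by rewrite ltn_eqF ?(ltn_trans ij) // vv.
  by apply: vmax => i ij; have := tv i ij; rewrite ltn_eqF // (ltn_trans ij).
pose Q : 'M[R]_n := \matrix_(i < n) v i.
pose D : 'rV[R]_n := \row_i d i.
have OO : Q *m Q^T = 1%:M.
  apply/matrixP => i j.
  have -> : (Q *m Q^T) i j = dot (v i) (v j).
    by rewrite dotE mxE; apply: eq_bigr => a _; rewrite !mxE.
  rewrite mxE; have [vi ovi _ _] := H i (ltn_ord i).
  have [_ ovj _ _] := H j (ltn_ord j).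
  have [->|] := eqVneq i j; first by have [-> _ _ _] := H j (ltn_ord j).
  rewrite -val_eqE neq_ltn => /orP[ij|ij]; last by rewrite ovi.
  by rewrite dotC ovj.
exists Q, D; split => // [|i j ij].
  have OM : Q *m M = diag_mx D *m Q.
    apply/row_matrixP => i; rewrite row_mul mul_diag_mx rowK.
    have [_ _ -> _] := H i (ltn_ord i).
    by apply/rowP => a; rewrite !mxE.
  by rewrite -mulmxA -OM mulmxA (mulmx1C OO) mul1mx.
rewrite !mxE; have [vj ovj vjM _] := H j (ltn_ord j).
have [_ _ _ imax] := H i (ltn_ord i).
have := imax (v j); rewrite vjM dotZl vj !mulr1; apply => a ai.
by rewrite ovj // (leq_trans ai).
Qed.

Section SpectralFacts.
Variables (n : nat) (M Q : 'M[R]_n) (d : 'rV[R]_n).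
Hypothesis sp : spectral M Q d.

Lemma spectral_orthT : Q^T *m Q = 1%:M.
Proof. by case: sp => OO _ _; exact: mulmx1C. Qed.

Lemma dot_orthT (u v : 'rV[R]_n) : dot (u *m Q^T) (v *m Q^T) = dot u v.
Proof. by rewrite dot_mull trmxK -mulmxA spectral_orthT mulmx1. Qed.

Lemma dot_spectral (u : 'rV[R]_n) :
  dot (u *m M) u = \sum_i d 0 i * (u *m Q^T) 0 i ^+ 2.
Proof.
case: sp => _ -> _; rewrite !mulmxA dot_mull dotE; apply: eq_bigr => i _.
by rewrite -!mulmxA mulmxA mul_mx_diag mxE expr2 mulrA [d _ _ * _]mulrC.
Qed.

(** Conjugation by the orthogonal [Q] preserves [char_poly], so both lists have the same multiset of
    roots, and a sorted list is determined by its multiset. *)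
Lemma eigenvals_spectral : eigenvals M = [seq d 0 i | i <- enum 'I_n].
Proof.
case: sp => OO ME dS.
have cp : char_poly M = \prod_(a <- [seq d 0 i | i <- enum 'I_n]) ('X - a%:P).
  have -> : char_poly M = char_poly (diag_mx d).
    rewrite /char_poly /char_poly_mx.
    have -> : 'X%:M - map_mx polyC M =
        map_mx polyC Q^T *m ('X%:M - map_mx polyC (diag_mx d)) *m map_mx polyC Q.
      rewrite mulmxBr mulmxBl -!map_mxM -ME mul_mx_scalar -scalemxAl.
      by rewrite -map_mxM spectral_orthT map_mx1 scalemx1.
    rewrite !det_mulmx mulrAC -det_mulmx -map_mxM spectral_orthT map_mx1 det1.
    by rewrite mul1r.
  rewrite char_poly_trig ?diag_mx_is_trig // big_map big_enum /=.
  by apply: eq_bigr => i _; rewrite mxE eqxx.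
have st : sorted >=%R [seq d 0 i | i <- enum 'I_n].
  have nthE j (jn : (j < n)%N) : [seq d 0 i | i <- enum 'I_n]`_j = d 0 (Ordinal jn).
    rewrite (nth_map (Ordinal jn)) ?size_enum_ord //.
    by congr (d 0 _); exact: (nth_ord_enum _ (Ordinal jn)).
  apply/(sortedP 0) => i; rewrite size_map size_enum_ord => i1n.
  by rewrite (nthE _ i1n) (nthE _ (ltnW i1n)); exact: dS.
have [ss cs] := xgetPex [::] (ex_intro [set s | sorted >=%R s /\
  char_poly M = \prod_(a <- s) ('X - a%:P)] _ (conj st cp)).
rewrite -/(eigenvals M) in ss cs.
apply: (sorted_eq _ _ ss st); last by apply: prod_XsubC_eq; rewrite -cs.
  by move=> a b c; rewrite /= => ba ac; exact: le_trans ac ba.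
by move=> a b /andP[ab ba]; apply/le_anti/andP.
Qed.

Lemma eigval_spectral (j : 'I_n) : eigval M j.+1 = d 0 j.
Proof.
rewrite /eigval eigenvals_spectral /= (nth_map j) ?size_enum_ord //.
by rewrite nth_ord_enum.
Qed.

Lemma eigvec_spectral (j : 'I_n) : row j Q *m M = d 0 j *: row j Q.
Proof.
case: sp => OO -> _; rewrite !mulmxA -row_mul OO row1.
by rewrite -rowE row_diag_mx -scalemxAl -rowE.
Qed.

Lemma dot_row_spectral (i j : 'I_n) : dot (row i Q) (row j Q) = (i == j)%:R.
Proof.
case: sp => /matrixP/(_ i j); rewrite mxE [RHS]mxE => <- _ _.
by rewrite dotE; apply: eq_bigr => a _; rewrite !mxE.
Qed.

(* Courant-Fischer: the span of the first [j.+1] eigenvectors meets every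
   subspace of codimension at most [j]. *)
Lemma spectral_codim_le (j : 'I_n) m (L : 'M[R]_(n, m)) z : (m <= j)%N ->
  (forall u, u *m L = 0 -> dot (u *m M) u <= z * dot u u) -> d 0 j <= z.
Proof.
move=> mj H.
pose E : 'M[R]_(j.+1, n) := \matrix_(a, i) (a == i :> nat)%:R.
have : kermx (E *m Q *m L) != 0.
  by rewrite kermx_eq0 -row_leq_rank -ltnNge ltnS (leq_trans (rank_leq_col _)).
case/matrix0Pn => a [b nz].
have : row a (kermx (E *m Q *m L)) != 0.
  by apply/eqP => /rowP/(_ b); rewrite mxE [RHS]mxE; apply/eqP.
have : row a (kermx (E *m Q *m L)) *m (E *m Q *m L) = 0.
  by rewrite -row_mul mulmx_ker row0.
move: (row a _) => c; rewrite !mulmxA => /H; rewrite dot_spectral -dot_orthT.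
have -> : c *m E *m Q *m Q^T = c *m E.
  by case: sp => OO _ _; rewrite -mulmxA OO mulmx1.
have cE (i : 'I_n) : (j < i)%N -> (c *m E) 0 i = 0.
  move=> ji; rewrite mxE big1 // => l _; rewrite mxE ltn_eqF ?mulr0 //.
  exact: leq_trans (ltn_ord l) ji.
move=> le_z c0; rewrite leNgt; apply/negP => zd.
have cE0 : c *m E != 0.
  case/rV0Pn: c0 => l cl; apply/rV0Pn.
  exists (widen_ord (ltn_ord j) l); rewrite mxE (bigD1 l) //= !mxE eqxx mulr1.
  rewrite big1 => [|l' ll']; first by rewrite addr0.
  by rewrite mxE /= -[_ == _]/(l' == l) (negPf ll') mulr0.
rewrite -dot_gt0 in cE0; move: le_z; apply/negP; rewrite -ltNge.
apply: (@lt_le_trans _ _ (d 0 j * dot (c *m E) (c *m E))); first by rewrite ltr_pM2r.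
rewrite dotE mulr_sumr; apply: ler_sum => i _; rewrite -expr2.
have [ij|ji] := leqP i j; last by rewrite cE // expr0n /= !mulr0.
by case: sp => _ _ dS; rewrite ler_wpM2r ?sqr_ge0 ?dS.
Qed.

Lemma spectral_codim_ge (j : nat) (u : 'rV[R]_n) (i0 : 'I_n) : (i0 <= j)%N ->
  (forall i : 'I_n, (i < i0)%N -> (u *m Q^T) 0 i = 0) ->
  dot (u *m M) u <= d 0 i0 * dot u u.
Proof.
move=> _ u0; rewrite dot_spectral -dot_orthT dotE mulr_sumr.
apply: ler_sum => i _; rewrite -expr2.
have [ij|ji] := ltnP i i0; first by rewrite u0 // expr0n /= !mulr0.
by case: sp => _ _ dS; rewrite ler_wpM2r ?sqr_ge0 ?dS.
Qed.

End SpectralFacts.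

Lemma size_eigenvals n (M : 'M[R]_n) : M^T = M -> size (eigenvals M) = n.
Proof.
by case/sym_spectral=> Q [d] /eigenvals_spectral->; rewrite size_map size_enum_ord.
Qed.

Lemma eigval_out n (M : 'M[R]_n) j : M^T = M -> (n < j)%N -> eigval M j = 0.
Proof.
move=> sM nj; rewrite /eigval nth_default // size_eigenvals //.
by case: j nj.
Qed.

Lemma eigval_codim_le n (M : 'M[R]_n) (j m : nat) (L : 'M[R]_(n, m)) z :
  M^T = M -> (m <= j < n)%N ->
  (forall u, u *m L = 0 -> dot (u *m M) u <= z * dot u u) -> eigval M j.+1 <= z.
Proof.
move=> /sym_spectral[Q [d sp]] /andP[mj jn] H.
rewrite (eigval_spectral sp (Ordinal jn)).
exact: (spectral_codim_le sp (j := Ordinal jn) mj H).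
Qed.

Lemma eigval1_le n (M : 'M[R]_n) z : M^T = M -> 0 <= z ->
  (forall u, dot (u *m M) u <= z * dot u u) -> eigval M 1 <= z.
Proof.
case: n M => [|n] M sM z0 H; first by rewrite eigval_out.
by apply: (@eigval_codim_le _ _ _ 0 (const_mx 0)).
Qed.

Lemma eigval1_ge n (M : 'M[R]_n) u : M^T = M ->
  dot (u *m M) u <= eigval M 1 * dot u u.
Proof.
case: n M u => [|n] M u sM; first by rewrite !dotE !big_ord0 mulr0.
have [Q [d sp]] := sym_spectral sM.
by rewrite (eigval_spectral sp ord0) (spectral_codim_ge sp (j := 0%N)).
Qed.

(** Courant-Fischer for [M] on the orthogonal complement of the top eigenvectors of [M'], where the
    form of [M'] is at most its next eigenvalue. *)
Lemma eigval_weyl n (M M' : 'M[R]_n) t j : M^T = M -> M'^T = M' ->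
  (0 < j <= n)%N ->
  (forall u, dot (u *m M) u <= dot (u *m M') u + t * dot u u) ->
  eigval M j <= eigval M' j + t.
Proof.
case: j => [//|j] sM sM' /= jn H; have [Q [d sp]] := sym_spectral sM'.
pose L : 'M[R]_(n, j) := \matrix_(a, i) Q (widen_ord (ltnW jn) i) a.
apply: (@eigval_codim_le _ _ _ j L); rewrite ?leqnn // => u uL.
rewrite (le_trans (H u)) // mulrDl lerD2r (eigval_spectral sp (Ordinal jn)).
apply: (spectral_codim_ge sp (j := j)) => // i ij.
have -> : (u *m Q^T) 0 i = (u *m L) 0 (Ordinal ij).
  rewrite !mxE; apply: eq_bigr => a _; rewrite !mxE.
  by congr (_ * Q _ _); exact: val_inj.
by rewrite uL mxE.
Qed.

Lemma eigval_ge0 n (M : 'M[R]_n) j : M^T = M ->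
  (forall u, 0 <= dot (u *m M) u) -> 0 <= eigval M j.+1.
Proof.
move=> sM H; have [jn|nj] := ltnP j n; last by rewrite eigval_out.
have [Q [d sp]] := sym_spectral sM; rewrite (eigval_spectral sp (Ordinal jn)).
have := H (row (Ordinal jn) Q).
by rewrite (eigvec_spectral sp) dotZl (dot_row_spectral sp) eqxx mulr1.
Qed.

Lemma eigval_sorted n (M : 'M[R]_n) i j : M^T = M -> (i <= j < n)%N ->
  eigval M j.+1 <= eigval M i.+1.
Proof.
move=> /sym_spectral[Q [d sp]] /andP[ij jn].
rewrite (eigval_spectral sp (Ordinal jn)).
rewrite (eigval_spectral sp (Ordinal (leq_ltn_trans ij jn))).
by case: sp => _ _; apply.
Qed.

Lemma psd_sqrtP n (M : 'M[R]_n) : psd M ->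
  (psd_sqrt M)^T = psd_sqrt M /\ psd_sqrt M *m psd_sqrt M = M.
Proof.
move=> [sM pM]; rewrite /psd_sqrt.
case: xgetP => [B -> [[sB _] BB] //|].
have [Q [d sp]] := sym_spectral sM.
have d0 j : 0 <= d 0 j.
  have := pM (row j Q)^T; rewrite trmxK (eigvec_spectral sp) -scalemxAl mxE.
  by rewrite -/(dot _ _) (dot_row_spectral sp) eqxx mulr1.
pose s : 'rV[R]_n := \row_i Num.sqrt (d 0 i).
have [OO ME _] := sp; have OT := spectral_orthT sp.
move/(_ (Q^T *m diag_mx s *m Q)); case; split; last first.
  rewrite !mulmxA -[_ *m Q *m Q^T]mulmxA OO mulmx1 -[Q^T *m _ *m _]mulmxA mulmx_diag.
  rewrite ME; congr (_ *m diag_mx _ *m _); apply/rowP => i.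
  by rewrite !mxE -expr2 sqr_sqrtr.
split=> [|u]; first by rewrite !trmx_mul trmxK tr_diag_mx mulmxA.
have -> : (u^T *m (Q^T *m diag_mx s *m Q) *m u) 0 0 =
    \sum_i s 0 i * (Q *m u) i 0 ^+ 2.
  rewrite !mulmxA -trmx_mul -mulmxA mxE; apply: eq_bigr => i _.
  by rewrite mul_mx_diag !mxE; ring.
by apply: sumr_ge0 => i _; rewrite mulr_ge0 ?sqr_ge0 // mxE sqrtr_ge0.
Qed.

End Dot.
(** * Resolvents and rank-one updates *)

Section Resolvent.
Context {R : realType}.

Definition posdef n (M : 'M[R]_n) : Prop :=
  M^T = M /\ forall u, u != 0 -> 0 < dot (u *m M) u.

Lemma dot_scalar n a (u : 'rV[R]_n) : dot (u *m a%:M) u = a * dot u u.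
Proof. by rewrite mul_mx_scalar dotZl. Qed.

Lemma dot_outer n (u x : 'rV[R]_n) : dot (u *m (x^T *m x)) u = dot u x ^+ 2.
Proof.
by rewrite mulmxA [u *m x^T]mx11_scalar mul_scalar_mx dotZl [dot x u]dotC expr2.
Qed.

Lemma posdef_ge0 n (M : 'M[R]_n) u : posdef M -> 0 <= dot (u *m M) u.
Proof.
move=> [_ pM]; have [->|/pM/ltW//] := eqVneq u 0; by rewrite mul0mx dot0l.
Qed.

Section Diagonal.
Variables (n : nat) (Q : 'M[R]_n).
Hypothesis OQ : Q *m Q^T = 1%:M.

(** Functional calculus in the orthonormal basis formed by the rows of [Q]: matrices diagonal in
    this basis are added, multiplied and inverted as functions of the index. *)
Definition sfun (f : 'I_n -> R) : 'M[R]_n := Q^T *m diag_mx (\row_i f i) *m Q.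

Lemma sfunM f g : sfun f *m sfun g = sfun (fun i => f i * g i).
Proof.
rewrite /sfun !mulmxA -[_ *m Q *m Q^T]mulmxA OQ mulmx1 -[Q^T *m _ *m _]mulmxA.
rewrite mulmx_diag; congr (_ *m diag_mx _ *m _).
by apply/rowP => i; rewrite !mxE.
Qed.

Lemma sfunD f g : sfun f + sfun g = sfun (fun i => f i + g i).
Proof.
rewrite /sfun -mulmxDl -mulmxDr -raddfD /=; congr (_ *m diag_mx _ *m _).
by apply/rowP => i; rewrite !mxE.
Qed.

Lemma sfun_scalar a : sfun (fun=> a) = a%:M.
Proof.
rewrite /sfun (_ : \row_i a = const_mx a); last by apply/rowP => i; rewrite !mxE.
by rewrite diag_const_mx mul_mx_scalar -scalemxAl (mulmx1C OQ) scalemx1.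
Qed.

Lemma sfun_tr f : (sfun f)^T = sfun f.
Proof. by rewrite /sfun !trmx_mul trmxK tr_diag_mx mulmxA. Qed.

Lemma mxtrace_sfun f : \tr (sfun f) = \sum_i f i.
Proof.
rewrite /sfun -mulmxA mxtrace_mulC -mulmxA OQ mulmx1 mxtrace_diag.
by apply: eq_bigr => i _; rewrite mxE.
Qed.

Lemma dot_sfun f u : dot (u *m sfun f) u = \sum_i f i * (u *m Q^T) 0 i ^+ 2.
Proof.
rewrite /sfun !mulmxA dot_mull dotE; apply: eq_bigr => i _.
by rewrite mul_mx_diag !mxE; ring.
Qed.

Lemma dot_coord u : dot u u = \sum_i (u *m Q^T) 0 i ^+ 2.
Proof.
rewrite -{1}[u]mulmx1 -(sfun_scalar 1) dot_sfun.
by apply: eq_bigr => i _; rewrite mul1r.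
Qed.

Lemma sfun_inv f : (forall i, f i != 0) ->
  sfun f \in unitmx /\ invmx (sfun f) = sfun (fun i => (f i)^-1).
Proof.
move=> f0; have H : sfun f *m sfun (fun i => (f i)^-1) = 1%:M.
  rewrite sfunM -(sfun_scalar 1); congr sfun; apply/funext => i.
  by rewrite mulfV.
have uM := (mulmx1_unit H).1; split => //.
by rewrite -[RHS]mul1mx -(mulVmx uM) -mulmxA H mulmx1.
Qed.

Lemma row_sfun f i : row i Q *m sfun f = f i *: row i Q.
Proof.
rewrite /sfun !mulmxA -row_mul OQ row1 -rowE row_diag_mx -scalemxAl -rowE.
by rewrite mxE.
Qed.

Lemma sfun_le f g u : (forall i, f i <= g i) ->
  dot (u *m sfun f) u <= dot (u *m sfun g) u.
Proof.
by move=> fg; rewrite !dot_sfun; apply: ler_sum => i _; rewrite ler_wpM2r ?sqr_ge0.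
Qed.

Lemma sfun_posdef f : (forall i, 0 < f i) -> posdef (sfun f).
Proof.
move=> f0; split=> [|u]; first exact: sfun_tr.
rewrite -dot_gt0 dot_coord dot_sfun => H.
rewrite lt_neqAle sumr_ge0 ?andbT; last by move=> i _; rewrite mulr_ge0 ?sqr_ge0 ?ltW.
apply/eqP => /esym/eqP; rewrite psumr_eq0; last first.
  by move=> i _; rewrite mulr_ge0 ?sqr_ge0 ?ltW.
move=> /allP a0; move: H; rewrite big1 ?ltxx // => i _.
by have := a0 i (mem_index_enum _); rewrite /= mulf_eq0 gt_eqF //= => /eqP.
Qed.

End Diagonal.

Lemma spectral_sfun n (M Q : 'M[R]_n) d : spectral M Q d ->
  Q *m Q^T = 1%:M /\ M = sfun Q (d 0).
Proof.
case=> OQ -> _; split => //; congr (_ *m diag_mx _ *m _).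
by apply/rowP => i; rewrite mxE.
Qed.

Lemma sym_sfun n (M : 'M[R]_n) : M^T = M ->
  exists Q f, Q *m Q^T = 1%:M /\ M = sfun Q f.
Proof. by case/sym_spectral=> Q [d] /spectral_sfun[]; exists Q, (d 0). Qed.

Lemma dot_row_orth n (Q : 'M[R]_n) i j : Q *m Q^T = 1%:M ->
  dot (row i Q) (row j Q) = (i == j)%:R.
Proof.
move=> /matrixP/(_ i j); rewrite mxE [RHS]mxE => <-.
by rewrite dotE; apply: eq_bigr => a _; rewrite !mxE.
Qed.

Lemma sfun_lower n (Q : 'M[R]_n) f nu : Q *m Q^T = 1%:M ->
  (forall u, nu * dot u u <= dot (u *m sfun Q f) u) -> forall i, nu <= f i.
Proof.
move=> OQ H i; have := H (row i Q).
by rewrite row_sfun // dotZl dot_row_orth // eqxx !mulr1.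
Qed.

Lemma posdef_sfun n (M : 'M[R]_n) : posdef M ->
  exists Q f, [/\ Q *m Q^T = 1%:M, M = sfun Q f & forall i, 0 < f i].
Proof.
move=> [sM pM]; have [Q [f [OQ ME]]] := sym_sfun sM; exists Q, f; split => // i.
have := pM (row i Q); rewrite ME row_sfun // dotZl dot_row_orth // eqxx mulr1.
apply; apply/eqP => r0; have := dot_row_orth i i OQ.
by rewrite r0 dot0l eqxx => /eqP; rewrite eq_sym oner_eq0.
Qed.

Lemma posdef_unit n (M : 'M[R]_n) : posdef M -> M \in unitmx.
Proof.
case/posdef_sfun=> Q [f [OQ -> f0]].
by have [] := sfun_inv OQ (f := f) => [i|]; rewrite ?gt_eqF.
Qed.

Lemma posdef_inv n (M : 'M[R]_n) : posdef M -> posdef (invmx M).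
Proof.
case/posdef_sfun=> Q [f [OQ -> f0]].
have [|_ ->] := sfun_inv OQ (f := f); first by move=> i; rewrite gt_eqF.
by apply: sfun_posdef => // i; rewrite invr_gt0.
Qed.

(** Ordinary Cauchy-Schwarz for [u] times the square root of [M] and [v] times its inverse root. *)
Lemma posdef_CS n (M : 'M[R]_n) u v : posdef M ->
  dot u v ^+ 2 <= dot (u *m M) u * dot (v *m invmx M) v.
Proof.
case/posdef_sfun=> Q [f [OQ -> f0]].
have [|_ ->] := sfun_inv OQ (f := f); first by move=> i; rewrite gt_eqF.
pose r i := Num.sqrt (f i).
have rE i : f i = r i ^+ 2 by rewrite sqr_sqrtr // ltW.
have r0 i : r i != 0 by rewrite gt_eqF // sqrtr_gt0.
have -> : sfun Q f = sfun Q r *m (sfun Q r)^T.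
  by rewrite sfun_tr sfunM //; congr sfun; apply/funext => i; rewrite rE.
have -> : sfun Q (fun i => (f i)^-1) =
   sfun Q (fun i => (r i)^-1) *m (sfun Q (fun i => (r i)^-1))^T.
  by rewrite sfun_tr sfunM //; congr sfun; apply/funext => i;
    rewrite rE -exprVn.
have dS (w : 'rV[R]_n) S : dot (w *m (S *m S^T)) w = dot (w *m S) (w *m S).
  by rewrite mulmxA dot_mull trmxK.
rewrite !dS.
apply: le_trans (dot_CS _ _); rewrite dot_mull sfun_tr -mulmxA sfunM //.
rewrite (_ : (fun i => _) = fun=> 1) ?sfun_scalar ?mulmx1 //.
by apply/funext => i; rewrite mulVf.
Qed.

Section ShermanMorrison.
Variables (n : nat) (B : 'M[R]_n) (x : 'rV[R]_n) (N : R).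
Hypotheses (N0 : 0 < N) (pB : posdef B).
Let W := invmx B.
Let q := dot (x *m W) x / N.
Let B' := B - N^-1 *: (x^T *m x).

Lemma rank1_quad u : dot (u *m B') u = dot (u *m B) u - dot u x ^+ 2 / N.
Proof.
by rewrite mulmxBr dotBl -scalemxAr dotZl dot_outer mulrC.
Qed.

Lemma rank1_sym : B'^T = B'.
Proof.
rewrite linearB /= linearZ /= trmx_mul trmxK; by case: pB => ->.
Qed.

(** By [posdef_CS], subtracting the row costs at most the fraction [q] of the form of [B]. *)
Lemma rank1_posdef : q < 1 -> posdef B'.
Proof.
move=> q1; split=> [|u u0]; first exact: rank1_sym.
rewrite rank1_quad; have uB := (pB.2 u u0).
apply: (@lt_le_trans _ _ (dot (u *m B) u * (1 - q))).
  by rewrite mulr_gt0 // subr_gt0.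
rewrite mulrBr mulr1 lerD2l lerN2 ler_pdivrMr // /q mulrA divfK ?gt_eqF //.
exact: posdef_CS.
Qed.

Lemma sherman_morrison : q < 1 ->
  invmx B' = W + (N * (1 - q))^-1 *: (W *m x^T *m (x *m W)).
Proof.
move=> q1; have uB := posdef_unit pB.
have qN : 1 - q != 0 by rewrite gt_eqF // subr_gt0.
have NN : N != 0 by rewrite gt_eqF.
have uB' := posdef_unit (rank1_posdef q1).
rewrite -[RHS]mul1mx -(mulVmx uB') -mulmxA; rewrite -[LHS]mulmx1; congr (_ *m _).
rewrite /B' mulmxBl !mulmxDr mulmxV // -!scalemxAl -!scalemxAr.
rewrite !mulmxA mulmxV // mul1mx -2![x^T *m x *m _ *m _]mulmxA.
have -> : x^T *m x *m (W *m x^T *m x) *m W = (q * N) *: (x^T *m x *m W).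
  rewrite -!mulmxA (mulmxA W) (mulmxA x (W *m x^T)) (mulmxA x W).
  rewrite [x *m W *m x^T]mx11_scalar -[_ 0 0]/(dot _ _).
  by rewrite mul_scalar_mx -scalemxAr /q divfK.
rewrite !scalerA -scalerDl -addrA -scalerBl.
rewrite (_ : _ - _ = 0) ?scale0r ?addr0 //.
by field; rewrite NN qN.
Qed.

Lemma sherman_morrison_tr : q < 1 ->
  \tr (invmx B') = \tr W + dot (x *m (W *m W)) x / (N * (1 - q)).
Proof.
move=> q1; rewrite sherman_morrison // mxtraceD mxtraceZ [_ / _]mulrC.
congr (_ + _ * _); rewrite -mulmxA mxtrace_mulC -!mulmxA.
by rewrite mxtrace_mulC trace_mx11.
Qed.

End ShermanMorrison.

(* One step of the barrier: [s0] is an extra shift, triggered only when the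
   resolvent is too concentrated; it is paid for by a drop of the trace. *)
Lemma barrier_shift p (B : 'M[R]_p) (N k c : R) :
  posdef B -> 0 < N -> 0 < k <= 1 -> 0 < c -> \tr (invmx B) <= N ->
  let s0 := if k ^+ 2 * N ^+ 2 < \tr (invmx B *m invmx B)
            then (k ^+ 2 * N)^-1 else 0 in
  let B1 := B + (s0 + c / N)%:M in
  [/\ posdef B1,
      \tr (invmx B1) / N + k ^+ 4 * N / 2 * s0 +
        c * (\tr (invmx B1 *m invmx B1) / N ^+ 2) <= \tr (invmx B) / N,
      \tr (invmx B1 *m invmx B1) <= k ^+ 2 * N ^+ 2 &
      forall x, dot (x *m (invmx B1 *m invmx B1)) x <=
                k * N * dot (x *m invmx B1) x].
Proof.
move=> pB N0 /andP[k0 k1] c0 trN s0 B1.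
have [Q [b [OQ BE b0]]] := posdef_sfun pB.
have k20 : 0 < k ^+ 2 by rewrite exprn_gt0.
have k2N : 0 < k ^+ 2 * N by rewrite mulr_gt0.
have s00 : 0 <= s0 by rewrite /s0; case: ifP => // _; rewrite invr_ge0 ltW.
have cN : 0 < c / N by rewrite divr_gt0.
pose t := s0 + c / N; have t0 : 0 < t by rewrite ltr_wpDl.
have bt0 i : 0 < b i + t by rewrite addr_gt0.
have B1E : B1 = sfun Q (fun i => b i + t) by rewrite -sfunD sfun_scalar // -BE.
have [|_ invB] := sfun_inv OQ (f := b); first by move=> i; rewrite gt_eqF.
have [|_ invB1] := sfun_inv OQ (f := fun i => b i + t).
  by move=> i; rewrite gt_eqF.
rewrite -BE in invB; rewrite -B1E in invB1.
have trW : \tr (invmx B) = \sum_i (b i)^-1 by rewrite invB mxtrace_sfun.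
have trWt : \tr (invmx B1) = \sum_i (b i + t)^-1 by rewrite invB1 mxtrace_sfun.
have trW2 : \tr (invmx B *m invmx B) = \sum_i (b i)^-1 ^+ 2.
  by rewrite invB sfunM // mxtrace_sfun //; apply: eq_bigr => i _; rewrite expr2.
have trWt2 : \tr (invmx B1 *m invmx B1) = \sum_i (b i + t)^-1 ^+ 2.
  by rewrite invB1 sfunM // mxtrace_sfun //; apply: eq_bigr => i _; rewrite expr2.
have bN i : (b i)^-1 <= N.
  apply: le_trans trN; rewrite trW (bigD1 i) //= lerDl sumr_ge0 // => j _.
  by rewrite invr_ge0 ltW.
(* If the extra shift is triggered, it pushes every eigenvalue of the inverse below [k ^+ 2 * N],
   and the trace is at most [N]; otherwise the bound held before and shifting only improves it. *)
have W2le : \tr (invmx B1 *m invmx B1) <= k ^+ 2 * N ^+ 2.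
  rewrite trWt2; move: (erefl s0); rewrite {2}/s0; case: ifP => [big _|/negbT small _].
    rewrite (_ : k ^+ 2 * N ^+ 2 = k ^+ 2 * N * N); last by ring.
    apply: (@le_trans _ _ (k ^+ 2 * N * \tr (invmx B))); last by rewrite ler_pM2l.
    rewrite trW mulr_sumr; apply: ler_sum => i _.
    rewrite expr2; apply: ler_pM; rewrite ?invr_ge0 ?(ltW (bt0 i)) //.
      rewrite invf_ple ?posrE ?bt0 // /t /s0 big.
      by rewrite addrCA lerDl addr_ge0 ?ltW.
    by rewrite lef_pV2 ?posrE ?bt0 // lerDl ltW.
  move: small; rewrite -leNgt trW2; apply: le_trans; apply: ler_sum => i _.
  rewrite ler_pXn2r ?nnegrE ?invr_ge0 ?(ltW (bt0 i)) ?(ltW (b0 i)) //.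
  by rewrite lef_pV2 ?posrE ?bt0 // lerDl ltW.
(* Put [s = (k^2 N)^-1]. Since [(b i)^-1 <= N] and [s N >= 1], each term drops by at least
   [(b i)^-2 / (2 N^2)]. When the shift is triggered these drops sum to more than [k^2 / 2], which
   is [k^4 N / 2 * s]. *)
have drop1 : k ^+ 4 * N / 2 * s0 <= \sum_i ((b i)^-1 - (b i + s0)^-1) / N.
  rewrite /s0; case: ifP => [big|_]; last first.
    by rewrite mulr0 big1 // => i _; rewrite addr0 subrr mul0r.
  rewrite (_ : _ * _ / 2 * _ = k ^+ 2 / 2); last by field; rewrite !gt_eqF.
  apply: le_trans (_ : \sum_i (b i)^-1 ^+ 2 / (2 * N ^+ 2) <= _).
    rewrite -mulr_suml -trW2 ler_pdivlMr ?mulr_gt0 ?exprn_gt0 //.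
    by apply: le_trans (ltW big); rewrite le_eqVlt; apply/orP; left; apply/eqP; field.
  apply: ler_sum => i _; set s := (k ^+ 2 * N)^-1.
  have sp : 0 < s by rewrite invr_gt0.
  rewrite (_ : _ - _ = s / (b i * (b i + s))); last first.
    by field; rewrite !gt_eqF // addr_gt0.
  rewrite ler_pdivrMr ?mulr_gt0 ?exprn_gt0 // (_ : _ / N * _ = s * N * 2 / (b i * (b i + s))); last first.
    by field; rewrite !gt_eqF // addr_gt0.
  rewrite ler_pdivlMr ?mulr_gt0 ?addr_gt0 //.
  rewrite [leLHS](_ : _ = 1 + (b i)^-1 * s); last by field; rewrite gt_eqF.
  have sN : 1 <= s * N.
    rewrite /s invfM -mulrA mulVf ?gt_eqF // mulr1 invf_ge1 //.
    by rewrite expr_le1 // ltW.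
  have : (b i)^-1 * s <= N * s by rewrite ler_pM2r.
  by move: sN; clear; lra.
split=> //; first by rewrite B1E; apply: sfun_posdef.
- have drop2 : c * (\tr (invmx B1 *m invmx B1) / N ^+ 2) <=
      \sum_i ((b i + s0)^-1 - (b i + t)^-1) / N.
    rewrite trWt2 -mulr_suml mulrA mulr_sumr mulr_suml ler_pdivlMr ?mulr_suml //.
    apply: ler_sum => i _; have bs : 0 < b i + s0 by rewrite ltr_pwDl.
    rewrite (_ : _ - _ = (c / N) / ((b i + s0) * (b i + t))); last first.
      have -> : c / N = (b i + t) - (b i + s0) by rewrite /t; ring.
      by field; rewrite !gt_eqF.
    rewrite (_ : c * _ / _ * N = c / N * (b i + t)^-1 ^+ 2); last first.
      by field; rewrite !gt_eqF.
    rewrite ler_pM2l // expr2 -invfM lef_pV2 ?posrE ?mulr_gt0 ?bt0 //.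
    by rewrite ler_pM2r ?bt0 // lerD2l lerDl ltW.
  move: drop1 drop2; rewrite -!mulr_suml !sumrB -trW -trWt !mulrBl; clear; lra.
- move=> x; rewrite invB1 sfunM // !dot_sfun mulr_sumr.
  apply: ler_sum => i _; rewrite mulrA ler_wpM2r ?sqr_ge0 //.
  rewrite ler_wpM2r ?invr_ge0 ?(ltW (bt0 i)) //.
  rewrite -(@ler_pXn2r _ 2) ?nnegrE ?invr_ge0 ?(ltW (bt0 i)) //; last first.
    by rewrite mulr_ge0 ?ltW.
  rewrite exprMn; apply: le_trans W2le; rewrite trWt2 (bigD1 i) //= lerDl sumr_ge0 // => j _.
  by rewrite sqr_ge0.
Qed.

End Resolvent.
(** * Moments and independence *)

Section Moments.
Context {R : realType} {d : measure_display} {T : measurableType d}.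
Variable P : probability T R.

(** Functions with all moments form an algebra, so the integrability of any polynomial in the
    entries of the array is automatic. *)
Definition nice (f : T -> R) : Prop := measurable_fun setT f /\
  forall k, P.-integrable setT (fun w => (f w ^+ k)%:E).

Definition Ex (f : T -> R) : R := \int[P]_w f w.

Lemma nice_meas f : nice f -> measurable_fun setT f.
Proof. by case. Qed.

Lemma nice_int f : nice f -> P.-integrable setT (EFin \o f).
Proof. by move=> [_ /(_ 1%N)]; exact: eq_integrable. Qed.

Lemma le_integrableR (f g : T -> R) : measurable_fun setT f ->
  P.-integrable setT (EFin \o g) -> (forall w, `|f w| <= g w) ->
  P.-integrable setT (EFin \o f).
Proof.
move=> mf ig fg; apply: (le_integrable measurableT) ig => //.
  exact/measurable_EFinP.
by move=> w _ /=; rewrite lee_fin; exact: le_trans (fg w) (ler_norm _).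
Qed.

Lemma nice_cst a : nice (fun=> a).
Proof.
split=> [|k]; first exact: measurable_cst.
exact: (finite_measure_integrable_cst P (a ^+ k)).
Qed.

Lemma nice_le (f g : T -> R) : measurable_fun setT f -> nice g ->
  (forall w, `|f w| <= `|g w|) -> nice f.
Proof.
move=> mf [mg ig] fg; split => // k.
apply: (@le_integrableR _ (fun w => `|g w ^+ k|)).
- exact: measurable_funX.
- exact: integrable_norm (ig k).
- by move=> w; rewrite !normrX lerXn2r ?nnegrE.
Qed.

Lemma nice_bounded (f : T -> R) a : measurable_fun setT f -> (forall w, `|f w| <= a) ->
  nice f.
Proof.
move=> mf fa; apply: (nice_le mf (nice_cst a)) => w.
exact: le_trans (fa w) (ler_norm _).
Qed.

Lemma niceD f g : nice f -> nice g -> nice (fun w => f w + g w).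
Proof.
move=> [mf jf] [mg jg]; split=> [|k]; first exact: measurable_funD.
apply: (@le_integrableR _ (fun w => 2 ^+ k * (`|f w ^+ k| + `|g w ^+ k|))).
- by apply: measurable_funX; exact: measurable_funD.
- have H : P.-integrable setT (EFin \o (fun w => `|f w ^+ k| + `|g w ^+ k|)).
    exact: (integrableD measurableT (integrable_norm (jf k)) (integrable_norm (jg k))).
  exact: (integrableZl measurableT (2 ^+ k) H).
- move=> w; rewrite normrX; set a := `|f w|; set b := `|g w|.
  have ab : `|f w + g w| <= a + b by exact: ler_normD.
  apply: le_trans (_ : (a + b) ^+ k <= _).
    by rewrite lerXn2r ?nnegrE // (le_trans _ ab).
  rewrite !normrX -/a -/b; have [a0 b0] : 0 <= a /\ 0 <= b by split; exact: normr_ge0.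
  wlog le_ab : a b a0 b0 {ab} / a <= b => [hw|].
    have [/hw|/ltW/hw] := leP a b; first exact.
    by rewrite [b + a]addrC [b ^+ k + _]addrC; apply.
  rewrite mulrDr -exprMn -exprMn; apply: le_trans (_ : (2 * b) ^+ k <= _).
    by rewrite lerXn2r ?nnegrE ?addr_ge0 ?mulr_ge0 //; lra.
  by rewrite lerDr exprn_ge0 // mulr_ge0.
Qed.

Lemma niceM f g : nice f -> nice g -> nice (fun w => f w * g w).
Proof.
move=> [mf jf] [mg jg]; split=> [|k]; first exact: measurable_funM.
apply: (@le_integrableR _ (fun w => f w ^+ (2 * k) + g w ^+ (2 * k))).
- by apply: measurable_funX; exact: measurable_funM.
- exact: (integrableD measurableT (jf _) (jg _)).
- move=> w; rewrite exprMn normrM.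
  rewrite ![(2 * k)%N]mulnC !exprM -[f w ^+ k ^+ 2]real_normK ?num_real //.
  rewrite -[g w ^+ k ^+ 2]real_normK ?num_real //.
  have := sqr_ge0 (`|f w ^+ k| - `|g w ^+ k|).
  have : 0 <= `|f w ^+ k| * `|g w ^+ k| by rewrite mulr_ge0.
  by rewrite sqrrB mulr2n; lra.
Qed.

Lemma niceZ a f : nice f -> nice (fun w => a * f w).
Proof. by move=> nf; exact: niceM (nice_cst a) nf. Qed.

Lemma niceN f : nice f -> nice (fun w => - f w).
Proof.
move=> nf; rewrite (_ : (fun _ => _) = fun w => -1 * f w); first exact: niceZ.
by apply/funext => w; rewrite mulN1r.
Qed.

Lemma niceB f g : nice f -> nice g -> nice (fun w => f w - g w).
Proof. by move=> nf ng; exact: niceD nf (niceN ng). Qed.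

Lemma niceX f k : nice f -> nice (fun w => f w ^+ k).
Proof.
move=> nf; elim: k => [|k IH]; first exact: nice_cst.
rewrite (_ : (fun _ => _) = fun w => f w * f w ^+ k); first exact: niceM.
by apply/funext => w; rewrite exprS.
Qed.

Lemma nice_sum I (s : seq I) (p : pred I) (f : I -> T -> R) :
  (forall i, nice (f i)) -> nice (fun w => \sum_(i <- s | p i) f i w).
Proof.
move=> nf; elim: s => [|i s IH].
  rewrite (_ : (fun _ => _) = fun=> 0); first exact: nice_cst.
  by apply/funext => w; rewrite big_nil.
rewrite (_ : (fun _ => _) = fun w =>
  (if p i then f i w else 0) + \sum_(j <- s | p j) f j w); last first.
  by apply/funext => w; rewrite big_cons; case: ifP => _; rewrite ?add0r.
apply: niceD => //; case: (p i) => //; exact: nice_cst.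
Qed.

Lemma nice_norm f : nice f -> nice (fun w => `|f w|).
Proof.
move=> nf; apply: (nice_le _ nf) => [|w]; last by rewrite normr_id.
by apply: measurableT_comp => //; exact: nice_meas.
Qed.

Lemma nice_indic (A : set T) : measurable A -> nice (\1_A : T -> R).
Proof.
move=> mA; apply: (@nice_bounded _ 1) => [|w]; first exact: measurable_indic.
by rewrite indicE; case: (_ \in _); rewrite ?normr1 // normr0.
Qed.

Lemma ExD f g : nice f -> nice g -> Ex (fun w => f w + g w) = Ex f + Ex g.
Proof. by move=> /nice_int jf /nice_int jg; rewrite /Ex RintegralD. Qed.

Lemma ExZ a f : nice f -> Ex (fun w => a * f w) = a * Ex f.
Proof. by move=> /nice_int jf; rewrite /Ex RintegralZl. Qed.

Lemma ExB f g : nice f -> nice g -> Ex (fun w => f w - g w) = Ex f - Ex g.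
Proof. by move=> /nice_int jf /nice_int jg; rewrite /Ex RintegralB. Qed.

Lemma Ex_cst a : Ex (fun=> a) = a.
Proof.
by rewrite /Ex Rintegral_cst // [X in fine X]probability_setT /= mulr1.
Qed.

Lemma Ex_sum I (s : seq I) (p : pred I) (f : I -> T -> R) :
  (forall i, nice (f i)) ->
  Ex (fun w => \sum_(i <- s | p i) f i w) = \sum_(i <- s | p i) Ex (f i).
Proof.
move=> nf; elim: s => [|i s IH].
  by rewrite big_nil -[RHS](Ex_cst 0); congr Ex; apply/funext => w; rewrite big_nil.
rewrite big_cons -IH; transitivity (Ex (fun w =>
  (if p i then f i w else 0) + \sum_(j <- s | p j) f j w)).
  congr Ex; apply/funext => w; rewrite big_cons.
  by case: ifP => _; rewrite ?add0r.
rewrite ExD //; last exact: nice_sum.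
  by case: (p i); rewrite ?Ex_cst ?add0r.
by case: (p i) => //; exact: nice_cst.
Qed.

Lemma Ex_le f g : nice f -> nice g -> (forall w, f w <= g w) -> Ex f <= Ex g.
Proof. by move=> /nice_int jf /nice_int jg fg; apply: le_Rintegral. Qed.

Lemma Ex_ge0 f : (forall w, 0 <= f w) -> 0 <= Ex f.
Proof. by move=> f0; apply: Rintegral_ge0. Qed.

Lemma Ex_indic (A : set T) : measurable A -> Ex \1_A = fine (P A).
Proof. by move=> mA; rewrite /Ex /Rintegral integral_indic // setIT. Qed.

Lemma EFin_Ex f : nice f -> ((Ex f)%:E = \int[P]_w (f w)%:E)%E.
Proof.
move=> /nice_int jf; rewrite /Ex /Rintegral fineK //.
exact: integrable_fin_num.
Qed.

End Moments.

(** * Independence of the sigma-algebras generated by disjoint sets of entries *)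

Section Independence.
Context {R : realType} {d : measure_display} {T : measurableType d}.
Variables (P : probability T R) (x : nat * nat -> {RV P >-> R}).
Hypothesis indx : mutually_independent x.
Implicit Types J : set (nat * nat).

(** A pi-system generating the sigma-algebra of the entries with index in [J]; finite index lists
    let [mutually_independent] evaluate it directly. *)
Definition cylinders J : set (set T) := [set A | exists (s : seq (nat * nat))
  (B : nat * nat -> set R), [/\ uniq s, forall i, i \in s -> J i,
    forall i, measurable (B i) & A = \bigcap_(i in [set` s]) x i @^-1` B i]].

Notation sigJ J := (g_sigma_algebraType (cylinders J)).

Lemma cylinders_measurable J : cylinders J `<=` measurable.
Proof.
move=> _ [s [B [us sJ mB ->]]].
apply: fin_bigcap_measurable => // i _.
by rewrite -[X in measurable X]setTI; exact: (measurable_funP (x i) measurableT _ (mB i)).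
Qed.

Lemma sigJ_measurable J (A : set T) : measurable (A : set (sigJ J)) -> measurable A.
Proof.
apply: smallest_sub; first exact: sigma_algebra_measurable.
exact: cylinders_measurable.
Qed.

Lemma measurable_sigJ d' (U : measurableType d') J (f : T -> U) :
  measurable_fun (setT : set (sigJ J)) f -> measurable_fun setT f.
Proof.
move=> mf _ B mB; apply: (@sigJ_measurable J).
exact: (mf measurableT B mB).
Qed.

Lemma measurable_sigJ_sub d' (U : measurableType d') J J' (f : T -> U) :
  J `<=` J' -> measurable_fun (setT : set (sigJ J)) f ->
  measurable_fun (setT : set (sigJ J')) f.
Proof.
move=> JJ' mf _ B mB; have := mf measurableT B mB.
apply: sub_sigma_algebra2 => _ [s [C [us sJ mC ->]]].
by exists s, C; split => // i /sJ /JJ'.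
Qed.

Lemma measurable_coord J i : J i -> measurable_fun (setT : set (sigJ J)) (x i).
Proof.
move=> Ji _ B mB; rewrite setTI; apply: sub_sigma_algebra.
exists [:: i], (fun=> B); split => //.
- by move=> j; rewrite inE => /eqP->.
- by apply/seteqP; split => w /=; [move=> Bw j /=; rewrite inE => /eqP->|
    move=> /(_ i); apply; rewrite /= inE eqxx].
Qed.

Lemma cylindersT J : cylinders J setT.
Proof.
exists [::], (fun=> setT); split => //.
by apply/seteqP; split => // w _ i /=; rewrite in_nil.
Qed.

Lemma cylindersI J : setI_closed (cylinders J).
Proof.
move=> _ _ [s [B [us sJ mB ->]]] [s' [B' [us' sJ' mB' ->]]].
pose C i := (if i \in s then B i else setT) `&` (if i \in s' then B' i else setT).
exists (undup (s ++ s')), C; split.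
- exact: undup_uniq.
- by move=> i; rewrite mem_undup mem_cat => /orP[/sJ|/sJ'].
- by move=> i; apply: measurableI; case: ifP.
- apply/seteqP; split => w /=.
    move=> [Bw Bw'] i /= _; split; case: ifP => // ii; [exact: Bw|exact: Bw'].
  move=> Cw; split=> i /= ii.
    have /= := Cw i; rewrite mem_undup mem_cat ii => /(_ isT)[].
    by rewrite ii.
  have /= := Cw i; rewrite mem_undup mem_cat ii orbT => /(_ isT)[_].
  by rewrite ii.
Qed.

Lemma cylinders_indep J J' A A' : J `&` J' `<=` set0 ->
  cylinders J A -> cylinders J' A' -> (P (A `&` A') = P A * P A')%E.
Proof.
move=> JJ' [s [B [us sJ mB ->]]] [s' [B' [us' sJ' mB' ->]]].
have ss' i : i \in s -> i \in s' -> False.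
  by move=> /sJ Ji /sJ' J'i; apply: (JJ' i).
pose C i := if i \in s then B i else B' i.
have CB i : i \in s -> C i = B i by rewrite /C => ->.
have CB' i : i \in s' -> C i = B' i.
  by rewrite /C; case: ifP => // /ss' H /H.
have -> : \bigcap_(i in [set` s]) x i @^-1` B i `&`
    \bigcap_(i in [set` s']) x i @^-1` B' i =
    \bigcap_(i in [set` s ++ s']) x i @^-1` C i.
  apply/seteqP; split => w /=.
    move=> [Bw Bw'] i /=; rewrite mem_cat /preimage /= => /orP[ii|ii].
      by rewrite CB //; exact: Bw.
    by rewrite CB' //; exact: Bw'.
  move=> Cw; split=> i /= ii; rewrite /preimage /=.
    by rewrite -CB //; apply: Cw; rewrite /= mem_cat ii.
  by rewrite -CB' //; apply: Cw; rewrite /= mem_cat ii orbT.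
rewrite !indx //; last 2 first.
- rewrite cat_uniq us us' andbT; apply/hasPn => i ii; apply/negP => /ss'.
  exact.
- by move=> i; rewrite /C; case: ifP.
rewrite big_cat /=; congr (_ * _)%E; apply: eq_big_seq => i ii.
  by rewrite CB.
by rewrite CB'.
Qed.

(** Two finite measures that agree on a pi-system agree on the sigma-algebra it generates; [step]
    extends the product formula in one factor, and it is applied to each factor in turn. *)
Lemma sigJ_indep J J' (A : set (sigJ J)) (A' : set (sigJ J')) :
  J `&` J' `<=` set0 -> measurable A -> measurable A' ->
  (P (A `&` A' : set T) = P A * P A')%E.
Proof.
move=> JJ' mA mA'.
have mT (B : set T) J0 : (<<s cylinders J0 >>) B -> measurable B.
  exact: sigJ_measurable.
have step J0 J1 (B B' : set T) : (forall C, cylinders J0 C -> (P (B `&` C) = P B * P C)%E) ->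
    measurable B -> (<<s cylinders J0 >>) B' -> (P (B `&` B') = P B * P B')%E.
  move=> H mB sB'.
  have PB0 : 0 <= fine (P B) by rewrite fine_ge0.
  pose m1 : {measure set T -> \bar R} := mrestr P mB.
  pose m2 : {measure set T -> \bar R} := mscale (NngNum PB0) P.
  have PB : P B = (fine (P B))%:E by rewrite fineK // fin_num_measure.
  have m1E C : m1 C = P (C `&` B) by [].
  have m2E C : m2 C = ((fine (P B))%:E * P C)%E by [].
  have := @g_sigma_algebra_measure_unique _ R T (cylinders J0)
    (@cylinders_measurable J0) (fun=> setT) (fun=> @cylindersT J0) _ m1 m2.
  move=> U.
  have {}U : m1 B' = m2 B'.
    apply: U => //.
    - by rewrite bigcup_const.
    - exact: cylindersI.
    - by move=> C JC; rewrite m1E m2E setIC H // -PB.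
    - move=> k; rewrite m1E setTI; apply: le_lt_trans (probability_le1 _ mB) _.
      exact: ltry.
  by rewrite setIC -m1E U m2E -PB.
apply: (step J' J) => //; last exact: mT mA.
move=> C JC; rewrite setIC muleC.
apply: (step J J') => //; last exact: cylinders_measurable JC.
by move=> C' JC'; rewrite setIC muleC; exact: cylinders_indep JC' JC.
Qed.

(** Decoupling: the diagonal map into two copies of [T], each with its own sub-sigma-algebra, has a
    product law. The second argument may therefore be replaced by an independent copy [w'], which
    plays the part of conditioning on the first. *)
Lemma indep_tonelli J J' (f : T * T -> R) : J `&` J' `<=` set0 ->
  measurable_fun (setT : set (sigJ J * sigJ J')) f -> (forall z, 0 <= f z) ->
  measurable_fun setT (fun w => \int[P]_w' (f (w, w'))%:E)%E /\
  (\int[P]_w (f (w, w))%:E = \int[P]_w \int[P]_w' (f (w, w'))%:E)%E.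
Proof.
move=> JJ' mf f0.
have midJ J0 : measurable_fun setT (fun w : T => w : sigJ J0).
  by move=> _ B mB; rewrite setTI; exact: sigJ_measurable mB.
have mdiag : measurable_fun setT (fun w : T => (w : sigJ J, w : sigJ J')).
  by apply: measurable_fun_pair; exact: midJ.
pose X1 : {mfun T >-> sigJ J} := HB.pack (fun w : T => w : sigJ J)
  (isMeasurableFun.Build _ _ _ _ _ (midJ J)).
pose X2 : {mfun T >-> sigJ J'} := HB.pack (fun w : T => w : sigJ J')
  (isMeasurableFun.Build _ _ _ _ _ (midJ J')).
pose Z : {mfun T >-> (sigJ J * sigJ J')%type} :=
  HB.pack (fun w : T => (w : sigJ J, w : sigJ J'))
  (isMeasurableFun.Build _ _ _ _ _ mdiag).
have mEf : measurable_fun setT (EFin \o (f : sigJ J * sigJ J' -> R)).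
  exact/measurable_EFinP.
have inner w : (\int[P]_w' (f (w, w'))%:E =
    fubini_F (distribution P X2) (EFin \o (f : sigJ J * sigJ J' -> R)) w)%E.
  rewrite /fubini_F (@ge0_integral_distribution _ _ _ _ _ P X2 (fun y => (f (w, y))%:E)) //.
    by apply/measurable_EFinP; exact: (measurableT_comp mf (measurable_pair1 _)).
  by move=> y; rewrite lee_fin.
split.
  under eq_fun do rewrite inner; apply: (@measurable_sigJ _ _ J).
  exact: measurable_fun_fubini_tonelli_F.
transitivity (\int[distribution P Z]_z (f z)%:E)%E.
  by rewrite (@ge0_integral_distribution _ _ _ _ _ P Z (EFin \o f)).
transitivity (\int[(distribution P X1 \x distribution P X2)%E]_z (f z)%:E)%E.
  apply: eq_measure_integral => A mA _.
  apply/esym; apply: product_measure_unique => // B B' mB mB'.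
  change (P ((B : set T) `&` B') = P B * P B')%E.
  exact: (sigJ_indep JJ' mB mB').
rewrite (@fubini_tonelli1 _ _ _ _ _ (distribution P X1) (distribution P X2) (EFin \o f)) //.
rewrite (@ge0_integral_distribution _ _ _ _ _ P X1).
- by apply: eq_integral => w _ /=; rewrite inner.
- exact: measurable_fun_fubini_tonelli_F.
- by move=> y; apply: integral_ge0 => z _; rewrite lee_fin.
Qed.

Lemma indep_le J J' (f : T * T -> R) (h : T -> R) : J `&` J' `<=` set0 ->
  measurable_fun (setT : set (sigJ J * sigJ J')) f -> (forall z, 0 <= f z) ->
  nice P (fun w => f (w, w)) -> (forall w, nice P (fun w' => f (w, w'))) ->
  nice P h -> (forall w, Ex P (fun w' => f (w, w')) <= h w) ->
  Ex P (fun w => f (w, w)) <= Ex P h.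
Proof.
move=> JJ' mf f0 nff nf nh fh; rewrite -lee_fin !EFin_Ex //.
have [mF ->] := indep_tonelli JJ' mf f0.
apply: ge0_le_integral => //.
- by move=> w _; apply: integral_ge0 => w' _; rewrite lee_fin.
- by apply/measurable_EFinP; exact: nice_meas nh.
- by move=> w _; rewrite -EFin_Ex // lee_fin.
Qed.

Lemma indep_mul_ge0 J J' (g h : T -> R) : J `&` J' `<=` set0 ->
  measurable_fun (setT : set (sigJ J)) g ->
  measurable_fun (setT : set (sigJ J')) h ->
  nice P g -> nice P h -> (forall w, 0 <= g w) -> (forall w, 0 <= h w) ->
  Ex P (fun w => g w * h w) = Ex P g * Ex P h.
Proof.
move=> JJ' mg mh ng nh g0 h0.
have mf : measurable_fun (setT : set (sigJ J * sigJ J')) (fun z => g z.1 * h z.2).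
  apply: measurable_funM; exact: measurableT_comp.
have [_] := indep_tonelli JJ' mf (fun z => mulr_ge0 (g0 z.1) (h0 z.2)).
rewrite -EFin_Ex /=; last exact: niceM.
rewrite (_ : (\int[P]_w _)%E = (\int[P]_w (Ex P h * g w)%:E)%E).
  rewrite -EFin_Ex; last exact: niceZ.
  by rewrite ExZ // mulrC => -[].
by apply: eq_integral => w _; rewrite -EFin_Ex ?ExZ 1?mulrC //; exact: niceZ.
Qed.

Lemma indep_mul J J' (g h : T -> R) : J `&` J' `<=` set0 ->
  measurable_fun (setT : set (sigJ J)) g ->
  measurable_fun (setT : set (sigJ J')) h -> nice P g -> nice P h ->
  Ex P (fun w => g w * h w) = Ex P g * Ex P h.
Proof.
move=> JJ' mg mh ng nh.
pose pos (f : T -> R) w := (`|f w| + f w) / 2.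
pose neg (f : T -> R) w := (`|f w| - f w) / 2.
have posneg f : f = (fun w => pos f w - neg f w).
  by apply/funext => w; rewrite /pos /neg; field.
have pos0 f w : 0 <= pos f w.
  by rewrite /pos divr_ge0 //; have := ler_norm (- f w); rewrite normrN; lra.
have neg0 f w : 0 <= neg f w.
  by rewrite /neg divr_ge0 //; have := ler_norm (f w); lra.
have npos f : nice P f -> nice P (pos f).
  move=> nf; apply: niceM (nice_cst _ _); apply: niceD => //; exact: nice_norm.
have nneg f : nice P f -> nice P (neg f).
  move=> nf; apply: niceM (nice_cst _ _); apply: niceB => //; exact: nice_norm.
have mpos J0 f : measurable_fun (setT : set (sigJ J0)) f ->
    measurable_fun (setT : set (sigJ J0)) (pos f).
  move=> mf; apply: measurable_funM => //; apply: measurable_funD => //.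
  exact: measurableT_comp.
have mneg J0 f : measurable_fun (setT : set (sigJ J0)) f ->
    measurable_fun (setT : set (sigJ J0)) (neg f).
  move=> mf; apply: measurable_funM => //; apply: measurable_funB => //.
  exact: measurableT_comp.
have H (g' h' : T -> R) := @indep_mul_ge0 J J' g' h' JJ'.
have nn f f' : nice P f -> nice P f' -> nice P (fun w => f w * f' w) by exact: niceM.
have gE : Ex P g = Ex P (pos g) - Ex P (neg g) by rewrite {1}(posneg g) ExB; auto.
have hE : Ex P h = Ex P (pos h) - Ex P (neg h) by rewrite {1}(posneg h) ExB; auto.
rewrite [in LHS](posneg g) [in LHS](posneg h).
rewrite (_ : (fun w => _) = fun w => (pos g w * pos h w + neg g w * neg h w) -
    (pos g w * neg h w + neg g w * pos h w)); last by apply/funext => w; ring.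
rewrite ExB; [|by apply: niceD; apply: nn; auto..].
rewrite !ExD; [|by apply: nn; auto..].
rewrite (H (pos g) (pos h)) ?(H (neg g) (neg h)) ?(H (pos g) (neg h))
  ?(H (neg g) (pos h)); auto.
rewrite gE hE; ring.
Qed.

End Independence.
Notation sigJ x J := (g_sigma_algebraType (cylinders x J)).

Ltac nice_tac := repeat match goal with
  | |- nice _ (fun w => (_ ^+ _)%R) => apply: niceX
  | |- nice _ (fun w => (- _)%R) => apply: niceN
  | |- nice _ (fun w => (_ + _)%R) => apply: niceD
  | |- nice _ (fun w => (_ * _)%R) => apply: niceM
  | |- nice _ (fun w => (\sum_(_ <- _ | _) _)%R) => apply: nice_sum => ?
  | |- nice _ (fun w => ?c) => exact: nice_cst
  | |- nice _ _ => solve [assumption | auto]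
  end.

Definition standard_array {R : realType} {d} {T : measurableType d}
    (P : probability T R) (x : nat * nat -> {RV P >-> R}) : Prop :=
  [/\ mutually_independent x, identically_distributed x, nice P (x (0, 0)%N),
      Ex P (x (0, 0)%N) = 0 & Ex P (fun w => x (0, 0)%N w ^+ 2) = 1].

(** * Fourth moments of linear and quadratic forms in one row *)

Section ArrayMoments.
Context {R : realType} {d : measure_display} {T : measurableType d}.
Variables (P : probability T R) (x : nat * nat -> {RV P >-> R}).
Hypotheses (indx : mutually_independent x) (idx : identically_distributed x).
Hypotheses (nx0 : nice P (x (0, 0)%N)).
Hypotheses (mean0 : Ex P (x (0, 0)%N) = 0).
Hypotheses (var1 : Ex P (fun w => x (0, 0)%N w ^+ 2) = 1).

Lemma ident_int (f : R -> R) i : measurable_fun setT f -> (forall r, 0 <= f r) ->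
  (\int[P]_w (f (x i w))%:E = \int[P]_w (f (x (0, 0)%N w))%:E)%E.
Proof.
move=> mf f0.
have mEf : measurable_fun setT (EFin \o f) by exact/measurable_EFinP.
have fE j : (\int[P]_w (f (x j w))%:E = \int[distribution P (x j)]_r (f r)%:E)%E.
  by rewrite (@ge0_integral_distribution _ _ _ _ _ P (x j) (EFin \o f)).
by rewrite !fE; apply: eq_measure_integral => A mA _; exact: idx.
Qed.

Lemma nice_entry i : nice P (x i).
Proof.
split=> [|k]; first exact: measurable_funP.
have mX : measurable_fun setT (fun r : R => `|r ^+ k|).
  by apply: measurableT_comp => //; exact: measurable_funX.
apply/integrableP; split.
  by apply/measurable_EFinP/measurable_funX; exact: measurable_funP.
change (\int[P]_w (`|x i w ^+ k|)%:E < +oo)%E.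
rewrite (ident_int i mX) //.
by have /integrableP[_] := (nx0.2 k).
Qed.
Hint Resolve nice_entry : core.

Lemma ident_Ex (f : R -> R) i : measurable_fun setT f ->
  nice P (fun w => f (x i w)) -> nice P (fun w => f (x (0, 0)%N w)) ->
  Ex P (fun w => f (x i w)) = Ex P (fun w => f (x (0, 0)%N w)).
Proof.
move=> mf ni n0; apply: EFin_inj; rewrite !EFin_Ex //.
have mEf : measurable_fun setT (EFin \o f) by exact/measurable_EFinP.
have fE j : nice P (fun w => f (x j w)) ->
    (\int[P]_w (f (x j w))%:E = \int[distribution P (x j)]_r (f r)%:E)%E.
  move=> nj; rewrite (@integral_distribution _ _ _ _ _ P (x j) (EFin \o f)) //.
  exact: nice_int nj.
by rewrite !fE //; apply: eq_measure_integral => A mA _; exact: idx.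
Qed.

Let m4 := Ex P (fun w => x (0, 0)%N w ^+ 4).
Let c2 := Ex P (fun w => (x (0, 0)%N w ^+ 2 - 1) ^+ 2).
Let c4 := Ex P (fun w => (x (0, 0)%N w ^+ 2 - 1) ^+ 4).
Definition linK : R := 3 + m4.
(** The square of the smallest [rho] that [quad_recur] accepts for the three constants met in
    [Ex_quad]. *)
Definition quadK : R := (32 * linK + 32 + 16 * c2 + 384 * m4 * linK + 24 * c4 + 1) ^+ 2.

Lemma m4_ge0 : 0 <= m4. Proof. by apply: Ex_ge0 => w; rewrite exprn_even_ge0. Qed.
Lemma c2_ge0 : 0 <= c2. Proof. by apply: Ex_ge0 => w; rewrite exprn_even_ge0. Qed.
Lemma c4_ge0 : 0 <= c4. Proof. by apply: Ex_ge0 => w; rewrite exprn_even_ge0. Qed.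
Lemma linK_ge0 : 0 <= linK. Proof. by rewrite addr_ge0 // m4_ge0. Qed.
Lemma quadK_ge0 : 0 <= quadK. Proof. exact: sqr_ge0. Qed.

Section Row.
Variable r : nat.
Let xi a w := x (r, a) w.
Let Jlt k : set (nat * nat) := [set i | i.1 = r /\ (i.2 < k)%N].

Let nxi a : nice P (xi a). Proof. exact: nice_entry. Qed.
Hint Resolve nxi : core.

Let mxi a k : (a < k)%N -> measurable_fun (setT : set (sigJ x (Jlt k))) (xi a).
Proof. by move=> ak; apply: (measurable_coord (i := (r, a))). Qed.

Let indep_xi k g (h : R -> R) : measurable_fun (setT : set (sigJ x (Jlt k))) g ->
  nice P g -> measurable_fun setT h -> nice P (fun w => h (xi k w)) ->
  nice P (fun w => h (x (0, 0)%N w)) ->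
  Ex P (fun w => g w * h (xi k w)) = Ex P g * Ex P (fun w => h (x (0, 0)%N w)).
Proof.
move=> mg ng mh nh n0.
rewrite (indep_mul indx (J := Jlt k) (J' := [set (r, k)])) //.
- by congr (_ * _); exact: (ident_Ex (i := (r, k)) mh).
- by move=> [a b] /= [[_ ab] [_ bk]]; move: ab; rewrite /= bk ltnn.
- by apply: (measurableT_comp mh); exact: measurable_coord.
Qed.

Definition lin (c : nat -> R) k w := \sum_(a < k) c a * xi a w.

Let lin_meas c k : measurable_fun (setT : set (sigJ x (Jlt k))) (lin c k).
Proof.
apply: measurable_sum => a; apply: measurable_funM => //; exact: mxi.
Qed.

Let lin_nice c k : nice P (lin c k). Proof. by rewrite /lin; nice_tac. Qed.
Hint Resolve lin_nice : core.

Let Ex_xi1 k g : measurable_fun (setT : set (sigJ x (Jlt k))) g -> nice P g ->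
  Ex P (fun w => g w * xi k w) = 0.
Proof.
by move=> mg ng; rewrite (indep_xi (h := id)) // mean0 mulr0.
Qed.

Let Ex_xi2 k g : measurable_fun (setT : set (sigJ x (Jlt k))) g -> nice P g ->
  Ex P (fun w => g w * xi k w ^+ 2) = Ex P g.
Proof.
move=> mg ng; rewrite (indep_xi (h := fun t => t ^+ 2)) ?var1 ?mulr1 //;
  first [exact: measurable_funX | by nice_tac].
Qed.

Let Ex_xi4 k g : measurable_fun (setT : set (sigJ x (Jlt k))) g -> nice P g ->
  Ex P (fun w => g w * xi k w ^+ 4) = Ex P g * m4.
Proof.
move=> mg ng; rewrite (indep_xi (h := fun t => t ^+ 4)) //;
  first [exact: measurable_funX | by nice_tac].
Qed.

Let Exi k j : Ex P (fun w => xi k w ^+ j) = Ex P (fun w => x (0, 0)%N w ^+ j).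
Proof.
apply: (ident_Ex (i := (r, k)) (f := fun t => t ^+ j)); first exact: measurable_funX.
  by nice_tac.
by nice_tac.
Qed.

(** Entries are added one at a time. In the binomial expansion every term with a mean-zero factor
    vanishes, whether that factor is the new entry or the partial sum, and [3 + m4] absorbs the
    remaining mixed and pure terms. *)
Lemma Ex_lin c k : [/\ Ex P (lin c k) = 0,
  Ex P (fun w => lin c k w ^+ 2) = \sum_(a < k) c a ^+ 2 &
  Ex P (fun w => lin c k w ^+ 4) <= linK * (\sum_(a < k) c a ^+ 2) ^+ 2].
Proof.
elim: k => [|k [IH1 IH2 IH4]].
  have l0 : lin c 0 = fun=> 0 by apply/funext => w; rewrite /lin big_ord0.
  by rewrite l0 !big_ord0; split; rewrite ?Ex_cst ?expr0n ?mulr0.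
have lS w : lin c k.+1 w = lin c k w + c k * xi k w by rewrite /lin big_ord_recr.
set l := lin c k in IH1 IH2 IH4 lS; have nl : nice P l by exact: lin_nice.
have ml : measurable_fun (setT : set (sigJ x (Jlt k))) l by exact: lin_meas.
have mlX j : measurable_fun (setT : set (sigJ x (Jlt k))) (fun w => l w ^+ j).
  exact: measurable_funX.
split.
- rewrite (_ : lin c k.+1 = fun w => l w + c k * (1 * xi k w)); last first.
    by apply/funext => w; rewrite lS mul1r.
  rewrite ExD; [|by nice_tac..]; rewrite ExZ; last by nice_tac.
  by rewrite Ex_xi1 ?IH1 ?mulr0 ?addr0 //; exact: nice_cst.
- rewrite (_ : (fun w => _) = fun w => l w ^+ 2 + ((2 * c k) * (l w * xi k w) +
      c k ^+ 2 * xi k w ^+ 2)); last first.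
    by apply/funext => w; rewrite lS; ring.
  rewrite !ExD ?ExZ; nice_tac.
  rewrite (Ex_xi1 ml nl) IH2 Exi // var1.
  by rewrite big_ord_recr /=; ring.
- rewrite (_ : (fun w => _) = fun w => l w ^+ 4 + ((4 * c k) * (l w ^+ 3 * xi k w) +
      ((6 * c k ^+ 2) * (l w ^+ 2 * xi k w ^+ 2) +
      ((4 * c k ^+ 3) * (l w * xi k w ^+ 3) +
      c k ^+ 4 * xi k w ^+ 4)))); last first.
    by apply/funext => w; rewrite lS; ring.
  rewrite !ExD ?ExZ; nice_tac.
  rewrite (Ex_xi1 (mlX 3)) ?(Ex_xi2 (mlX 2)) ?Exi //; nice_tac.
  rewrite (indep_xi (g := l) (h := fun t => t ^+ 3)) ?IH1 //; first [exact: measurable_funX | by nice_tac | idtac].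
  rewrite mul0r big_ord_recr /= IH2 -/m4.
  set v := \sum_(i < k) _ in IH4 *.
  have v0 : 0 <= v by apply: sumr_ge0 => a _; exact: sqr_ge0.
  have c0 : 0 <= c k ^+ 2 by exact: sqr_ge0.
  rewrite (_ : c k ^+ 4 = (c k ^+ 2) ^+ 2); last by ring.
  set b := c k ^+ 2 in c0 *; move: IH4; rewrite /linK; have := m4_ge0.
  move=> m40 IH4; have := mulr_ge0 (mulr_ge0 m40 v0) c0; have := sqr_ge0 b.
  by move: IH4; move: (Ex P _) => e; lra.
Qed.

Variable W : nat -> nat -> R.
(** The centred quadratic form as a martingale: the increment at [a] has mean zero given the entries
    before [a]. *)
Let quad k w := \sum_(a < k)
  (W a a * (xi a w ^+ 2 - 1) + 2 * (xi a w * lin (W a) a w)).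

Let quad_meas k : measurable_fun (setT : set (sigJ x (Jlt k))) (quad k).
Proof.
apply: measurable_sum => a; apply: measurable_funD; apply: measurable_funM => //.
  by apply: measurable_funB => //; apply: measurable_funX; exact: mxi.
apply: measurable_funM; first exact: mxi.
apply: (measurable_sigJ_sub (J := Jlt a)) => [[i j] /= [ir ja]|].
  by split => //=; exact: ltn_trans ja _.
exact: lin_meas.
Qed.

Let quad_nice k : nice P (quad k). Proof. by rewrite /quad; nice_tac. Qed.
Hint Resolve quad_nice : core.

(** One step of the fourth-moment recursion: [a] and [a'] are successive fourth moments, [U] the
    accumulated squared coefficients and [u] the new ones. The free weight [t = u / (rho U)]
    balances the two Young terms, and both become multiples of [rho U u], the cross term of
    [(U + u)^2]. *)
Lemma quad_recur (K1 K2 K3 rho a a' U u : R) :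
  0 <= K1 -> 0 <= K2 -> 0 <= K3 -> 0 <= a -> a <= rho ^+ 2 * U ^+ 2 ->
  0 <= U -> 0 <= u -> K1 + K2 + K3 + 1 <= rho ->
  (forall t, 0 < t -> a' <= a + K1 * (t * a) + K2 * (u ^+ 2 / t) + K3 * u ^+ 2) ->
  a' <= rho ^+ 2 * (U + u) ^+ 2.
Proof.
move=> K10 K20 K30 a0 aU U0 u0 Kr H.
have r1 : 1 <= rho by lra.
have rr : rho <= rho ^+ 2 by rewrite expr2; nra.
(* With [u = 0] the hypothesis reads [a' <= (1 + K1 t) a] for all [t > 0]; the witness is small
   enough to contradict [a < a']. *)
have [u00|up] := eqVneq u 0.
  rewrite u00 addr0; apply: le_trans aU; rewrite leNgt; apply/negP => aa'.
  have den : 0 < 2 * (K1 * a + 1) by have : 0 <= K1 * a by [exact: mulr_ge0]; lra.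
  have tp : 0 < (a' - a) / (2 * (K1 * a + 1)) by rewrite divr_gt0 // subr_gt0.
  have := H _ tp; rewrite u00 expr0n /= mul0r !mulr0 !addr0.
  set t := (_ / _) in tp *.
  have tE : t * (2 * (K1 * a + 1)) = a' - a by rewrite divfK // gt_eqF.
  rewrite mulrCA; have : 0 <= K1 * a by exact: mulr_ge0.
  nra.
have {}up : 0 < u by rewrite lt_neqAle eq_sym up.
have [U00|Up] := eqVneq U 0.
  have a00 : a = 0 by move: aU; rewrite U00 expr0n /= mulr0; lra.
  have := H 1 ltr01; rewrite U00 a00 !mulr0 add0r divr1 add0r -mulrDl.
  by move/le_trans; apply; rewrite add0r ler_wpM2r ?sqr_ge0 //; lra.
have {}Up : 0 < U by rewrite lt_neqAle eq_sym Up.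
have rp : 0 < rho by lra.
have tp : 0 < u / (rho * U) by rewrite divr_gt0 // mulr_gt0.
have := H _ tp.
have -> : u ^+ 2 / (u / (rho * U)) = u * (rho * U) by field; rewrite !gt_eqF.
have le1 : u / (rho * U) * a <= u * (rho * U).
  rewrite -mulrA ler_wpM2l // [_^-1 * a]mulrC ler_pdivrMr ?mulr_gt0 //.
  by apply: le_trans aU _; rewrite le_eqVlt; apply/orP; left; apply/eqP; ring.
move/le_trans; apply.
have -> : rho ^+ 2 * (U + u) ^+ 2 = rho ^+ 2 * U ^+ 2 + (2 * rho) * (u * (rho * U)) + rho ^+ 2 * u ^+ 2.
  by ring.
have p1 : K1 * (u / (rho * U) * a) <= K1 * (u * (rho * U)) by rewrite ler_wpM2l.
have p2 : (K1 + K2) * (u * (rho * U)) <= (2 * rho) * (u * (rho * U)).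
  by rewrite ler_wpM2r ?mulr_ge0 ?ltW //; lra.
have p3 : K3 * u ^+ 2 <= rho ^+ 2 * u ^+ 2 by rewrite ler_wpM2r ?sqr_ge0 //; lra.
by move: p2; rewrite mulrDl; lra.
Qed.

(** The term linear in [a + b] is kept exact because its mean vanishes in [Ex_quad]. The cubic term
    is absorbed through [4 S r^3 <= 2 S^2 r^2 + 2 r^4] with [r = a + b], whence the constants 16 and
    24. *)
Lemma pow4_add (S a b : R) : (S + (a + b)) ^+ 4 <=
  S ^+ 4 + 4 * S ^+ 3 * (a + b) + 16 * S ^+ 2 * (a ^+ 2 + b ^+ 2) +
  24 * (a ^+ 4 + b ^+ 4).
Proof.
have h1 : 0 <= 2 * (a + b) ^+ 2 * (S - (a + b)) ^+ 2.
  by rewrite mulr_ge0 ?sqr_ge0 // mulr_ge0 ?sqr_ge0.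
have h2 : 0 <= 8 * S ^+ 2 * (a - b) ^+ 2.
  by rewrite mulr_ge0 ?sqr_ge0 // mulr_ge0 ?sqr_ge0.
have h3 : (a + b) ^+ 4 <= 8 * (a ^+ 4 + b ^+ 4).
  have e1 : (a + b) ^+ 2 <= 2 * (a ^+ 2 + b ^+ 2).
    by rewrite -subr_ge0 (_ : _ - _ = (a - b) ^+ 2) ?sqr_ge0 //; ring.
  have e2 : (a ^+ 2 + b ^+ 2) ^+ 2 <= 2 * (a ^+ 4 + b ^+ 4).
    by rewrite -subr_ge0 (_ : _ - _ = (a ^+ 2 - b ^+ 2) ^+ 2) ?sqr_ge0 //; ring.
  have : ((a + b) ^+ 2) ^+ 2 <= (2 * (a ^+ 2 + b ^+ 2)) ^+ 2.
    rewrite ler_pXn2r // nnegrE; first exact: sqr_ge0.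
      by have := sqr_ge0 a; have := sqr_ge0 b; lra.
  by rewrite -[_ ^+ 2 ^+ 2]exprM [(2 * _) ^+ 2]exprMn; lra.
rewrite -subr_ge0 (_ : _ - _ = 2 * (a + b) ^+ 2 * (S - (a + b)) ^+ 2 +
  8 * S ^+ 2 * (a - b) ^+ 2 + 3 * (8 * (a ^+ 4 + b ^+ 4) - (a + b) ^+ 4)); last by ring.
by rewrite !addr_ge0 // mulr_ge0 // subr_ge0.
Qed.

Lemma Ex_quad k : Ex P (fun w => quad k w ^+ 4) <=
  quadK * (\sum_(a < k) (\sum_(b < a) W a b ^+ 2 + W a a ^+ 2)) ^+ 2.
Proof.
elim: k => [|k IH].
  rewrite (_ : (fun w => _) = fun=> 0) ?Ex_cst; first by rewrite mulr_ge0 ?quadK_ge0 ?sqr_ge0.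
  by apply/funext => w; rewrite /quad big_ord0 expr0n.
set l := lin (W k) k; set S := quad k in IH.
have nl : nice P l := lin_nice _ _.
have nS : nice P S := quad_nice _.
have ml : measurable_fun (setT : set (sigJ x (Jlt k))) l by exact: lin_meas.
have mS : measurable_fun (setT : set (sigJ x (Jlt k))) S by exact: quad_meas.
have mlX j : measurable_fun (setT : set (sigJ x (Jlt k))) (fun w => l w ^+ j).
  exact: measurable_funX.
have mSX j : measurable_fun (setT : set (sigJ x (Jlt k))) (fun w => S w ^+ j).
  exact: measurable_funX.
rewrite big_ord_recr /=; set U := \sum_(a < k) _ in IH *.
set v := \sum_(b < k) W k b ^+ 2; set q := W k k ^+ 2.
have v0 : 0 <= v by apply: sumr_ge0 => b _; exact: sqr_ge0.
have q0 : 0 <= q by exact: sqr_ge0.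
have U0 : 0 <= U.
  by apply: sumr_ge0 => b _; rewrite addr_ge0 ?sqr_ge0 // sumr_ge0 // => ? _; rewrite sqr_ge0.
have [L0 [M0 [C20 C40]]] := conj linK_ge0 (conj m4_ge0 (conj c2_ge0 c4_ge0)).
apply: (@quad_recur (32 + 8 * c2) (32 * linK + 8 * c2) (384 * m4 * linK + 24 * c4)
  _ (Ex P (fun w => S w ^+ 4))).
- lra.
- lra.
- by have := mulr_ge0 M0 L0; lra.
- by apply: Ex_ge0 => w; rewrite exprn_even_ge0.
- exact: IH.
- exact: U0.
- exact: addr_ge0.
- lra.
move=> t t0.
pose F w := S w ^+ 4 + (8 * ((S w ^+ 3 * l w) * xi k w) +
  ((4 * W k k) * (S w ^+ 3 * (xi k w ^+ 2 - 1)) +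
  (64 * ((S w ^+ 2 * l w ^+ 2) * xi k w ^+ 2) +
  ((16 * q) * (S w ^+ 2 * (xi k w ^+ 2 - 1) ^+ 2) +
  (384 * (l w ^+ 4 * xi k w ^+ 4) +
   (24 * q ^+ 2) * (xi k w ^+ 2 - 1) ^+ 4))))).
have le1 : Ex P (fun w => quad k.+1 w ^+ 4) <= Ex P F.
  apply: Ex_le; [by nice_tac|by rewrite /F; nice_tac|move=> w].
  rewrite {1}/quad big_ord_recr /= -/(quad k w) -/S -/l.
  apply: le_trans (pow4_add _ _ _) _.
  by rewrite le_eqVlt; apply/orP; left; apply/eqP; rewrite /F /q; ring.
apply: le_trans le1 _; rewrite /F !ExD ?ExZ; nice_tac.
rewrite Ex_xi1; [|by apply: measurable_funM|by nice_tac].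
rewrite (indep_xi (g := fun w => S w ^+ 3) (h := fun t => t ^+ 2 - 1)) //; first last.
  by nice_tac.
  by nice_tac.
  by apply: measurable_funB => //; exact: measurable_funX.
  by nice_tac.
rewrite (_ : Ex P (fun w => x (0, 0)%N w ^+ 2 - 1) = 0); last first.
  by rewrite ExB ?var1 ?Ex_cst ?subrr //; nice_tac.
rewrite Ex_xi2; [|by apply: measurable_funM|by nice_tac].
rewrite (indep_xi (g := fun w => S w ^+ 2) (h := fun t => (t ^+ 2 - 1) ^+ 2)) //; first last.
  by nice_tac.
  by nice_tac.
  by apply: measurable_funX; apply: measurable_funB => //; exact: measurable_funX.
  by nice_tac.
rewrite Ex_xi4 //; last by nice_tac.
have -> : Ex P (fun w => (xi k w ^+ 2 - 1) ^+ 4) = c4.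
  apply: (ident_Ex (i := (r, k)) (f := fun t => (t ^+ 2 - 1) ^+ 4)).
  - by apply: measurable_funX; apply: measurable_funB => //; exact: measurable_funX.
  - by nice_tac.
  - by nice_tac.
rewrite -/c2 !mulr0 !add0r.
have [_ _ l4] := Ex_lin (W k) k; rewrite -/l -/v in l4.
(* Young's inequality with weight [t], left free until [quad_recur] balances it against the previous
   fourth moment. *)
have amgm (f g : T -> R) : nice P f -> nice P g ->
    Ex P (fun w => f w * g w) <= (t * Ex P (fun w => f w ^+ 2) + Ex P (fun w => g w ^+ 2) / t) / 2.
  move=> nf ng; have -> : (t * Ex P (fun w => f w ^+ 2) + Ex P (fun w => g w ^+ 2) / t) / 2 =
     Ex P (fun w => t / 2 * f w ^+ 2 + (2 * t)^-1 * g w ^+ 2).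
    rewrite ExD ?ExZ; nice_tac; by field; rewrite gt_eqF.
  apply: Ex_le; nice_tac => w.
  rewrite -subr_ge0 (_ : _ - _ = (t * f w - g w) ^+ 2 / (2 * t)); last by field; rewrite gt_eqF.
  by rewrite divr_ge0 ?sqr_ge0 // mulr_ge0 ?ltW.
have S2l2 := amgm (fun w => S w ^+ 2) (fun w => l w ^+ 2) _ _.
have {S2l2} := S2l2 (niceX _ nS) (niceX _ nl).
have S2q := amgm (fun w => S w ^+ 2) (fun=> q) (niceX _ nS) (nice_cst _ _).
have XX (f : T -> R) : (fun w => (f w ^+ 2) ^+ 2) = (fun w => f w ^+ 4).
  by apply/funext => w; rewrite -exprM.
rewrite !XX => S2l2; move: S2q; rewrite XX Ex_cst.
rewrite (_ : (fun w => _) = fun w => q * S w ^+ 2); last by apply/funext => w; rewrite mulrC.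
rewrite ExZ; last by nice_tac.
set a := Ex P (fun w => S w ^+ 4) in S2l2 *; set e := Ex P (fun w => l w ^+ 4) in l4 S2l2 *.
move=> S2q.
have a0 : 0 <= a by apply: Ex_ge0 => w; rewrite exprn_even_ge0.
have t1 : 0 < t^-1 by rewrite invr_gt0.
have u2v : v ^+ 2 <= (v + q) ^+ 2 by rewrite ler_pXn2r ?nnegrE ?addr_ge0 // lerDl.
have u2q : q ^+ 2 <= (v + q) ^+ 2 by rewrite ler_pXn2r ?nnegrE ?addr_ge0 // lerDr.
have b1 : e <= linK * (v + q) ^+ 2 by apply: le_trans l4 _; rewrite ler_wpM2l.
have b1t : e / t <= linK * ((v + q) ^+ 2 / t) by rewrite mulrA ler_pM2r.
have b2t : q ^+ 2 / t <= (v + q) ^+ 2 / t by rewrite ler_pM2r.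
have b3 : 16 * c2 * (q * Ex P (fun w => S w ^+ 2)) <=
    16 * c2 * ((t * a + (v + q) ^+ 2 / t) / 2).
  by apply: ler_wpM2l; [lra|apply: le_trans S2q _; lra].
have b4 : 384 * m4 * e <= 384 * m4 * (linK * (v + q) ^+ 2).
  by apply: (ler_wpM2l _ b1); lra.
have b5 : 24 * c4 * q ^+ 2 <= 24 * c4 * (v + q) ^+ 2.
  by apply: (ler_wpM2l _ u2q); lra.
have b6 : Ex P (fun w => S w ^+ 2 * l w ^+ 2) <= (t * a + linK * ((v + q) ^+ 2 / t)) / 2.
  by apply: le_trans S2l2 _; lra.
move: b3 b4 b5 b6; move: (Ex P _) (Ex P _) => e1 e2 b3 b4 b5 b6.
set z := (v + q) ^+ 2 / t in b3 b6 *; set y := (v + q) ^+ 2 in b4 b5 *.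
have -> : a + (32 + 8 * c2) * (t * a) + (32 * linK + 8 * c2) * z + (384 * m4 * linK + 24 * c4) * y =
  a + 64 * ((t * a + linK * z) / 2) + 16 * c2 * ((t * a + z) / 2) + 384 * m4 * (linK * y) + 24 * c4 * y.
  by field.
lra.
Qed.

End Row.

Lemma sum_sym_split (f : nat -> nat -> R) k : (forall a b, f a b = f b a) ->
  \sum_(a < k) \sum_(b < k) f a b =
  \sum_(a < k) (f a a + 2 * \sum_(b < a) f a b).
Proof.
move=> fC; elim: k => [|k IH]; first by rewrite !big_ord0.
rewrite big_ord_recr [RHS]big_ord_recr /= -IH big_ord_recr /=.
under eq_bigr do rewrite big_ord_recr /=.
have fCs : \sum_(a < k) f a k = \sum_(a < k) f k a by apply: eq_bigr.
by rewrite big_split /= fCs; ring.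
Qed.

(** Extension by 0 to natural indices, so that the recursion over the entries of a row needs no
    ordinals. *)
Definition mxnat p (M : 'M[R]_p) (a b : nat) : R :=
  match insub a : option 'I_p, insub b : option 'I_p with
  | Some i, Some j => M i j
  | _, _ => 0
  end.

Lemma mxnatE p (M : 'M[R]_p) (i j : 'I_p) : mxnat M i j = M i j.
Proof. by rewrite /mxnat !valK. Qed.

Lemma mxnatC p (M : 'M[R]_p) a b : M^T = M -> mxnat M a b = mxnat M b a.
Proof.
move=> sM; rewrite /mxnat; case: (insub a) => [i|]; case: (insub b) => [j|] //.
by rewrite -{1}sM mxE.
Qed.

Definition xrow p r w : 'rV[R]_p := \row_j x (r, j : nat) w.

Lemma Ex_row_quad4 p r (M : 'M[R]_p) : M^T = M ->
  Ex P (fun w => (dot (xrow p r w *m M) (xrow p r w) - \tr M) ^+ 4) <=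
  quadK * \tr (M *m M) ^+ 2.
Proof.
move=> sM; pose W := mxnat M.
have WC a b : W a b = W b a by exact: mxnatC.
have -> : (fun w => (dot (xrow p r w *m M) (xrow p r w) - \tr M) ^+ 4) =
  (fun w => (\sum_(a < p) (W a a * (x (r, a : nat) w ^+ 2 - 1) +
    2 * (x (r, a : nat) w * \sum_(b < a) W a b * x (r, b : nat) w))) ^+ 4).
  apply/funext => w; congr (_ ^+ 4); rewrite dotE.
  transitivity (\sum_(a < p) \sum_(b < p)
      W a b * x (r, a : nat) w * x (r, b : nat) w - \sum_(a < p) W a a).
    congr (_ - _); last by apply: eq_bigr => a _; rewrite /W mxnatE.
    apply: eq_bigr => a _; rewrite mxE mulr_suml; apply: eq_bigr => b _.
    by rewrite !mxE WC /W mxnatE; ring.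
  rewrite (sum_sym_split (f := fun a b => W a b * x (r, a) w * x (r, b) w)); last first.
    by move=> a b; rewrite WC; ring.
  rewrite -sumrB; apply: eq_bigr => a _.
  have -> : \sum_(b < a) W a b * x (r, a : nat) w * x (r, b : nat) w =
      x (r, a : nat) w * \sum_(b < a) W a b * x (r, b : nat) w.
    by rewrite mulr_sumr; apply: eq_bigr => b _; ring.
  ring.
apply: le_trans (Ex_quad r W p) _; apply: ler_wpM2l; first exact: quadK_ge0.
have sqsum (k : nat) (f : nat -> R) : 0 <= \sum_(b < k) f b ^+ 2.
  by apply: sumr_ge0 => b _; exact: sqr_ge0.
rewrite ler_pXn2r // ?nnegrE.
- have -> : \tr (M *m M) = \sum_(a < p) \sum_(b < p) W a b ^+ 2.
    apply: eq_bigr => a _; rewrite mxE; apply: eq_bigr => b _.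
    by rewrite /W mxnatE expr2 -{2}sM mxE.
  rewrite (sum_sym_split (f := fun a b => W a b ^+ 2)); last by move=> a b; rewrite WC.
  by apply: ler_sum => a _; have := sqsum a (W a); lra.
- by apply: sumr_ge0 => a _; rewrite addr_ge0 ?sqr_ge0.
- apply: sumr_ge0 => a _; rewrite mxE; apply: sumr_ge0 => b _.
  by rewrite -{1}sM mxE -expr2 sqr_ge0.
Qed.

Section RandomCoefficients.
Variables (p r : nat).

Definition other_rows : set (nat * nat) := [set i | i.1 <> r].
Definition this_row : set (nat * nat) := [set i | i.1 = r].

Lemma rows_disjoint : other_rows `&` this_row `<=` set0.
Proof. by move=> i []. Qed.

Lemma nice_xrow j : nice P (fun w => xrow p r w 0 j).
Proof.
rewrite (_ : (fun w => _) = x (r, j : nat)) //.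
by apply/funext => w; rewrite mxE.
Qed.
Hint Resolve nice_xrow : core.

Lemma measurable_xrow j :
  measurable_fun (setT : set (sigJ x this_row)) (fun w => xrow p r w 0 j).
Proof.
rewrite (_ : (fun w => _) = x (r, j : nat)); first exact: measurable_coord.
by apply/funext => w; rewrite mxE.
Qed.

Variable A : T -> 'M[R]_p.
Hypothesis nA : forall i j, nice P (fun w => A w i j).
Hypothesis mA : forall i j,
  measurable_fun (setT : set (sigJ x other_rows)) (fun w => A w i j).
Hint Resolve nA : core.

Lemma Ex_row_quad : Ex P (fun w => dot (xrow p r w *m A w) (xrow p r w)) =
  Ex P (fun w => \tr (A w)).
Proof.
have -> : (fun w => dot (xrow p r w *m A w) (xrow p r w)) = (fun w =>
  \sum_i \sum_j A w j i * (xrow p r w 0 j * xrow p r w 0 i)).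
  apply/funext => w; rewrite dotE; apply: eq_bigr => i _.
  by rewrite mxE mulr_suml; apply: eq_bigr => j _; ring.
have n1 i j : nice P (fun w => A w j i * (xrow p r w 0 j * xrow p r w 0 i)) by nice_tac.
rewrite Ex_sum; last by move=> i; nice_tac.
rewrite [RHS]Ex_sum //; apply: eq_bigr => i _; rewrite Ex_sum //.
have E2 j : Ex P (fun w => A w j i * (xrow p r w 0 j * xrow p r w 0 i)) =
    Ex P (fun w => A w j i) * (j == i)%:R.
  rewrite (indep_mul indx rows_disjoint) //; [|by apply: measurable_funM; exact: measurable_xrow|by nice_tac].
  congr (_ * _); have [->|ji] := eqVneq j i.
    rewrite -[RHS]var1 -(ident_Ex (i := (r, i : nat)) (f := fun t => t ^+ 2)).
    - by congr (Ex P); apply/funext => w; rewrite mxE expr2.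
    - exact: measurable_funX.
    - by nice_tac.
    - by nice_tac.
  rewrite (_ : (fun w => _) = fun w => x (r, j : nat) w * x (r, i : nat) w); last first.
    by apply/funext => w; rewrite !mxE.
  rewrite (indep_mul indx (J := [set (r, j : nat)]) (J' := [set (r, i : nat)])) //.
  - rewrite (_ : Ex P (x (r, j : nat)) = 0) ?mul0r //.
    by rewrite (ident_Ex (i := (r, j : nat)) (f := id)).
  - by move=> k /= [-> [/val_inj/eqP]]; rewrite (negPf ji).
  - exact: measurable_coord.
  - exact: measurable_coord.
rewrite (bigD1 i) //= E2 eqxx mulr1 big1 ?addr0 // => j ji.
by rewrite E2 (negPf ji) mulr0.
Qed.

(** [A] and the weight [g] depend on the other rows only, so they can be frozen by [indep_le] and
    the bound for a fixed matrix applies. *)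
Lemma Ex_row_quad4_rand (g : T -> R) : (forall w, (A w)^T = A w) ->
  (forall w, 0 <= g w) -> nice P g ->
  measurable_fun (setT : set (sigJ x other_rows)) g ->
  Ex P (fun w => g w * (dot (xrow p r w *m A w) (xrow p r w) - \tr (A w)) ^+ 4) <=
  quadK * Ex P (fun w => g w * \tr (A w *m A w) ^+ 2).
Proof.
move=> sA g0 ng mg.
have dE w w' : dot (xrow p r w' *m A w) (xrow p r w') =
    \sum_i \sum_j A w j i * (xrow p r w' 0 j * xrow p r w' 0 i).
  rewrite dotE; apply: eq_bigr => i _.
  by rewrite mxE mulr_suml; apply: eq_bigr => j _; ring.
have trE w : \tr (A w *m A w) = \sum_i \sum_j A w i j * A w j i.
  by apply: eq_bigr => i _; rewrite mxE.
have ntr : nice P (fun w => \tr (A w *m A w)).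
  rewrite (_ : (fun w => _) = fun w => \sum_i \sum_j A w i j * A w j i); first by nice_tac.
  exact/funext.
rewrite -ExZ; last by nice_tac.
apply: (indep_le indx rows_disjoint (f := fun z => g z.1 *
  (dot (xrow p r z.2 *m A z.1) (xrow p r z.2) - \tr (A z.1)) ^+ 4)).
- apply: measurable_funM; first exact: (measurableT_comp mg).
  apply: measurable_funX; apply: measurable_funB.
    under eq_fun do rewrite dE.
    apply: measurable_sum => i; apply: measurable_sum => j; apply: measurable_funM.
      exact: (measurableT_comp (mA j i)).
    apply: measurable_funM.
      exact: (measurableT_comp (measurable_xrow j)).
    exact: (measurableT_comp (measurable_xrow i)).
  apply: measurable_sum => i; exact: (measurableT_comp (mA i i)).
- by move=> z; rewrite mulr_ge0 // exprn_even_ge0.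
- under eq_fun do rewrite dE /mxtrace; nice_tac.
- by move=> w /=; under eq_fun do rewrite dE /mxtrace; nice_tac.
- by nice_tac.
- move=> w /=; rewrite ExZ; last by under eq_fun do rewrite dE /mxtrace; nice_tac.
  rewrite mulrCA; apply: ler_wpM2l => //; exact: Ex_row_quad4.
Qed.

End RandomCoefficients.

End ArrayMoments.

(** * Measurability of matrix-valued functions *)

Section MatrixMeasurability.
Context {R : realType} {d : measure_display} {T : measurableType d}.

Definition mxmeas m n (f : T -> 'M[R]_(m, n)) : Prop :=
  forall i j, measurable_fun setT (fun w => f w i j).

Lemma measurable_invr : measurable_fun setT (fun r : R => r^-1).
Proof.
have -> : (fun r : R => r^-1) = (fun r => if r == 0 then 0 else r^-1).
  by apply/funext => r; case: eqVneq => // ->; rewrite invr0.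
apply: measurable_fun_if => //; first exact: measurable_fun_eqr.
rewrite setTI; apply: (open_continuous_measurable_fun (f := fun r : R => r^-1)).
  rewrite (_ : _ @^-1` _ = [set r | r != 0]); first exact: open_neq.
  by apply/seteqP; split => r /=; case: (r == 0).
move=> r; rewrite inE /= => /negbT r0; exact: inv_continuous.
Qed.

Lemma measurable_funV (f : T -> R) : measurable_fun setT f ->
  measurable_fun setT (fun w => (f w)^-1).
Proof. by move=> mf; exact: (measurableT_comp measurable_invr). Qed.

Lemma mxmeas_cst m n (M : 'M[R]_(m, n)) : mxmeas (fun=> M).
Proof. by move=> i j; exact: measurable_cst. Qed.

Lemma mxmeasD m n (f g : T -> 'M[R]_(m, n)) : mxmeas f -> mxmeas g ->
  mxmeas (fun w => f w + g w).
Proof.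
move=> mf mg i j; under eq_fun do rewrite mxE; exact: measurable_funD.
Qed.

Lemma mxmeasZ m n (a : T -> R) (f : T -> 'M[R]_(m, n)) :
  measurable_fun setT a -> mxmeas f -> mxmeas (fun w => a w *: f w).
Proof.
move=> ma mf i j; under eq_fun do rewrite mxE; exact: measurable_funM.
Qed.

Lemma mxmeasN m n (f : T -> 'M[R]_(m, n)) : mxmeas f -> mxmeas (fun w => - f w).
Proof.
move=> mf; under eq_fun do rewrite -scaleN1r; exact: mxmeasZ.
Qed.

Lemma mxmeasB m n (f g : T -> 'M[R]_(m, n)) : mxmeas f -> mxmeas g ->
  mxmeas (fun w => f w - g w).
Proof. by move=> mf mg; apply: mxmeasD => //; exact: mxmeasN. Qed.

Lemma mxmeas_scalar n (a : T -> R) : measurable_fun setT a ->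
  mxmeas (fun w => (a w)%:M : 'M[R]_n).
Proof.
move=> ma; under eq_fun do rewrite -scalemx1.
by apply: mxmeasZ => //; exact: mxmeas_cst.
Qed.

Lemma mxmeas_tr m n (f : T -> 'M[R]_(m, n)) : mxmeas f -> mxmeas (fun w => (f w)^T).
Proof. by move=> mf i j; under eq_fun do rewrite mxE; exact: mf. Qed.

Lemma mxmeasM m n p (f : T -> 'M[R]_(m, n)) (g : T -> 'M[R]_(n, p)) :
  mxmeas f -> mxmeas g -> mxmeas (fun w => f w *m g w).
Proof.
move=> mf mg i j; under eq_fun do rewrite mxE.
by apply: measurable_sum => k; exact: measurable_funM.
Qed.

Lemma measurable_trace n (f : T -> 'M[R]_n) : mxmeas f ->
  measurable_fun setT (fun w => \tr (f w)).
Proof. by move=> mf; apply: measurable_sum => k; exact: mf. Qed.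

Lemma measurable_dot n (f g : T -> 'rV[R]_n) : mxmeas f -> mxmeas g ->
  measurable_fun setT (fun w => dot (f w) (g w)).
Proof.
move=> mf mg; under eq_fun do rewrite dotE.
by apply: measurable_sum => k; exact: measurable_funM.
Qed.

Lemma measurable_det n (f : T -> 'M[R]_n) : mxmeas f ->
  measurable_fun setT (fun w => \det (f w)).
Proof.
move=> mf; rewrite /determinant; apply: measurable_sum => s.
by apply: measurable_funM => //; apply: measurable_prod => i _; exact: mf.
Qed.

Lemma mxmeas_inv n (f : T -> 'M[R]_n) : mxmeas f -> mxmeas (fun w => invmx (f w)).
Proof.
move=> mf i j; have madj : measurable_fun setT (fun w => (\adj (f w)) i j).
  under eq_fun do rewrite mxE; apply: measurable_funM => //.
  by apply: measurable_det => a b; under eq_fun do rewrite !mxE; exact: mf.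
(* [invmx] returns its argument on a singular matrix, hence the case distinction on the
   determinant. *)
have -> : (fun w => invmx (f w) i j) = (fun w => if \det (f w) == 0 then f w i j
    else (\det (f w))^-1 * (\adj (f w)) i j).
  apply/funext => w; rewrite /invmx unitmxE unitfE.
  by case: eqVneq => //= _; rewrite mxE.
apply: measurable_fun_ifT => //.
  by apply: measurable_fun_eqr => //; exact: measurable_det.
by apply: measurable_funM => //; apply: measurable_funV; exact: measurable_det.
Qed.

End MatrixMeasurability.

Lemma expR_neg_le {R : realType} (u : R) : 0 <= u <= 1 -> expR (- u) <= 1 - u / 2.
Proof.
move=> /andP[u0 u1]; rewrite expRN invf_ple ?posrE ?expR_gt0 //; last lra.
apply: le_trans (expR_ge1Dx u); rewrite invf_ple ?posrE //; [|lra|lra].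
by rewrite -(@ler_pM2r _ (1 + u)) ?mulVf ?gt_eqF //; [nra|lra|lra].
Qed.

Lemma expR_small_le {R : realType} (g t : R) : 0 < g <= 1 -> 0 <= t <= g / 2 ->
  expR t <= 1 + (1 + g) * t.
Proof.
move=> /andP[g0 g1] /andP[t0 tg].
have t1 : 0 < 1 - t by lra.
have : (expR t)^-1 >= 1 - t by rewrite -expRN; apply: le_trans (expR_ge1Dx (- t)).
rewrite -(@ler_pM2r _ (expR t)) ?expR_gt0 // mulVf ?gt_eqF ?expR_gt0 // => H.
rewrite -(@ler_pM2r _ (1 - t)) // mulrC; apply: le_trans H _.
have : (1 + g) * t <= g by nra.
nra.
Qed.

(** * The upper barrier *)

Section UpperBarrier.
Context {R : realType} {d : measure_display} {T : measurableType d}.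
Variables (P : probability T R) (x : nat * nat -> {RV P >-> R}).
Hypotheses (indx : mutually_independent x) (idx : identically_distributed x).
Hypotheses (nx0 : nice P (x (0, 0)%N)).
Hypotheses (mean0 : Ex P (x (0, 0)%N) = 0).
Hypotheses (var1 : Ex P (fun w => x (0, 0)%N w ^+ 2) = 1).

Section Process.
Variables (p : nat) (D : 'M[R]_p) (N k c M L m0 del : R).
Hypotheses (pD : posdef D) (N0 : 0 < N) (k01 : 0 < k <= 1) (c0 : 0 < c).
Hypotheses (del0 : 0 < del) (ME : M = m0 + 2 * del) (M1 : M < 1) (L0 : 0 < L).
Hypothesis trD : \tr (invmx D) <= m0 * N.

Definition extra_shift (B : 'M[R]_p) : R :=
  if k ^+ 2 * N ^+ 2 < \tr (invmx B *m invmx B) then (k ^+ 2 * N)^-1 else 0.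

Definition shifted (B : 'M[R]_p) : 'M[R]_p := B + (extra_shift B + c / N)%:M.

(** The shift precedes the removal of the row, so the matrix that a row meets depends on earlier
    rows only and already satisfies the bounds of [barrier_shift]. *)
Fixpoint barrier (i : nat) (w : T) : 'M[R]_p * R :=
  if i is j.+1 then
    let B := (barrier j w).1 in
    (shifted B - N^-1 *: ((xrow x p j w)^T *m xrow x p j w),
     (barrier j w).2 + extra_shift B)
  else (D, 0).

(* The second term charges the extra shifts, so that a bound on [potential]
   also bounds their sum. *)
Definition potential (i : nat) (w : T) : R :=
  \tr (invmx (barrier i w).1) / N + k ^+ 4 * N / 2 * (barrier i w).2.

Definition row_form (i : nat) (w : T) : R :=
  dot (xrow x p i w *m invmx (shifted (barrier i w).1)) (xrow x p i w).

(** A stopping flag: it never recovers after a failure, and positivity of the barrier is derived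
    from it. *)
Fixpoint good (i : nat) (w : T) : bool :=
  if i is j.+1 then [&& good j w, row_form j w / N <= M &
                       potential j.+1 w <= m0 + del]
  else true.

Let m00 : 0 <= m0.
Proof.
rewrite -(pmulr_lge0 _ N0); apply: le_trans trD.
have [Q [f [OQ -> f0]]] := posdef_sfun (posdef_inv pD).
by rewrite mxtrace_sfun // sumr_ge0 // => i _; exact: ltW.
Qed.

Let params : [/\ M < 1, 0 < del, M = m0 + 2 * del & 0 <= m0].
Proof. by []. Qed.

Lemma extra_shift_ge0 B : 0 <= extra_shift B.
Proof.
case/andP: k01 => k0 _; rewrite /extra_shift; case: ifP => // _.
by rewrite invr_ge0 mulr_ge0 ?exprn_ge0 ?ltW.
Qed.

Lemma good_barrier i w : good i w -> [/\ posdef (barrier i w).1,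
  0 <= (barrier i w).2 & potential i w <= m0 + del].
Proof.
have [M1' del0' ME' m00'] := params.
elim: i => [_|i IH /= /and3P[/IH[pB S0 pot] qM pot']].
  split => //; rewrite /potential /= mulr0 addr0 ler_pdivrMr //.
  by apply: le_trans trD _; apply: ler_wpM2r; [exact: ltW|lra].
split => //; last by rewrite addr_ge0 // extra_shift_ge0.
have trN : \tr (invmx (barrier i w).1) <= N.
  rewrite -[leRHS]mul1r -ler_pdivrMr //; apply: le_trans (_ : potential i w <= _); last lra.
  rewrite lerDl mulr_ge0 //; case/andP: k01 => k0 _.
  by rewrite divr_ge0 // mulr_ge0 ?exprn_ge0 ?ltW.
have [pB1 _ _ _] := barrier_shift pB N0 k01 c0 trN.
by apply: rank1_posdef => //; apply: le_lt_trans qM M1.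
Qed.

Lemma good_step i w : good i w -> let Wt := invmx (shifted (barrier i w).1) in
  [/\ posdef (shifted (barrier i w).1), \tr Wt <= (m0 + del) * N,
      \tr (Wt *m Wt) <= k ^+ 2 * N ^+ 2,
      0 <= potential i w &
      row_form i w / N <= M ->
        potential i.+1 w <= potential i w - c * (\tr (Wt *m Wt) / N ^+ 2) +
          dot (xrow x p i w *m (Wt *m Wt)) (xrow x p i w) / (N ^+ 2 * (1 - M)) /\
        0 <= dot (xrow x p i w *m (Wt *m Wt)) (xrow x p i w) <= k * N * (M * N)].
Proof.
have [M1' del0' ME' m00'] := params.
move=> gi Wt; have [pB S0 pot] := good_barrier gi.
have /andP[k0 k1] := k01.
have kN : 0 <= k ^+ 4 * N / 2 by rewrite divr_ge0 // mulr_ge0 ?exprn_ge0 ?ltW.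
have trB0 : 0 <= \tr (invmx (barrier i w).1).
  have [Q [f [OQ -> f0]]] := posdef_sfun (posdef_inv pB).
  by rewrite mxtrace_sfun // sumr_ge0 // => j _; exact: ltW.
have pot0 : 0 <= potential i w.
  by rewrite addr_ge0 ?(divr_ge0 trB0 (ltW N0)) ?(mulr_ge0 kN S0).
have trN : \tr (invmx (barrier i w).1) <= N.
  rewrite -[leRHS]mul1r -ler_pdivrMr //; apply: le_trans (_ : potential i w <= _); last lra.
  by rewrite lerDl mulr_ge0.
have [pB1 drop tr2 quad] := barrier_shift pB N0 k01 c0 trN.
rewrite -/(extra_shift _) -/(shifted _) -/Wt in pB1 drop tr2 quad.
have W20 : 0 <= \tr (Wt *m Wt).
  have [Q [f [OQ WE f0]]] := posdef_sfun (posdef_inv pB1).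
  rewrite -/Wt in WE; rewrite WE sfunM // mxtrace_sfun // sumr_ge0 // => j _.
  by rewrite mulr_ge0 ?ltW.
split => //.
  have dt0 : 0 <= c * (\tr (Wt *m Wt) / N ^+ 2).
    by rewrite mulr_ge0 ?(ltW c0) // divr_ge0 // sqr_ge0.
  have es0 : 0 <= k ^+ 4 * N / 2 * extra_shift (barrier i w).1.
    by rewrite mulr_ge0 ?extra_shift_ge0.
  have kS : 0 <= k ^+ 4 * N / 2 * (barrier i w).2 by rewrite mulr_ge0.
  rewrite -ler_pdivrMr //; move: pot; rewrite /potential; lra.
move=> qM; have q1 : row_form i w / N < 1 := le_lt_trans qM M1.
have fM : row_form i w <= M * N by rewrite -ler_pdivrMr.
have f2 := quad (xrow x p i w).
have f20 : 0 <= dot (xrow x p i w *m (Wt *m Wt)) (xrow x p i w).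
  rewrite mulmxA dot_mull.
  have [-> _] : Wt^T = Wt /\ True by split => //; case: (posdef_inv pB1).
  exact: dot_ge0.
split; last first.
  rewrite f20; apply: le_trans f2 _; rewrite ler_wpM2l //.
  by rewrite mulr_ge0 ?ltW.
rewrite /potential [barrier i.+1 w]/= [X in X.1]/= [X in X.2]/=.
rewrite (sherman_morrison_tr N0 pB1 q1) -/Wt -/(row_form i w) /=.
set y := dot _ _ in f20 *.
have -> : (\tr Wt + y / (N * (1 - row_form i w / N))) / N =
    \tr Wt / N + y / (N ^+ 2 * (1 - row_form i w / N)).
  by rewrite mulrDl -mulrA -invfM; congr (_ + _ / _); ring.
have N2 : 0 < N ^+ 2 by rewrite exprn_gt0.
have le2 : y / (N ^+ 2 * (1 - row_form i w / N)) <= y / (N ^+ 2 * (1 - M)).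
  rewrite ler_wpM2l // lef_pV2 ?posrE ?mulr_gt0 ?subr_gt0 //.
  by rewrite ler_pM2l // lerD2l lerN2.
lra.
Qed.

Lemma barrier_meas J i : (forall a b, (a < i)%N -> J (a, b)) ->
  mxmeas (T := sigJ x J) (fun w => (barrier i w).1) /\
  measurable_fun (setT : set (sigJ x J)) (fun w => (barrier i w).2).
Proof.
elim: i => [_|i IH iJ]; first by split => //; exact: mxmeas_cst.
have [a b ab|mB mS] := IH; first by apply: iJ; exact: ltnW.
have mx : mxmeas (T := sigJ x J) (xrow x p i).
  move=> a j; rewrite (ord1 a) (_ : (fun w => _) = x (i, j : nat)).
    by apply: measurable_coord; exact: iJ.
  by apply/funext => w; rewrite mxE.
have mE : measurable_fun (setT : set (sigJ x J)) (fun w => extra_shift (barrier i w).1).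
  apply: measurable_fun_ifT => //; apply: measurable_fun_ltr => //.
  by apply: measurable_trace; apply: mxmeasM; exact: mxmeas_inv.
split; last exact: measurable_funD.
apply: mxmeasB; first by apply: mxmeasD => //; apply: mxmeas_scalar; exact: measurable_funD.
apply: mxmeasZ => //; apply: mxmeasM => //; exact: mxmeas_tr.
Qed.

Lemma shifted_meas J i : (forall a b, (a < i)%N -> J (a, b)) ->
  mxmeas (T := sigJ x J) (fun w => invmx (shifted (barrier i w).1)).
Proof.
move=> iJ; have [mB _] := barrier_meas iJ; apply: mxmeas_inv; apply: mxmeasD => //.
apply: mxmeas_scalar; apply: measurable_funD => //.
apply: measurable_fun_ifT => //; apply: measurable_fun_ltr => //.
by apply: measurable_trace; apply: mxmeasM; exact: mxmeas_inv.
Qed.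

Lemma potential_meas J i : (forall a b, (a < i)%N -> J (a, b)) ->
  measurable_fun (setT : set (sigJ x J)) (potential i).
Proof.
move=> iJ; have [mB mS] := barrier_meas iJ.
apply: measurable_funD; last exact: measurable_funM.
by apply: measurable_funM => //; apply: measurable_trace; exact: mxmeas_inv.
Qed.

Lemma good_meas J i : (forall a b, (a < i)%N -> J (a, b)) ->
  measurable_fun (setT : set (sigJ x J)) (good i).
Proof.
elim: i => [_|i IH iJ]; first exact: measurable_cst.
have iJ' a b : (a < i)%N -> J (a, b) by move=> ai; apply: iJ; exact: ltnW.
have mx : mxmeas (T := sigJ x J) (xrow x p i).
  move=> a j; rewrite (ord1 a) (_ : (fun w => _) = x (i, j : nat)).
    by apply: measurable_coord; exact: iJ.
  by apply/funext => w; rewrite mxE.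
apply: measurable_and; first exact: IH.
apply: measurable_and; apply: measurable_fun_ler => //; last exact: potential_meas.
apply: measurable_funM => //; apply: measurable_dot => //.
by apply: mxmeasM => //; exact: shifted_meas.
Qed.

(* At most the indicator of [good i], and of nondecreasing mean in [i]: hence
   [P (good n) >= lyapunov 0], which is close to 1 for large [L]. *)
Definition lyapunov i w : R :=
  if good i w then 1 - expR (L * (potential i w - m0 - del)) else 0.

Lemma lyapunov_meas i : measurable_fun setT (lyapunov i).
Proof.
apply: (@measurable_sigJ _ _ _ _ x _ _ setT).
apply: measurable_fun_ifT => //; first exact: good_meas.
apply: measurable_funB => //; apply: (measurableT_comp (@measurable_expR R)).
apply: measurable_funM => //; apply: measurable_funB => //.
by apply: measurable_funB => //; exact: potential_meas.
Qed.

Lemma lyapunov_bnd i w : 0 <= lyapunov i w <= (good i w)%:R.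
Proof.
have [M1' del0' ME' m00'] := params.
rewrite /lyapunov; case: ifP => [gi|_]; last by rewrite lexx.
have [_ _ pot] := good_barrier gi.
rewrite subr_ge0 lerBlDr lerDl expR_ge0 andbT -expR0 ler_expR.
by rewrite mulr_ge0_le0 ?(ltW L0) //; lra.
Qed.

Lemma nice_lyapunov i : nice P (lyapunov i).
Proof.
apply: (@nice_bounded _ _ _ _ _ 1) => [|w]; first exact: lyapunov_meas.
have /andP[l0 l1] := lyapunov_bnd i w; rewrite ger0_norm //.
by apply: le_trans l1 _; case: (good i w).
Qed.

Variable g : R.
Hypotheses (g01 : 0 < g <= 1) (cE : c = (1 + 2 * g) / (1 - M)).
Hypothesis kL : L * k <= g / 2 * (1 - M).
Hypothesis kquad :
  quadK x * k ^+ 2 <= del ^+ 4 * expR (- (L * (m0 + del))) * L * g / 2.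

(** On average the row raises the potential by at most about [tr(Wt^2) / (N^2 (1 - M))], while the
    shift lowers it by [c tr(Wt^2) / N^2]. Of the surplus [2 g] in [c], one [g] pays for linearizing
    the exponential; the other leaves a negative drift that, by [kquad], covers the probability of a
    row form above [M]. *)
Lemma lyapunov_step i : Ex P (lyapunov i) <= Ex P (lyapunov i.+1).
Proof.
have [M1' del0' ME' m00'] := params; have kL' := kL.
have /andP[k0 k1] := k01; have /andP[g0 g1] := g01.
have M0 : 0 < 1 - M by lra.
pose J := other_rows i.
have iJ a b : (a < i)%N -> J (a, b) by rewrite /J /other_rows /= => ai ia; rewrite ia ltnn in ai.
pose gb w : R := (good i w)%:R.
pose Wt w := invmx (shifted (barrier i w).1).
(* The flag as a factor bounds the entries, hence makes them [nice], and keeps them measurable in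
   the other rows. *)
pose A w := gb w *: Wt w.
pose dt w := \tr (A w *m A w) / N ^+ 2.
pose e w := gb w * expR (L * (potential i w - c * dt w - m0 - del)).
have mgb : measurable_fun (setT : set (sigJ x J)) gb.
  rewrite /gb (_ : (fun w => _) = fun w => if good i w then 1 else 0).
    by apply: measurable_fun_ifT => //; exact: good_meas.
  by apply/funext => w; case: (good i w).
have mA : mxmeas (T := sigJ x J) A by apply: mxmeasZ => //; exact: shifted_meas.
have mdt : measurable_fun (setT : set (sigJ x J)) dt.
  by apply: measurable_funM => //; apply: measurable_trace; exact: mxmeasM.
have me : measurable_fun (setT : set (sigJ x J)) e.
  apply: measurable_funM => //; apply: (measurableT_comp (@measurable_expR R)).
  apply: measurable_funM => //; apply: measurable_funB => //.
  apply: measurable_funB => //; apply: measurable_funB; first exact: potential_meas.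
  exact: measurable_funM.
have sA w : (A w)^T = A w.
  rewrite /A /gb; have [gi|_] := boolP (good i w); last by rewrite scale0r trmx0.
  rewrite scale1r; have [pB1 _ _ _ _] := good_step gi; by case: (posdef_inv pB1).
have AC w a b : A w b a = A w a b.
  by have := congr1 (fun B : 'M[R]_p => B a b) (sA w); rewrite [LHS]mxE.
have AW w : good i w -> A w = Wt w by rewrite /A /gb => ->; rewrite scale1r.
have trA w : 0 <= \tr (A w *m A w) <= k ^+ 2 * N ^+ 2.
  apply/andP; split.
    apply: sumr_ge0 => a _; rewrite mxE; apply: sumr_ge0 => b _.
    by rewrite AC -expr2 sqr_ge0.
  rewrite /A /gb; have [gi|_] := boolP (good i w); last first.
    by rewrite scale0r mul0mx mxtrace0 mulr_ge0 ?sqr_ge0.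
  by rewrite !scale1r; have [] := good_step gi.
have dt0 w : 0 <= dt w <= k ^+ 2.
  have /andP[t0 t1] := trA w; rewrite /dt ler_pdivrMr ?exprn_gt0 // t1 andbT.
  by rewrite divr_ge0 // exprn_ge0 // ltW.
have Abnd w a b : `|A w a b| <= k * N.
  rewrite -(@ler_pXn2r _ 2) ?nnegrE ?mulr_ge0 ?(ltW k0) ?(ltW N0) //.
  rewrite real_normK ?num_real // exprMn; have /andP[_] := trA w; apply: le_trans.
  rewrite /mxtrace (bigD1 a) //= [X in X + _]mxE (bigD1 b) //= -addrA.
  rewrite AC -expr2 lerDl addr_ge0 // sumr_ge0 // => a' _.
    by rewrite AC -expr2 sqr_ge0.
  rewrite mxE sumr_ge0 // => b' _.
  by rewrite AC -expr2 sqr_ge0.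
have mT0 (f : T -> R) : measurable_fun (setT : set (sigJ x J)) f -> measurable_fun setT f.
  exact: measurable_sigJ.
have ngb : nice P gb.
  apply: (@nice_bounded _ _ _ _ _ 1) => [|w]; first exact: mT0.
  by rewrite /gb; case: (good i w); rewrite ?normr1 ?normr0.
have nA a b : nice P (fun w => A w a b).
  by apply: (nice_bounded _ (a := k * N)) => [|w]; [exact: mT0|exact: Abnd].
have ebnd w : 0 <= e w <= 1.
  rewrite /e /gb; have [gi|_] := boolP (good i w); last by rewrite mul0r ler01 lexx.
  rewrite mul1r expR_ge0 -expR0 ler_expR.
  have [_ _ pot] := good_barrier gi; have /andP[d0 _] := dt0 w.
  by rewrite mulr_ge0_le0 ?(ltW L0) //; have := mulr_ge0 (ltW c0) d0; lra.
have ne : nice P e.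
  apply: (@nice_bounded _ _ _ _ _ 1) => [|w]; first exact: mT0.
  by have /andP[e0 e1] := ebnd w; rewrite ger0_norm.
pose al := (1 + g) * L / (N ^+ 2 * (1 - M)).
pose be := ((del * N) ^+ 4)^-1.
have N2 : 0 < N ^+ 2 by rewrite exprn_gt0.
have al0 : 0 <= al.
  by rewrite divr_ge0 // mulr_ge0 ?(ltW L0) ?(ltW N2) ?(ltW M0) //; lra.
have be0 : 0 <= be by rewrite invr_ge0 exprn_ge0 // mulr_ge0 ?(ltW N0) ?(ltW del0).
pose Y w := dot (xrow x p i w *m (e w *: (A w *m A w))) (xrow x p i w).
pose Q w := dot (xrow x p i w *m A w) (xrow x p i w) - \tr (A w).
have nAA a b : nice P (fun w => (e w *: (A w *m A w)) a b).
  by under eq_fun do rewrite !mxE; nice_tac.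
have nx a : nice P (fun w => xrow x p i w 0 a) by exact: nice_xrow.
have nY : nice P Y.
  rewrite /Y; under eq_fun do rewrite dotE; apply: nice_sum => a.
  by apply: niceM => //; under eq_fun do rewrite mxE; nice_tac.
have nQ : nice P Q.
  apply: niceB; last by rewrite /mxtrace; nice_tac.
  under eq_fun do rewrite dotE; apply: nice_sum => a.
  by apply: niceM => //; under eq_fun do rewrite mxE; nice_tac.
have ntr : nice P (fun w => \tr (A w *m A w)).
  by rewrite /mxtrace; apply: nice_sum => a; under eq_fun do rewrite mxE; nice_tac.
(* A minorant of [lyapunov i.+1] that is polynomial in row [i], so that its mean can be bounded
   below. If the row form exceeds [M], which is [del] above the bound on the normalized trace, the
   last term is at least 1 and makes [H] nonpositive. *)
pose H w := gb w - e w - al * Y w - be * (gb w * Q w ^+ 4).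
have nH : nice P H by rewrite /H; nice_tac.
have HV w : H w <= lyapunov i.+1 w.
  have /andP[V0 _] := lyapunov_bnd i.+1 w.
  have gQ0 : 0 <= be * (gb w * Q w ^+ 4).
    by rewrite mulr_ge0 // mulr_ge0 ?exprn_even_ge0 // /gb; case: (good i w).
  have [gi|gi] := boolP (good i w); last first.
    have gb0 : gb w = 0 by rewrite /gb (negPf gi).
    have e0 : e w = 0 by rewrite /e gb0 mul0r.
    have Y0 : Y w = 0 by rewrite /Y e0 scale0r mulmx0 dot0l.
    by apply: le_trans V0; rewrite /H gb0 e0 Y0 !mul0r !mulr0 !subr0.
  have [pB1 trW tr2 pot0 stepi] := good_step gi.
  have gb1 : gb w = 1 by rewrite /gb gi.
  have QE : Q w = row_form i w - \tr (Wt w) by rewrite /Q AW.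
  have YE : Y w = e w * dot (xrow x p i w *m (Wt w *m Wt w)) (xrow x p i w).
    by rewrite /Y AW // -scalemxAr dotZl.
  have /andP[e0 e1] := ebnd w.
  have [qM|qM] := leP (row_form i w / N) M; last first.
    have /ltW QdN : del * N < Q w.
      rewrite QE; rewrite ltr_pdivlMr // ME in qM.
      by move: trW; rewrite -/(Wt w) !mulrDl in qM *; lra.
    have dN : 0 < del * N by exact: mulr_gt0.
    have : 1 <= be * Q w ^+ 4.
      rewrite -(@ler_pM2l _ ((del * N) ^+ 4)) ?exprn_gt0 // mulr1 mulVKf ?gt_eqF ?exprn_gt0 //.
      by rewrite ler_pXn2r ?nnegrE ?(ltW dN) // (le_trans (ltW dN)).
    have Y0 : 0 <= Y w.
      rewrite YE mulr_ge0 // mulmxA dot_mull.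
      have [-> _] : (Wt w)^T = Wt w /\ True by split => //; case: (posdef_inv pB1).
      exact: dot_ge0.
    have := mulr_ge0 al0 Y0; move: V0; rewrite /H gb1 mul1r; lra.
  have [potle /andP[y0 y1]] := stepi qM; rewrite -/(Wt w) in potle y0 y1.
  set y := dot _ _ in potle y0 y1 YE.
  have key : expR (L * (potential i.+1 w - m0 - del)) <= e w + al * Y w.
    pose t := L * (y / (N ^+ 2 * (1 - M))).
    have tb : 0 <= t <= g / 2.
      apply/andP; split; first by rewrite mulr_ge0 ?(ltW L0) // divr_ge0 // mulr_ge0 ?ltW.
      rewrite /t mulrA ler_pdivrMr ?mulr_gt0 //.
      apply: le_trans (_ : L * (k * N * (M * N)) <= _); first by rewrite ler_wpM2l ?(ltW L0).
      have -> : L * (k * N * (M * N)) = L * k * (M * N ^+ 2) by ring.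
      have -> : g / 2 * (N ^+ 2 * (1 - M)) = g / 2 * (1 - M) * N ^+ 2 by ring.
      apply: le_trans (_ : L * k * N ^+ 2 <= _); last by rewrite ler_pM2r.
      rewrite ler_wpM2l ?mulr_ge0 ?(ltW L0) ?(ltW k0) // ler_piMl ?(ltW N2) //; lra.
    have -> : e w + al * Y w = e w * (1 + (1 + g) * t).
      by rewrite YE /al /t; field; rewrite !gt_eqF.
    apply: le_trans (_ : e w * expR t <= _); last by rewrite ler_wpM2l ?expR_small_le.
    rewrite /e gb1 mul1r -expRD ler_expR /t -mulrDr ler_pM2l // /dt AW //; lra.
  have Hle : H w <= 1 - expR (L * (potential i.+1 w - m0 - del)).
    rewrite /H gb1 -[leLHS]addr0 -[X in _ <= X]addr0.
    move: key gQ0; rewrite gb1; set e1' := expR _; set q := be * _.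
    by move: (e w) (al * Y w) q e1' => *; lra.
  rewrite /lyapunov /= gi qM /=; case: ifPn => [_|]; first exact: Hle.
  rewrite -ltNge => pot'; apply: le_trans Hle _.
  have : 1 <= expR (L * (potential i.+1 w - m0 - del)).
    by rewrite -expR0 ler_expR mulr_ge0 ?(ltW L0) //; lra.
  by rewrite subr_le0.
apply: le_trans (Ex_le nH (nice_lyapunov i.+1) HV).
have -> : Ex P H = Ex P gb - Ex P e - al * Ex P Y - be * Ex P (fun w => gb w * Q w ^+ 4).
  by rewrite /H !ExB ?ExZ //; nice_tac.
have -> : Ex P Y = Ex P (fun w => e w * \tr (A w *m A w)).
  rewrite /Y (Ex_row_quad indx idx) //.
    by congr (Ex P); apply/funext => w; rewrite mxtraceZ.
  by apply: mxmeasZ => //; exact: mxmeasM.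
have Q4 : Ex P (fun w => gb w * Q w ^+ 4) <=
    quadK x * Ex P (fun w => gb w * \tr (A w *m A w) ^+ 2).
  by apply: Ex_row_quad4_rand.
apply: le_trans (_ : Ex P gb - Ex P e - al * Ex P (fun w => e w * \tr (A w *m A w)) -
   be * (quadK x * Ex P (fun w => gb w * \tr (A w *m A w) ^+ 2)) <= _); last first.
  by rewrite lerD2l lerN2 ler_wpM2l.
have -> : Ex P gb - Ex P e - al * Ex P (fun w => e w * \tr (A w *m A w)) -
   be * (quadK x * Ex P (fun w => gb w * \tr (A w *m A w) ^+ 2)) =
   Ex P (fun w => gb w - e w - al * (e w * \tr (A w *m A w)) -
   be * (quadK x * (gb w * \tr (A w *m A w) ^+ 2))).
  by rewrite !ExB ?ExZ //; nice_tac.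
apply: Ex_le; [exact: nice_lyapunov|by nice_tac|move=> w].
rewrite /lyapunov /e /gb; case: ifP => [gi|_]; last by rewrite !mul0r !mulr0 !subr0.
rewrite !mul1r; have [_ _ _ pot0 _] := good_step gi.
have /andP[d0 d1] := dt0 w.
have -> : \tr (A w *m A w) = N ^+ 2 * dt w by rewrite /dt mulrC divfK ?gt_eqF.
have Lg0 : 0 <= L * g := mulr_ge0 (ltW L0) (ltW g0).
have Lgd0 : 0 <= L * g * dt w := mulr_ge0 Lg0 d0.
set u := L * g * dt w / (1 - M).
have u0 : 0 <= u := divr_ge0 Lgd0 (ltW M0).
have Lgd : L * g * dt w <= u.
  by rewrite ler_pdivlMr // ler_piMr //; lra.
have u1 : u <= 1.
  rewrite ler_pdivrMr // mul1r; apply: le_trans (_ : L * g * k ^+ 2 <= _).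
    exact: ler_wpM2l.
  have Lk0 := mulr_ge0 (ltW L0) (ltW k0).
  have gk1 : g * k <= 1 by rewrite mulr_ile1 ?(ltW g0) ?(ltW k0).
  have -> : L * g * k ^+ 2 = L * k * (g * k) by ring.
  apply: le_trans (ler_piMr Lk0 gk1) _; apply: le_trans kL' _.
  by rewrite ler_piMl ?(ltW M0) //; lra.
set E := expR (L * (potential i w - m0 - del)).
have E0 : 0 < E by exact: expR_gt0.
have EK : expR (- (L * (m0 + del))) <= E.
  by rewrite ler_expR -mulrN ler_pM2l //; lra.
set e' := expR _.
have e'E : e' = E * expR (- (L * c * dt w)).
  by rewrite -expRD; congr expR; ring.
have le1 : e' * (1 + al * (N ^+ 2 * dt w)) <= E * (1 - u / 2).
  apply: le_trans (_ : E * expR (- u) <= _); last by rewrite ler_pM2l // expR_neg_le // u0.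
  rewrite e'E -mulrA ler_pM2l //.
  apply: le_trans (_ : expR (- (L * c * dt w)) * expR (al * (N ^+ 2 * dt w)) <= _).
    by rewrite ler_pM2l ?expR_gt0 // expR_ge1Dx.
  rewrite -expRD ler_expR le_eqVlt; apply/orP; left; apply/eqP.
  by rewrite /al /u cE; field; rewrite !gt_eqF.
have le2 : be * (quadK x * (N ^+ 2 * dt w) ^+ 2) <= E * (u / 2).
  have -> : be * (quadK x * (N ^+ 2 * dt w) ^+ 2) = quadK x * dt w * dt w / del ^+ 4.
    by rewrite /be; field; rewrite !gt_eqF.
  rewrite ler_pdivrMr ?exprn_gt0 //.
  apply: le_trans (_ : quadK x * k ^+ 2 * dt w <= _).
    by rewrite ler_wpM2r // ler_wpM2l // quadK_ge0.
  apply: le_trans (_ : del ^+ 4 * expR (- (L * (m0 + del))) * L * g / 2 * dt w <= _).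
    by rewrite ler_wpM2r.
  rewrite (_ : _ * L * g / 2 * dt w = del ^+ 4 * (expR (- (L * (m0 + del))) * (L * g * dt w / 2))); last by ring.
  rewrite [leRHS]mulrC ler_pM2l ?exprn_gt0 //.
  apply: ler_pM; rewrite ?expR_ge0 //; last lra.
  exact: divr_ge0.
rewrite (_ : true%:R = 1 :> R) //.
move: le1 le2; rewrite mulrDr mulr1 [al * (e' * _)]mulrCA.
rewrite mulrBr mulr1; move: (be * _) => z1; move: (e' * (al * _)) => z2.
by move: (E * (u / 2)) => z3; move: (e') (E) => z4 z5; lra.
Qed.

Lemma good_prob i : 1 - expR (- (L * del)) <= Ex P (fun w => (good i w)%:R).
Proof.
apply: le_trans (_ : Ex P (lyapunov i) <= _); last first.
  apply: Ex_le; [exact: nice_lyapunov| |by move=> w; case/andP: (lyapunov_bnd i w)].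
  apply: (@nice_bounded _ _ _ _ _ 1) => [|w]; last by case: (good i w); rewrite ?normr1 ?normr0.
  rewrite (_ : (fun w => _) = fun w => if good i w then 1 else 0).
    apply: measurable_fun_ifT => //.
    by apply: (@measurable_sigJ _ _ _ _ x _ _ setT); exact: good_meas.
  by apply/funext => w; case: (good i w).
have [M1' del0' ME' m00'] := params.
elim: i => [|i IH]; last exact: le_trans IH (lyapunov_step i).
rewrite -[leLHS](Ex_cst P); apply: Ex_le; [exact: nice_cst|exact: nice_lyapunov|move=> w].
rewrite /lyapunov /= lerD2l lerN2 ler_expR -mulrN ler_pM2l //.
rewrite /potential /= mulr0 addr0; have : \tr (invmx D) / N <= m0 by rewrite ler_pdivrMr.
lra.
Qed.

End Process.
End UpperBarrier.

Section UpperBound.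
Context {R : realType} {d : measure_display} {T : measurableType d}.
Variables (P : probability T R) (x : nat * nat -> {RV P >-> R}).

Lemma barrier_quad p (D : 'M[R]_p) N k c i w u :
  dot (u *m (barrier x D N k c i w).1) u = dot (u *m D) u +
    ((barrier x D N k c i w).2 + i%:R * (c / N)) * dot u u -
    N^-1 * \sum_(j < i) dot u (xrow x p j w) ^+ 2.
Proof.
elim: i => [|i IH] /=; first by rewrite big_ord0 mul0r mulr0 !addr0 mul0r subr0 addr0.
rewrite mulmxBr dotBl -scalemxAr dotZl dot_outer /shifted mulmxDr dotDl IH.
rewrite dot_scalar big_ord_recr /= (_ : i.+1%:R = i%:R + 1 :> R) -?natr1 //; ring.
Qed.

Lemma good_le p (D : 'M[R]_p) N k c M m0 del i j w : (i <= j)%N ->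
  good x D N k c M m0 del j w -> good x D N k c M m0 del i w.
Proof.
elim: j => [|j IH]; first by rewrite leqn0 => /eqP->.
by rewrite leq_eqVlt ltnS => /orP[/eqP->//|/IH H] /= /and3P[/H].
Qed.

End UpperBound.

(** The matrices [C] at all intermediate times, before and after the shift, are exported because the
    flat process is later kept positive by comparison with them. *)
Lemma barrier_bound {R : realType} {d} {T : measurableType d} {P : probability T R}
    {x : nat * nat -> {RV P >-> R}} (M1 eta rho : R) :
  standard_array x -> 0 <= M1 < 1 -> 0 < eta -> 0 < rho ->
  exists N0 : nat, forall (n p : nat) (D : 'M[R]_p) (m0 : R), (N0 <= n)%N ->
  posdef D -> \tr (invmx D) <= m0 * n%:R -> m0 <= M1 ->
  exists G : set T, [/\ measurable G, 1 - rho <= Ex P \1_G &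
    forall w, G w ->
      (forall i, (i <= n)%N -> exists C : 'M[R]_p, [/\ posdef C,
        \tr (invmx C) <= (1 + M1) / 2 * n%:R & forall u, dot (u *m C) u <=
        dot (u *m D) u + (i%:R / n%:R * (1 - m0)^-1 + eta) * dot u u -
        n%:R^-1 * \sum_(j < i) dot u (xrow x p j w) ^+ 2]) /\
      (forall i, (i < n)%N -> exists C : 'M[R]_p, [/\ posdef C,
        dot (xrow x p i w *m invmx C) (xrow x p i w) <= (1 + M1) / 2 * n%:R &
        forall u, dot (u *m C) u <=
        dot (u *m D) u + (i.+1%:R / n%:R * (1 - m0)^-1 + eta) * dot u u -
        n%:R^-1 * \sum_(j < i) dot u (xrow x p j w) ^+ 2])].
Proof.
move=> [indx idx nx0 mean0 var1] /andP[M10 M11] eta0 rho0.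
have [s sE] : exists s : R, s = 1 - M1 by exists (1 - M1).
have s0 : 0 < s by lra.
(* [s / 4] keeps [1 - M] above [s / 2]; [eta * s ^+ 2 / 16] keeps the total shift [c] within
   [eta / 2] of [(1 - m0)^-1]. *)
have [del [del0 dels deleta]] : exists del : R, [/\ 0 < del, del <= s / 4 & del <= eta * s ^+ 2 / 16].
  exists (Num.min (s / 4) (eta * s ^+ 2 / 16)); split; rewrite ?ge_min ?lexx ?orbT //.
  by rewrite lt_min !divr_gt0 ?mulr_gt0 ?exprn_gt0.
(* With this [L], [expR (- (L * del))] is [expR (- rho^-1)], which is below [rho]. *)
have [L LE] : exists L : R, L = (rho * del)^-1 by exists (rho * del)^-1.
have L0 : 0 < L by rewrite LE invr_gt0 mulr_gt0.
have Q0 : 0 <= quadK x := quadK_ge0 x.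
(* The last two bounds give [kL] and [kquad] of the process; [expR (- L)] replaces the factor
   depending on [m0], because [m0 + del <= 1], so that [k] is uniform in [m0]. *)
have [k [k0 k1 kL kq]] : exists k : R, [/\ 0 < k, k <= 1, k <= del * s / (4 * L) &
    k <= del ^+ 4 * expR (- L) * L * del / 2 / (quadK x + 1)].
  pose a : R := del * s / (4 * L); pose b : R := del ^+ 4 * expR (- L) * L * del / 2 / (quadK x + 1).
  exists (Num.min 1 (Num.min a b)); split; rewrite ?ge_min ?lexx ?orbT //.
  have d4 : 0 < del ^+ 4 * expR (- L) by rewrite mulr_gt0 ?exprn_gt0 ?expR_gt0.
  rewrite !lt_min ltr01 /= /a /b; apply/andP; split.
    by rewrite divr_gt0 // mulr_gt0.
  have dL := mulr_gt0 (mulr_gt0 d4 L0) del0.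
  by rewrite divr_gt0 ?ltr_wpDl // divr_gt0.
have k4 : 0 < k ^+ 4 by rewrite exprn_gt0.
(* The potential stays below 1, so the extra shifts sum to at most [2 / (k^4 n)]; from this rank on
   that is at most [eta / 2]. *)
have [N0 hN0] : exists N0 : nat, 4 / (k ^+ 4 * eta) < N0%:R.
  exists (Num.bound (4 / (k ^+ 4 * eta))).
  by apply: archi_boundP; rewrite divr_ge0 // mulr_ge0 ?ltW.
exists (maxn 1 N0) => n p D m0; rewrite geq_max => /andP[n0 nN] pD trD mM.
have N0' : 0 < n%:R :> R by rewrite ltr0n.
have m00 : 0 <= m0.
  rewrite -(pmulr_lge0 _ N0'); apply: le_trans trD.
  have [Q [f [OQ -> f0]]] := posdef_sfun (posdef_inv pD).
  by rewrite mxtrace_sfun // sumr_ge0 // => i _; exact: ltW.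
pose M := m0 + 2 * del.
have ME : M = m0 + 2 * del by [].
have M1' : M < 1 by clear -M11 ME dels mM sE; lra.
have sM : s / 2 <= 1 - M by clear -ME dels mM sE; lra.
pose c := (1 + 2 * del) / (1 - M).
have M0 : 0 < 1 - M by clear -M11 ME dels mM sE; lra.
have c0 : 0 < c by rewrite divr_gt0 //; clear -del0; lra.
have k01 : 0 < k <= 1 by rewrite k0 k1.
have g01 : 0 < del <= 1 by rewrite del0; clear -M10 dels sE; lra.
have H1 : L * k <= del / 2 * (1 - M).
  apply: le_trans (_ : L * (del * s / (4 * L)) <= _); first by rewrite ler_pM2l.
  have -> : L * (del * s / (4 * L)) = del / 2 * (s / 2) by field; rewrite gt_eqF.
  by rewrite ler_pM2l // divr_gt0.
have H2 : quadK x * k ^+ 2 <= del ^+ 4 * expR (- (L * (m0 + del))) * L * del / 2.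
  apply: le_trans (_ : (quadK x + 1) * k <= _).
    rewrite expr2 mulrA ler_pM2r //; apply: le_trans (_ : quadK x <= _); last by rewrite lerDl.
    exact: ler_piMr.
  rewrite mulrC; apply: le_trans (_ : del ^+ 4 * expR (- L) * L * del / 2 <= _).
    by rewrite -ler_pdivlMr // ltr_wpDl.
  have H : expR (- L) <= expR (- (L * (m0 + del))).
    by rewrite ler_expR lerN2 ler_piMr ?(ltW L0) //; clear -M11 dels mM sE; lra.
  have dd := ltW del0; have LL := ltW L0.
  rewrite !(ler_wpM2r, ler_wpM2l) ?exprn_ge0 //.
exists [set w | good x D n%:R k c M m0 del n w].
have mG : measurable [set w | good x D n%:R k c M m0 del n w].
  have := @good_meas _ _ _ P x p D n%:R k c M m0 del setT n (fun _ _ _ => I).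
  move=> /(@measurable_sigJ _ _ _ _ x _ _ setT) /(_ measurableT [set true]).
  by rewrite setTI; apply.
split => //.
- apply: le_trans (_ : Ex P (fun w => (good x D n%:R k c M m0 del n w)%:R) <= _).
    apply: le_trans (good_prob indx idx nx0 mean0 var1 pD N0' k01 c0 del0 ME M1' L0 trD g01 erefl H1 H2 n).
    rewrite lerD2l lerN2 expRN invf_ple ?posrE ?expR_gt0 //.
    rewrite LE (_ : _ * del = rho^-1); last by field; rewrite !gt_eqF.
    by apply: le_trans (expR_ge1Dx _); rewrite lerDr.
  rewrite le_eqVlt; apply/orP; left; apply/eqP; congr Ex; apply/funext => w.
  rewrite indicE; case gw: (good _ _ _ _ _ _ _ _ _ w).
    by rewrite mem_set.
  by rewrite memNset //= gw.
have cle : c <= (1 - m0)^-1 + eta / 2.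
  have m1 : 0 < 1 - m0 by clear -M11 mM; lra.
  have -> : c = (1 - m0)^-1 + (2 * del * (1 - m0) + 2 * del) / ((1 - M) * (1 - m0)).
    by rewrite /c ME; field; rewrite -ME !gt_eqF.
  rewrite lerD2l ler_pdivrMr ?mulr_gt0 //.
  apply: le_trans (_ : eta / 2 * (s / 2 * s) <= _).
    apply: le_trans (_ : 4 * del <= _); last (by clear -deleta; lra).
    have : del * m0 >= 0 by rewrite mulr_ge0 // ltW.
    clear; lra.
  by rewrite ler_pM2l ?divr_gt0 // ler_pM ?divr_ge0 ?(ltW s0) //; clear -mM sE; lra.
have Mle : M <= (1 + M1) / 2 by clear -ME dels mM sE; lra.
move=> w /= gw; have gi i : (i <= n)%N -> good x D n%:R k c M m0 del i w.
  by move=> ni; apply: good_le gw.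
have Sle i : (i <= n)%N -> [/\ posdef (barrier x D n%:R k c i w).1,
    \tr (invmx (barrier x D n%:R k c i w).1) <= M * n%:R,
    0 <= (barrier x D n%:R k c i w).2 & (barrier x D n%:R k c i w).2 <= eta / 2].
  move=> /gi gg; have [pB S0 pot] := good_barrier pD N0' k01 c0 del0 ME M1' trD gg.
  set S := (barrier _ _ _ _ _ _ _).2 in S0 *.
  have kS0 : 0 <= k ^+ 4 * n%:R / 2 * S by rewrite mulr_ge0 // divr_ge0 // mulr_ge0 // ltW.
  have trB0 : 0 <= \tr (invmx (barrier x D n%:R k c i w).1) / n%:R.
    have [Q [f [OQ -> f0]]] := posdef_sfun (posdef_inv pB).
    by rewrite mxtrace_sfun // divr_ge0 ?(ltW N0') // sumr_ge0 // => j _; exact: ltW.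
  move: pot; rewrite /potential -/S => pot; split => //.
    by rewrite -ler_pdivrMr //; clear -ME del0 kS0 pot; lra.
  have : k ^+ 4 * n%:R / 2 * S <= 1 by clear -M11 dels mM pot sE trB0; lra.
  have : 4 / (k ^+ 4 * eta) <= n%:R by apply: le_trans (ltW hN0) _; rewrite ler_nat.
  rewrite ler_pdivrMr ?mulr_gt0 // => H3 H4.
  have k4n : 0 < k ^+ 4 * n%:R by rewrite mulr_gt0.
  rewrite -(@ler_pM2l _ (k ^+ 4 * n%:R / 2)) ?divr_gt0 //.
  by apply: le_trans H4 _; clear -H3; lra.
have cn i : (i <= n)%N -> i%:R * (c / n%:R) <= i%:R / n%:R * (1 - m0)^-1 + eta / 2.
  move=> ni; have r0 : 0 <= i%:R / n%:R :> R by rewrite divr_ge0.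
  have r1 : i%:R / n%:R <= 1 :> R by rewrite ler_pdivrMr // mul1r ler_nat.
  rewrite (_ : _ * (c / _) = i%:R / n%:R * c); last by field; rewrite gt_eqF.
  apply: le_trans (ler_wpM2l r0 cle) _; rewrite mulrDr lerD2l.
  by rewrite ler_piMl // divr_ge0 // ltW.
split=> i ni.
  have [pB tB S0 S1] := Sle i ni; exists (barrier x D n%:R k c i w).1; split => //.
    by apply: le_trans tB _; rewrite ler_pM2r.
  move=> u; rewrite barrier_quad lerD2r lerD2l ler_wpM2r ?dot_ge0 //.
  by have := cn i ni; clear -S1; lra.
have [_ _ S0 /=] := Sle i.+1 ni; rewrite -[(barrier _ _ _ _ _ _ _).2 + _]/((barrier x D n%:R k c i.+1 w).2) => S1.
have gii := gi i (ltnW ni); have := gi i.+1 ni => /= /and3P[_ qM _].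
have [pB1 _ _ _ _] := good_step pD N0' k01 c0 del0 ME M1' trD gii.
exists (shifted n%:R k c (barrier x D n%:R k c i w).1); split => //.
  by move: qM; rewrite ler_pdivrMr // => qM; apply: le_trans qM _; rewrite ler_pM2r.
move=> u; rewrite /shifted mulmxDr dotDl barrier_quad dot_scalar.
have := cn i.+1 ni; move: S1 => /=; have u0 := dot_ge0 u.
set S := (barrier _ _ _ _ _ _ _).2; set E := extra_shift _ _ _ => S1 cn1.
have H5 : (S + E + i.+1%:R * (c / n%:R)) * dot u u <=
    (i.+1%:R / n%:R * (1 - m0)^-1 + eta) * dot u u by rewrite ler_wpM2r //; clear -S1 cn1; lra.
apply: le_trans (_ : dot (u *m D) u + (S + E + i.+1%:R * (c / n%:R)) * dot u u -
   n%:R^-1 * \sum_(j < i) dot u (xrow x p j w) ^+ 2 <= _); last by rewrite lerD2r lerD2l.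
by rewrite le_eqVlt; apply/orP; left; apply/eqP; rewrite -natr1; ring.
Qed.

Lemma upper_bound {R : realType} {d} {T : measurableType d} {P : probability T R}
    {x : nat * nat -> {RV P >-> R}} (M1 eta rho : R) :
  standard_array x -> 0 <= M1 < 1 -> 0 < eta -> 0 < rho ->
  exists N0 : nat, forall (n p : nat) (D : 'M[R]_p) (m0 : R), (N0 <= n)%N ->
  posdef D -> \tr (invmx D) <= m0 * n%:R -> m0 <= M1 ->
  exists G : set T, [/\ measurable G, 1 - rho <= Ex P \1_G &
    forall w, G w -> forall u,
      n%:R^-1 * \sum_(i < n) dot u (xrow x p i w) ^+ 2 <=
      dot (u *m D) u + ((1 - m0)^-1 + eta) * dot u u].
Proof.
move=> sx M01 eta0 rho0; have [N0 H] := barrier_bound sx M01 eta0 rho0.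
exists (maxn 1 N0) => n p D m0; rewrite geq_max => /andP[n0 nN] pD trD mM.
have [G [mG PG GH]] := H _ _ _ _ nN pD trD mM; exists G; split => // w Gw u.
have [/(_ n (leqnn n))[C [pC _ Cu]] _] := GH w Gw.
have := Cu u; have := posdef_ge0 u pC; rewrite divff ?mul1r ?pnatr_eq0 -?lt0n //.
clear; lra.
Qed.

(** * The flat process *)

Definition stepC {R : realType} (K M : R) : R := let k := (1 - M)^-1 in
  K * k ^+ 2 + 2 * K ^+ 3 * k ^+ 3 + 4 * K ^+ 2 * k ^+ 2 + 2 * k ^+ 2.

(** Scalar form of one flat step: [ph] and [pht] are a resolvent functional before and after the
    shift, [X / (N * (1 - q))] is the gain from the row by Sherman-Morrison, and [tA] is the mean of
    [X]. As [q], [mt] and [m0] nearly agree, [c = (1 - m0)^-1] cancels gain against loss. What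
    remains is a multiple of [X - tA], of mean zero, plus errors fit for a Gronwall argument. *)
Lemma step_scalar {R : realType} (N c K M m0 ph0 ph pht m mt q X tA ep : R) :
  1 <= N -> 0 <= m0 <= M -> M < 1 -> 0 <= K -> c = (1 - m0)^-1 ->
  0 <= ph <= K -> 0 <= ph0 <= K -> 0 <= tA <= K -> 0 <= X ->
  0 <= mt <= m -> m <= M -> m - mt <= c / N * K -> q <= M ->
  - ((c / N) ^+ 2 * K) <= pht - ph + c / N * tA <= 0 ->
  0 <= ph - pht <= c / N * K -> 0 < ep ->
  (pht + X / (N * (1 - q)) - ph0) ^+ 2 <=
  (ph - ph0) ^+ 2 + stepC K M / N * ((ph - ph0) ^+ 2 + (m - m0) ^+ 2) +
  2 * (ph - ph0) / (1 - mt) / N * (X - tA) +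
  stepC K M / N * ((ep + N^-1) * (1 + X ^+ 2) + (q - mt) ^+ 2 / ep).
Proof.
move=> N1 /andP[m00 m0M] M1 K0 cE /andP[p0 pK] /andP[p00 p0K] /andP[tA0 tAK] X0
  /andP[mt0 mtm] mM mmt qM /andP[e1l e1u] /andP[d0 dK] ep0.
have [k kE] : exists k : R, k = (1 - M)^-1 by exists (1 - M)^-1.
have N0 : 0 < N by lra.
have Mp : 0 < 1 - M by clear -M1; lra.
have k0 : 0 < k by rewrite kE invr_gt0.
have inv_le r : r <= M -> 0 < (1 - r)^-1 <= k.
  by move=> rM; rewrite invr_gt0 kE lef_pV2 ?posrE //; clear -M1 rM; lra.
have [r1 r1E] : exists r1 : R, r1 = (1 - mt)^-1 by exists (1 - mt)^-1.
have [r2 r2E] : exists r2 : R, r2 = (1 - q)^-1 by exists (1 - q)^-1.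
have /andP[c0 ck] : 0 < c <= k by rewrite cE inv_le.
have /andP[r10 r1k] : 0 < r1 <= k by rewrite r1E inv_le //; clear -mM mtm; lra.
have /andP[r20 r2k] : 0 < r2 <= k by rewrite r2E inv_le.
have mt1 : 1 - mt != 0 by rewrite gt_eqF //; clear -M1 mM mtm; lra.
have q1 : 1 - q != 0 by rewrite gt_eqF //; clear -M1 qM; lra.
have m01 : 1 - m0 != 0 by rewrite gt_eqF //; clear -M1 m0M; lra.
have [a aE] : exists a : R, a = ph - ph0 by exists (ph - ph0).
have aK : `|a| <= K by rewrite ler_norml aE; apply/andP; split; clear -p0 p00 p0K pK; lra.
have [u uE] : exists u : R, u = N^-1 by exists N^-1.
have u0 : 0 < u by rewrite uE invr_gt0.
have [e1 e1E] : exists e1 : R, e1 = pht - ph + c / N * tA by exists (pht - ph + c / N * tA).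
have [y yE] : exists y : R, y = q - mt by exists (q - mt).
have k0' := ltW k0; have u0' := ltW u0; have r10' := ltW r10; have r20' := ltW r20.
pose eta := pht - ph + X * u * r2.
(* The four parts of the increment: mismatch between [mt] and [m0], the mean-zero part, fluctuation
   of [q] around [mt], and the second-order error of the shift. *)
have etaE : eta = tA * u * ((mt - m0) * (r1 * c)) + (X - tA) * u * r1 +
    X * u * (y * (r1 * r2)) + e1.
  rewrite /eta uE yE e1E r1E r2E cE; field.
  by rewrite mt1 q1 m01 gt_eqF.
have kk : 0 <= k ^+ 2 by rewrite sqr_ge0.
have r1c : 0 <= r1 * c <= k ^+ 2.
  by rewrite mulr_ge0 ?(ltW r10) ?(ltW c0) //= expr2 ler_pM ?(ltW r10) ?(ltW c0).
have r12 : 0 <= r1 * r2 <= k ^+ 2.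
  by rewrite mulr_ge0 ?(ltW r10) ?(ltW r20) //= expr2 ler_pM ?(ltW r10) ?(ltW r20).
have cN : c / N <= k * u by rewrite -uE ler_pM2r.
have cN0 : 0 <= c / N by rewrite divr_ge0 ?(ltW c0) ?(ltW N0).
have ku0 : 0 <= k * u by rewrite mulr_ge0 ?(ltW k0) ?(ltW u0).
have mm : `|mt - m0| <= `|m - m0| + k * u * K.
  have -> : mt - m0 = (m - m0) - (m - mt) by ring.
  apply: le_trans (ler_normB _ _) _; rewrite lerD2l ger0_norm ?subr_ge0 //.
  by apply: le_trans mmt _; rewrite ler_wpM2r.
have aa : a ^+ 2 = `|a| ^+ 2 by rewrite real_normK ?num_real.
have bb : (m - m0) ^+ 2 = `|m - m0| ^+ 2 by rewrite real_normK ?num_real.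
have E1 : 2 * a * (tA * u * ((mt - m0) * (r1 * c))) <=
    K * k ^+ 2 * u * (a ^+ 2 + (m - m0) ^+ 2) + 2 * K ^+ 3 * k ^+ 3 * u ^+ 2.
  apply: le_trans (ler_norm _) _; rewrite !normrM (ger0_norm tA0) (gtr0_norm u0).
  rewrite (gtr0_norm r10) (gtr0_norm c0) normr_nat.
  move: r1c => /andP[rc0 rck].
  apply: le_trans (_ : 2 * `|a| * (K * u * ((`|m - m0| + k * u * K) * k ^+ 2)) <= _).
    rewrite ler_wpM2l ?mulr_ge0 //; apply: ler_pM.
    - by rewrite mulr_ge0 ?(ltW u0).
    - by rewrite mulr_ge0.
    - by rewrite ler_wpM2r ?(ltW u0).
    - by apply: ler_pM.
  rewrite aa bb.
  have Kk : 0 <= K * k ^+ 2 * u by rewrite !mulr_ge0 ?(ltW u0).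
  have S : 0 <= K * k ^+ 2 * u * (`|a| - `|m - m0|) ^+ 2 by rewrite mulr_ge0 ?sqr_ge0.
  have S2 : 2 * K ^+ 2 * k ^+ 3 * u ^+ 2 * `|a| <= 2 * K ^+ 2 * k ^+ 3 * u ^+ 2 * K.
    by rewrite ler_wpM2l // !mulr_ge0 ?exprn_ge0 ?(ltW k0) ?(ltW u0).
  have -> : 2 * `|a| * (K * u * ((`|m - m0| + k * u * K) * k ^+ 2)) =
    K * k ^+ 2 * u * (`|a| ^+ 2 + `|m - m0| ^+ 2) - K * k ^+ 2 * u * (`|a| - `|m - m0|) ^+ 2
     + 2 * K ^+ 2 * k ^+ 3 * u ^+ 2 * `|a| by ring.
  have -> : 2 * K ^+ 3 * k ^+ 3 * u ^+ 2 = 2 * K ^+ 2 * k ^+ 3 * u ^+ 2 * K by ring.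
  by apply: lerD => //; rewrite lerBlDr lerDl.
have E3 : 2 * a * (X * u * (y * (r1 * r2))) <= K * k ^+ 2 * u * (ep * X ^+ 2 + y ^+ 2 / ep).
  apply: le_trans (ler_norm _) _; rewrite !normrM (ger0_norm X0) (gtr0_norm u0).
  rewrite (gtr0_norm r10) (gtr0_norm r20) normr_nat.
  apply: le_trans (_ : 2 * K * (X * u * (`|y| * k ^+ 2)) <= _).
    apply: ler_pM; rewrite ?mulr_ge0 ?(ltW u0) ?(ltW r10) ?(ltW r20) ?ler_wpM2l ?mulr_ge0 ?(ltW u0) //.
    by case/andP: r12.
  have yy : y ^+ 2 = `|y| ^+ 2 by rewrite real_normK ?num_real.
  have S : 2 * (X * `|y|) <= ep * X ^+ 2 + y ^+ 2 / ep.
    rewrite yy -subr_ge0 (_ : _ - _ = (ep * X - `|y|) ^+ 2 / ep).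
      by rewrite divr_ge0 ?sqr_ge0 ?(ltW ep0).
    by field; rewrite gt_eqF.
  have -> : 2 * K * (X * u * (`|y| * k ^+ 2)) = K * k ^+ 2 * u * (2 * (X * `|y|)) by ring.
  by rewrite ler_wpM2l // !mulr_ge0 ?(ltW u0).
have e1b : `|e1| <= k ^+ 2 * u ^+ 2 * K.
  rewrite ler_norml e1E; apply/andP; split.
    apply: le_trans e1l; rewrite lerN2 ler_wpM2r // -exprMn.
    by rewrite ler_pXn2r ?nnegrE.
  by apply: le_trans e1u _; rewrite !mulr_ge0 ?sqr_ge0.
have E4 : 2 * a * e1 <= 2 * K ^+ 2 * k ^+ 2 * u ^+ 2.
  apply: le_trans (ler_norm _) _; rewrite !normrM normr_nat.
  have -> : 2 * K ^+ 2 * k ^+ 2 * u ^+ 2 = 2 * K * (k ^+ 2 * u ^+ 2 * K) by ring.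
  by rewrite ler_pM ?mulr_ge0 // ler_wpM2l.
have E5 : eta ^+ 2 <= 2 * k ^+ 2 * K ^+ 2 * u ^+ 2 + 2 * k ^+ 2 * X ^+ 2 * u ^+ 2.
  have h1 : (pht - ph) ^+ 2 <= (k * u * K) ^+ 2.
    rewrite -[X in X <= _]sqrrN opprB ler_pXn2r ?nnegrE ?(mulr_ge0 ku0 K0) //.
    by apply: le_trans dK _; rewrite ler_wpM2r.
  have h2 : (X * u * r2) ^+ 2 <= (X * u * k) ^+ 2.
    by rewrite ler_pXn2r ?nnegrE ?mulr_ge0 ?(ltW u0) ?(ltW r20) ?(ltW k0) ?ler_wpM2l ?mulr_ge0 ?(ltW u0).
  have -> : 2 * k ^+ 2 * K ^+ 2 * u ^+ 2 + 2 * k ^+ 2 * X ^+ 2 * u ^+ 2 =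
    2 * (k * u * K) ^+ 2 + 2 * (X * u * k) ^+ 2 by ring.
  apply: le_trans (_ : 2 * (pht - ph) ^+ 2 + 2 * (X * u * r2) ^+ 2 <= _).
    rewrite -subr_ge0 (_ : _ - _ = (pht - ph - X * u * r2) ^+ 2) ?sqr_ge0 //.
    by rewrite /eta; ring.
  by rewrite lerD // ler_wpM2l.
have lhsE : (pht + X / (N * (1 - q)) - ph0) ^+ 2 = a ^+ 2 + 2 * a * eta + eta ^+ 2.
  rewrite /eta uE r2E aE; field; rewrite q1 gt_eqF //.
rewrite lhsE etaE -etaE.
have -> : 2 * a * eta = 2 * a * (tA * u * ((mt - m0) * (r1 * c))) +
   2 * a * r1 * u * (X - tA) + 2 * a * (X * u * (y * (r1 * r2))) + 2 * a * e1.
  by rewrite etaE; ring.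
rewrite -aE -r1E -uE -yE.
have [C1 C1E] : exists C1 : R, C1 = K * k ^+ 2 by exists (K * k ^+ 2).
have [C2 C2E] : exists C2 : R, C2 = 2 * K ^+ 3 * k ^+ 3 by exists (2 * K ^+ 3 * k ^+ 3).
have [C3 C3E] : exists C3 : R, C3 = 4 * K ^+ 2 * k ^+ 2 by exists (4 * K ^+ 2 * k ^+ 2).
have [C4 C4E] : exists C4 : R, C4 = 2 * k ^+ 2 by exists (2 * k ^+ 2).
have CE : stepC K M = C1 + C2 + C3 + C4 by rewrite /stepC -kE C1E C2E C3E C4E.
have C10 : 0 <= C1 by rewrite C1E !mulr_ge0.
have C20 : 0 <= C2 by rewrite C2E !mulr_ge0.
have C30 : 0 <= C3 by rewrite C3E !mulr_ge0.
have C40 : 0 <= C4 by rewrite C4E !mulr_ge0.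
rewrite -C1E -C2E in E1; rewrite -C1E in E3.
have S1 : 0 <= a ^+ 2 + (m - m0) ^+ 2 by rewrite addr_ge0 ?sqr_ge0.
have C234 : 0 <= (C2 + C3 + C4) * u by rewrite mulr_ge0 ?addr_ge0.
have S2 := mulr_ge0 C234 S1.
have X20 : 0 <= X ^+ 2 := sqr_ge0 X.
have X21 : 0 <= 1 + X ^+ 2 by rewrite addr_ge0.
have yep : 0 <= y ^+ 2 / ep by rewrite divr_ge0 ?sqr_ge0 ?(ltW ep0).
have S3 : 0 <= (C2 + C3 + C4) * u * (ep * (1 + X ^+ 2) + y ^+ 2 / ep).
  by apply: (mulr_ge0 C234); rewrite addr_ge0 // (mulr_ge0 (ltW ep0)).
have S4 : 0 <= C1 * u * (u * (1 + X ^+ 2) + ep).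
  by apply: mulr_ge0; [exact: mulr_ge0|rewrite addr_ge0 ?(ltW ep0) // (mulr_ge0 u0')].
have S5 : 0 <= C2 * u * (u * X ^+ 2) + C3 * u * (u * X ^+ 2) + C4 * u * u.
  by rewrite !addr_ge0 // ?(mulr_ge0 (mulr_ge0 _ u0') (mulr_ge0 u0' X20)) // (mulr_ge0 (mulr_ge0 C40 u0')).
have E4' : 2 * a * e1 <= C3 * u ^+ 2 / 2 by rewrite C3E; apply: le_trans E4 _; clear; lra.
have E5' : eta ^+ 2 <= C3 * u ^+ 2 / 2 + C4 * u ^+ 2 * X ^+ 2.
  by rewrite C3E C4E; apply: le_trans E5 _; rewrite le_eqVlt; apply/orP; left; apply/eqP; field.
rewrite CE; move: E1 E3 E4' E5' S2 S3 S4 S5.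
move: (2 * a * (tA * _ * _)) (2 * a * r1 * u * _) (2 * a * (X * _ * _)) (2 * a * e1) (eta ^+ 2) => t1 t2 t3 t4 t5.
move: (a ^+ 2) ((m - m0) ^+ 2) (y ^+ 2 / ep) (X ^+ 2) => z1 z2 z3 z4; clear; lra.
Qed.

Lemma stepC_ge {R : realType} (K M : R) : M < 1 -> 0 <= K ->
  (4 * K ^+ 2 + 2) * ((1 - M)^-1) ^+ 2 <= stepC K M.
Proof.
move=> M1 K0; rewrite /stepC; have k0 : 0 <= (1 - M)^-1 by rewrite invr_ge0; lra.
move: (1 - M)^-1 k0 => k k0.
have h1 : 0 <= K * k ^+ 2 by rewrite !mulr_ge0.
have h2 : 0 <= 2 * K ^+ 3 * k ^+ 3 by rewrite !mulr_ge0.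
lra.
Qed.

Lemma step_scalar_ge0 {R : realType} (N K M m0 ph0 ph m mt q X tA ep : R) :
  1 <= N -> M < 1 -> 0 <= K -> 0 <= tA <= K -> mt <= M -> 0 < ep ->
  0 <= (ph - ph0) ^+ 2 + stepC K M / N * ((ph - ph0) ^+ 2 + (m - m0) ^+ 2) +
  2 * (ph - ph0) / (1 - mt) / N * (X - tA) +
  stepC K M / N * ((ep + N^-1) * (1 + X ^+ 2) + (q - mt) ^+ 2 / ep).
Proof.
move=> N1 M1 K0 /andP[tA0 tAK] mtM ep0.
have Cge := stepC_ge M1 K0; have N0 : 0 < N by lra.
have k0 : 0 < (1 - M)^-1 by rewrite invr_gt0; lra.
have r10 : 0 < (1 - mt)^-1 by rewrite invr_gt0; lra.
have r1k : (1 - mt)^-1 <= (1 - M)^-1 by rewrite lef_pV2 ?posrE; lra.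
have u0 : 0 < N^-1 by rewrite invr_gt0.
move: (1 - M)^-1 (1 - mt)^-1 N^-1 k0 r10 r1k u0 Cge => k r u k0 r10 rk u0 Cge.
have C0 : 0 <= stepC K M.
  by apply: le_trans Cge; rewrite mulr_ge0 ?sqr_ge0 // addr_ge0 // mulr_ge0 ?sqr_ge0.
move: (stepC K M) C0 Cge => C C0 Cge; move: (ph - ph0) => a.
have Cu0 : 0 <= C * u by rewrite mulr_ge0 ?(ltW u0).
have X20 : 0 <= X ^+ 2 := sqr_ge0 X.
have h1 : 0 <= C * u * (a ^+ 2 + (m - m0) ^+ 2).
  by apply: (mulr_ge0 Cu0); rewrite addr_ge0 ?sqr_ge0.
have h2 : 0 <= C * u * (ep * (1 + X ^+ 2) + (q - mt) ^+ 2 / ep).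
  apply: (mulr_ge0 Cu0); rewrite addr_ge0 ?divr_ge0 ?sqr_ge0 ?(ltW ep0) //.
  by rewrite (mulr_ge0 (ltW ep0)) // addr_ge0.
have h3 : 0 <= (a + r * u * (X - tA)) ^+ 2 := sqr_ge0 _.
have h4 : (r * u * (X - tA)) ^+ 2 <= (k * u) ^+ 2 * (2 * X ^+ 2 + 2 * K ^+ 2).
  rewrite exprMn; apply: ler_pM; rewrite ?sqr_ge0 //.
    by rewrite ler_pXn2r ?nnegrE ?ler_pM2r // mulr_ge0 // ltW.
  apply: le_trans (_ : 2 * X ^+ 2 + 2 * tA ^+ 2 <= _).
    rewrite -subr_ge0 (_ : _ - _ = (X + tA) ^+ 2) ?sqr_ge0 //; ring.
  by rewrite lerD2l ler_wpM2l // ler_pXn2r ?nnegrE // (le_trans tA0).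
have h5 : (k * u) ^+ 2 * (2 * X ^+ 2 + 2 * K ^+ 2) <= C * u * (u * (1 + X ^+ 2)).
  apply: le_trans (_ : (4 * K ^+ 2 + 2) * k ^+ 2 * (u ^+ 2 * (1 + X ^+ 2)) <= _); last first.
    have -> : C * u * (u * (1 + X ^+ 2)) = C * (u ^+ 2 * (1 + X ^+ 2)) by ring.
    by rewrite ler_wpM2r // (mulr_ge0 (sqr_ge0 u)) // addr_ge0.
  rewrite -subr_ge0.
  rewrite (_ : _ - _ = (k * u) ^+ 2 * (2 + 2 * K ^+ 2 + 4 * (K * X) ^+ 2)); last by ring.
  by rewrite (mulr_ge0 (sqr_ge0 _)) // !addr_ge0 // mulr_ge0 ?sqr_ge0.
have -> : 2 * a * r * u * (X - tA) = (a + r * u * (X - tA)) ^+ 2 - a ^+ 2 - (r * u * (X - tA)) ^+ 2.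
  by ring.
move: h1 h2 h3 h4 h5; move: ((a + _) ^+ 2) ((r * _ * _) ^+ 2) (_ * (2 * _ + _)) => z1 z2 z3.
move: ((q - mt) ^+ 2 / ep) => y.
have -> : C * u * ((ep + u) * (1 + X ^+ 2) + y) =
  C * u * (ep * (1 + X ^+ 2) + y) + C * u * (u * (1 + X ^+ 2)) by ring.
move: (C * u * (a ^+ 2 + _)) (C * u * (ep * _ + _)) (C * u * (u * _)) => z4 z5 z6.
by move: (a ^+ 2) => z7; clear; lra.
Qed.

Section StepMatrix.
Context {R : realType}.

Definition psdquad p (T : 'M[R]_p) : Prop := T^T = T /\ forall u, 0 <= dot (u *m T) u.

Lemma mxtrace_mul_sfun p (Q T : 'M[R]_p) g :
  \tr (T *m sfun Q g) = \sum_j g j * dot (row j Q *m T) (row j Q).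
Proof.
rewrite /sfun !mulmxA mxtrace_mulC !mulmxA /mxtrace; apply: eq_bigr => j _.
rewrite mul_mx_diag !mxE mulrC; congr (_ * _).
by rewrite /dot -row_mul mxE; apply: eq_bigr => a _; rewrite !mxE.
Qed.

Lemma psd_trace_sqr p (A : 'M[R]_p) : psdquad A -> \tr (A *m A) <= \tr A ^+ 2.
Proof.
move=> [sA pA]; have [Q [f [OQ AE]]] := sym_sfun sA.
have f0 i : 0 <= f i.
  have := pA (row i Q); rewrite AE row_sfun // dotZl dot_row_orth // eqxx mulr1.
  exact.
rewrite AE sfunM // !mxtrace_sfun // expr2 mulr_suml; apply: ler_sum => i _.
by rewrite ler_wpM2l // (bigD1 i) //= lerDl sumr_ge0.
Qed.

Lemma psd_congr p (W T : 'M[R]_p) : W^T = W -> psdquad T -> psdquad (W *m T *m W).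
Proof.
move=> sW [sT pT]; split=> [|u]; first by rewrite !trmx_mul sW sT mulmxA.
by rewrite mulmxA dot_mull sW mulmxA.
Qed.

Section Shift.
Variables (p : nat) (B : 'M[R]_p) (tau : R).
Hypotheses (pB : posdef B) (tau0 : 0 <= tau).
Let W := invmx B.
Let Wt := invmx (B + tau%:M).

Lemma shift_posdef : posdef (B + tau%:M).
Proof.
case: pB => sB B0; split=> [|u u0]; first by rewrite linearD /= tr_scalar_mx sB.
by rewrite mulmxDr dotDl dot_scalar ltr_wpDr ?B0 // mulr_ge0 ?dot_ge0.
Qed.

(** Scalar inequalities summed over the spectrum of [B] with the nonnegative weights given by [T].
    For an eigenvalue [w] of the inverse that becomes [v], the second-order error is [tau^2 w v^2],
    and [w^3 <= (w^2 + w^4) / 2] trades the cube for even powers; this is why [tame] controls fourth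
    powers. *)
Lemma shift_trace T : psdquad T ->
  [/\ 0 <= \tr (T *m Wt) <= \tr (T *m W),
      \tr (T *m W) - \tr (T *m Wt) <= tau * \tr (T *m (W *m W)),
      0 <= \tr (T *m (Wt *m Wt)) <= \tr (T *m (W *m W)) &
      - (tau ^+ 2 * ((\tr (T *m (W *m W)) + \tr (T *m (W *m W *m (W *m W)))) / 2)) <=
      \tr (T *m Wt) - \tr (T *m W) + tau * \tr (T *m (Wt *m Wt)) <= 0].
Proof.
move=> [sT pT]; have [Q [f [OQ BE f0]]] := posdef_sfun pB.
have ft0 i : 0 < f i + tau by rewrite ltr_wpDr.
have WE : W = sfun Q (fun i => (f i)^-1).
  by rewrite /W BE; have [|_ ->] := sfun_inv OQ (f := f) => // i; rewrite gt_eqF.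
have WtE : Wt = sfun Q (fun i => (f i + tau)^-1).
  rewrite /Wt BE -(sfun_scalar OQ) (sfunD Q).
  by have [|_ ->] := sfun_inv OQ (f := fun i => f i + tau) => // i; rewrite gt_eqF.
rewrite WE WtE !sfunM // !mxtrace_mul_sfun.
have l0 j := pT (row j Q); set l := fun j => dot (row j Q *m T) (row j Q) in l0.
have w0 j : 0 < (f j)^-1 by rewrite invr_gt0.
have t0 j : 0 < (f j + tau)^-1 by rewrite invr_gt0.
have wt j : (f j + tau)^-1 <= (f j)^-1 by rewrite lef_pV2 ?posrE // lerDl.
have we j : (f j)^-1 - (f j + tau)^-1 = tau * ((f j)^-1 * (f j + tau)^-1).
  by field; rewrite !gt_eqF.
split.
- apply/andP; split; first by apply: sumr_ge0 => j _; rewrite mulr_ge0 ?(ltW (t0 j)).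
  by apply: ler_sum => j _; rewrite ler_wpM2r.
- rewrite -sumrB mulr_sumr; apply: ler_sum => j _.
  rewrite -mulrBl we mulrA ler_wpM2r // ler_wpM2l // ler_wpM2l // ltW //.
- apply/andP; split.
    by apply: sumr_ge0 => j _; rewrite !mulr_ge0 ?(ltW (t0 j)).
  by apply: ler_sum => j _; rewrite ler_wpM2r // ler_pM ?(ltW (t0 j)).
rewrite mulr_sumr -sumrB -big_split /= -big_split /= mulr_suml mulr_sumr -sumrN.
have e1 j : (f j + tau)^-1 - (f j)^-1 + tau * ((f j + tau)^-1 * (f j + tau)^-1) =
    - (tau ^+ 2 * ((f j)^-1 * ((f j + tau)^-1 * (f j + tau)^-1))).
  by field; rewrite !gt_eqF.
apply/andP; split; last first.
  apply: sumr_le0 => j _; rewrite mulrA -!mulrBl -mulrDl e1 mulNr oppr_le0.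
  by rewrite !mulr_ge0 ?sqr_ge0 ?(ltW (t0 j)) ?(ltW (w0 j)).
apply: ler_sum => j _; rewrite -/(l j).
rewrite (_ : _ - _ + _ = - (tau ^+ 2 * ((f j)^-1 * ((f j + tau)^-1 * (f j + tau)^-1))) * l j); last first.
  by rewrite -e1 !mulrDl !mulNr !mulrA.
move: (f j)^-1 (f j + tau)^-1 (w0 j) (t0 j) (wt j) => w v w1 v1 vw.
rewrite mulNr lerN2 -subr_ge0.
rewrite (_ : _ - _ = tau ^+ 2 * l j * ((w * w + w * w * (w * w)) / 2 - w * (v * v))); last by field.
rewrite mulr_ge0 ?mulr_ge0 ?sqr_ge0 //; first exact: l0.
rewrite subr_ge0.
apply: le_trans (_ : w * (w * w) <= _).
  by rewrite ler_wpM2l ?(ltW w1) // ler_pM ?(ltW v1).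
rewrite -subr_ge0 (_ : _ - _ = w ^+ 2 * (1 - w) ^+ 2 / 2); last by field.
by rewrite divr_ge0 // mulr_ge0 // sqr_ge0.
Qed.

End Shift.

Lemma psd1 p : psdquad (1%:M : 'M[R]_p).
Proof. by split=> [|u]; rewrite ?trmx1 // mulmx1 dot_ge0. Qed.

Lemma step_matrix p (B T : 'M[R]_p) (x : 'rV[R]_p) (N c K M m0 ph0 ep : R) :
  posdef B -> psdquad T -> 1 <= N -> 0 <= m0 <= M -> M < 1 -> 0 <= K ->
  c = (1 - m0)^-1 -> 0 <= ph0 <= K -> 0 < ep ->
  let W := invmx B in let Wt := invmx (B + (c / N)%:M) in
  let A := Wt *m T *m Wt in
  let rhs := (\tr (T *m W) - ph0) ^+ 2 + stepC K M / N *
     ((\tr (T *m W) - ph0) ^+ 2 + (\tr W / N - m0) ^+ 2) +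
   2 * (\tr (T *m W) - ph0) / (1 - \tr Wt / N) / N * (dot (x *m A) x - \tr A) +
   stepC K M / N * ((ep + N^-1) * (1 + dot (x *m A) x ^+ 2) +
     (dot (x *m Wt) x / N - \tr Wt / N) ^+ 2 / ep) in
  \tr (T *m W) <= K -> \tr (T *m (W *m W)) <= K ->
  \tr (T *m (W *m W *m (W *m W))) <= K ->
  \tr W <= M * N -> \tr (W *m W) <= K * N ->
  [/\ psdquad A, 0 <= \tr A <= K, \tr (A *m A) <= K ^+ 2,
      0 <= \tr (T *m W) /\ 0 <= \tr Wt <= M * N & 0 <= \tr (Wt *m Wt) <= K * N] /\
  0 <= rhs /\
  (dot (x *m Wt) x / N <= M ->
   (\tr (T *m invmx (B + (c / N)%:M - N^-1 *: (x^T *m x))) - ph0) ^+ 2 <= rhs).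
Proof.
move=> pB pT N1 m0M M1 K0 cE ph0K ep0 W Wt A rhs TW TW2 TW4 trW trW2.
have N0 : 0 < N by lra.
have cN0 : 0 <= c / N.
  by rewrite divr_ge0 ?(ltW N0) // cE invr_ge0; case/andP: m0M => _ ?; lra.
have [/andP[tt0 tt1] d1 /andP[a0 a1] /andP[e1 e2]] := shift_trace pB cN0 pT.
have [] := shift_trace pB cN0 (psd1 p); rewrite !mul1mx.
move=> /andP[mt0 mt1] dm /andP[b0 b1] _.
rewrite -/W -/Wt in tt0 tt1 d1 a0 a1 e1 e2 mt0 mt1 dm b0 b1.
have pBt := shift_posdef pB cN0.
have sWt : Wt^T = Wt by case: (posdef_inv pBt).
have trAE : \tr A = \tr (T *m (Wt *m Wt)).
  by rewrite /A -mulmxA mxtrace_mulC mulmxA.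
have pA : psdquad A by exact: psd_congr.
have trA : 0 <= \tr A <= K by rewrite trAE a0 (le_trans a1).
split.
  split => //.
  - by apply: le_trans (psd_trace_sqr pA) _; case/andP: trA => ? ?; rewrite ler_pXn2r.
  - by rewrite (le_trans tt0) // mt0 (le_trans mt1).
  - by rewrite b0 (le_trans b1).
split.
  apply: step_scalar_ge0 => //; rewrite ler_pdivrMr //; exact: le_trans mt1 trW.
move=> qM; have q1 := le_lt_trans qM M1.
have -> : \tr (T *m invmx (B + (c / N)%:M - N^-1 *: (x^T *m x))) =
    \tr (T *m Wt) + dot (x *m A) x / (N * (1 - dot (x *m Wt) x / N)).
  rewrite (sherman_morrison N0 pBt q1) -/Wt mulmxDr mxtraceD -scalemxAr mxtraceZ.
  rewrite mulrC; congr (_ + _ * _).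
  rewrite !mulmxA mxtrace_mulC !mulmxA -[RHS]trace_mx11 mxtrace_mulC /A.
  by rewrite !mulmxA.
have dotA0 : 0 <= dot (x *m A) x by case: pA.
apply: (step_scalar (c := c)) => //.
- by rewrite (le_trans tt0).
- by rewrite divr_ge0 ?(ltW N0) //= ler_pM2r ?invr_gt0.
- by rewrite ler_pdivrMr.
- rewrite -mulrBl ler_pdivrMr //; apply: le_trans dm _.
  by rewrite -[leRHS]mulrA ler_wpM2l.
- rewrite trAE e2 andbT; apply: le_trans e1; rewrite lerN2 ler_wpM2l ?sqr_ge0 //.
  clear -TW2 TW4; lra.
- by rewrite subr_ge0 tt1 /=; apply: le_trans d1 _; rewrite ler_wpM2l.
Qed.

End StepMatrix.

Lemma sym_entry_le {R : realType} p (A : 'M[R]_p) b a1 a2 : A^T = A -> 0 <= b ->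
  \tr (A *m A) <= b ^+ 2 -> `|A a1 a2| <= b.
Proof.
move=> sA b0; apply: contraTT; rewrite -!ltNge => bA.
have AC i j : A j i = A i j by have := congr1 (fun B : 'M[R]_p => B i j) sA; rewrite [LHS]mxE.
apply: (@lt_le_trans _ _ (`|A a1 a2| ^+ 2)); first by rewrite ltr_pXn2r ?nnegrE.
rewrite real_normK ?num_real // /mxtrace (bigD1 a1) //= [X in X + _]mxE (bigD1 a2) //= -addrA.
rewrite AC -expr2 lerDl addr_ge0 // sumr_ge0 // => i _.
  by rewrite AC -expr2 sqr_ge0.
by rewrite mxE sumr_ge0 // => j _; rewrite AC -expr2 sqr_ge0.
Qed.

Lemma quartic_bound {R : realType} (y t K : R) : 0 <= t <= K ->
  1 + (y + t) ^+ 2 <= 2 + 2 * K ^+ 2 + y ^+ 4.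
Proof.
move=> /andP[t0 tK].
have h1 : t ^+ 2 <= K ^+ 2 by rewrite ler_pXn2r ?nnegrE // (le_trans t0).
have h2 := sqr_ge0 (y - t); have h3 := sqr_ge0 (y ^+ 2 - 1).
have -> : y ^+ 4 = (y ^+ 2 - 1) ^+ 2 + 2 * y ^+ 2 - 1 by ring.
have -> : (y + t) ^+ 2 = 2 * y ^+ 2 + 2 * t ^+ 2 - (y - t) ^+ 2 by ring.
by move: (y ^+ 2) (t ^+ 2) (K ^+ 2) ((y - t) ^+ 2) ((_ - 1) ^+ 2) h1 h2 h3 => a b k u v; lra.
Qed.

Section FlatProcess.
Context {R : realType} {d : measure_display} {T : measurableType d}.
Variables (P : probability T R) (x : nat * nat -> {RV P >-> R}).
Hypotheses (indx : mutually_independent x) (idx : identically_distributed x).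
Hypotheses (nx0 : nice P (x (0, 0)%N)).
Hypotheses (mean0 : Ex P (x (0, 0)%N) = 0).
Hypotheses (var1 : Ex P (fun w => x (0, 0)%N w ^+ 2) = 1).

Variables (p : nat) (D : 'M[R]_p) (e : 'rV[R]_p) (N c M m0 K : R).
Hypotheses (pD : posdef D) (N1 : 1 <= N) (m0M : 0 <= m0 <= M) (M1 : M < 1).
Hypotheses (K1 : 1 <= K) (cE : c = (1 - m0)^-1).
Hypothesis m0E : m0 = \tr (invmx D) / N.

(* For [c = (1 - m0)^-1] the shift compensates the removed rows exactly to first
   order, so that the resolvent of [flat i] hardly moves. *)
Fixpoint flat (i : nat) (w : T) : 'M[R]_p :=
  if i is j.+1 then flat j w + (c / N)%:M - N^-1 *: ((xrow x p j w)^T *m xrow x p j w)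
  else D.

Definition res i w := invmx (flat i w).
Definition resS i w := invmx (flat i w + (c / N)%:M).

(** The trace bounds that [step_matrix] asks for, for the test matrices [testN] and [testE]. *)
Definition tame i w : bool :=
  [&& \tr (res i w) <= M * N, \tr (res i w *m res i w) <= K * N,
      \tr (res i w *m res i w *m (res i w *m res i w)) <= K * N,
      dot (e *m res i w) e <= K, dot (e *m (res i w *m res i w)) e <= K &
      dot (e *m (res i w *m res i w *m (res i w *m res i w))) e <= K].

Fixpoint safe i w : bool :=
  if i is j.+1 then
    [&& safe j w, dot (xrow x p j w *m resS j w) (xrow x p j w) / N <= M &
        tame j.+1 w]
  else tame 0 w.

Let N0 : 0 < N. Proof. by have := N1; lra. Qed.
Let cN0 : 0 <= c / N.
Proof.
rewrite divr_ge0 ?(ltW N0) // cE invr_ge0; case/andP: m0M => _ h.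
by have := M1; lra.
Qed.

Lemma safe_posdef i w : safe i w -> posdef (flat i w).
Proof.
elim: i => [//|i IH] /= /and3P[/IH pB qM _].
apply: rank1_posdef => //; first exact: shift_posdef.
exact: le_lt_trans qM M1.
Qed.

Lemma safe_tame i w : safe i w -> tame i w.
Proof. by case: i => [|i] //= /and3P[]. Qed.

Lemma flat_meas J i : (forall a b, (a < i)%N -> J (a, b)) ->
  mxmeas (T := sigJ x J) (flat i).
Proof.
elim: i => [_|i IH iJ]; first exact: mxmeas_cst.
have mx : mxmeas (T := sigJ x J) (xrow x p i).
  move=> a j; rewrite (ord1 a) (_ : (fun w => _) = x (i, j : nat)).
    by apply: measurable_coord; exact: iJ.
  by apply/funext => w; rewrite mxE.
apply: mxmeasB.
  apply: mxmeasD; last exact: mxmeas_cst.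
  by apply: IH => a b ai; apply: iJ; exact: ltnW.
apply: mxmeasZ => //; apply: mxmeasM => //; exact: mxmeas_tr.
Qed.

Lemma res_meas J i : (forall a b, (a < i)%N -> J (a, b)) ->
  mxmeas (T := sigJ x J) (res i) /\ mxmeas (T := sigJ x J) (resS i).
Proof.
move=> iJ; split; apply: mxmeas_inv; first exact: flat_meas.
by apply: mxmeasD; [exact: flat_meas|exact: mxmeas_cst].
Qed.

Lemma tame_meas J i : (forall a b, (a < i)%N -> J (a, b)) ->
  measurable_fun (setT : set (sigJ x J)) (tame i).
Proof.
move=> iJ; have [mW _] := res_meas iJ.
have mW2 := mxmeasM mW mW; have mW4 := mxmeasM mW2 mW2.
have me : mxmeas (T := sigJ x J) (fun=> e) by exact: mxmeas_cst.
do 5![apply: measurable_and; first by apply: measurable_fun_ler => //;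
   first [exact: measurable_trace|apply: measurable_dot => //; exact: mxmeasM]].
by apply: measurable_fun_ler => //; apply: measurable_dot => //; exact: mxmeasM.
Qed.

Lemma safe_meas J i : (forall a b, (a < i)%N -> J (a, b)) ->
  measurable_fun (setT : set (sigJ x J)) (safe i).
Proof.
elim: i => [_|i IH iJ]; first exact: tame_meas.
have iJ' a b : (a < i)%N -> J (a, b) by move=> ai; apply: iJ; exact: ltnW.
have mx : mxmeas (T := sigJ x J) (xrow x p i).
  move=> a j; rewrite (ord1 a) (_ : (fun w => _) = x (i, j : nat)).
    by apply: measurable_coord; exact: iJ.
  by apply/funext => w; rewrite mxE.
apply: measurable_and; first exact: IH.
apply: measurable_and; last exact: tame_meas.
apply: measurable_fun_ler => //; apply: measurable_funM => //; apply: measurable_dot => //.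
by apply: mxmeasM => //; have [] := res_meas iJ'.
Qed.

Definition drift (S : 'M[R]_p) i w : R :=
  (safe i w)%:R * (\tr (S *m res i w) - \tr (S *m invmx D)) ^+ 2.

(** The normalized trace as a test functional. Its displacement [m - m0] enters the error of every
    other functional, so the recursion closes only when it is tracked as well. *)
Definition testN : 'M[R]_p := (N^-1)%:M.

Lemma trace_testN A : \tr (testN *m A) = \tr A / N.
Proof. by rewrite mul_scalar_mx mxtraceZ mulrC. Qed.

Section TestMatrix.
Variable S : 'M[R]_p.
Hypothesis pS : psdquad S.
Hypothesis S0 : 0 <= \tr (S *m invmx D) <= K.
Hypothesis tameS : forall i w, tame i w -> [/\ \tr (S *m res i w) <= K,
  \tr (S *m (res i w *m res i w)) <= K &
  \tr (S *m (res i w *m res i w *m (res i w *m res i w))) <= K].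

Lemma drift_nice i : nice P (drift S i) /\ forall w, 0 <= drift S i w <= K ^+ 2.
Proof.
have K0 : 0 <= K by have := K1; lra.
have b w : 0 <= drift S i w <= K ^+ 2.
  rewrite /drift; have [si|_] := boolP (safe i w); last by rewrite mul0r lexx exprn_ge0.
  have [t1 _ _] := tameS (safe_tame si).
  have [/andP[t0 _] _ _ _] := shift_trace (safe_posdef si) cN0 pS.
  have [/andP[_ t2] _ _ _] := shift_trace (safe_posdef si) cN0 pS.
  have t3 := le_trans t0 t2.
  rewrite mul1r sqr_ge0 -[X in X <= _]real_normK ?num_real // ler_pXn2r ?nnegrE //=.
  by case/andP: S0 => s0 s1; rewrite ler_norml; apply/andP; split; rewrite -/(res i w); lra.
split=> //; apply: (@nice_bounded _ _ _ _ _ (K ^+ 2)) => [|w]; last first.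
  by have /andP[? ?] := b w; rewrite ger0_norm.
have m1 := safe_meas (J := setT) (i := i) (fun _ _ _ => I).
have [m2 _] := res_meas (J := setT) (i := i) (fun _ _ _ => I).
apply: (@measurable_sigJ _ _ _ _ x _ _ setT).
rewrite /drift (_ : (fun w => _) = fun w => (if safe i w then 1 else 0) *
  (\tr (S *m res i w) - \tr (S *m invmx D)) ^+ 2); last first.
  by apply/funext => w; case: (safe i w).
apply: measurable_funM; first by apply: measurable_fun_ifT.
apply: measurable_funX; apply: measurable_funB => //; apply: measurable_trace.
by apply: mxmeasM => //; exact: mxmeas_cst.
Qed.

End TestMatrix.

Lemma testN_psd : psdquad testN.
Proof.
split=> [|u]; first by rewrite /testN tr_scalar_mx.
by rewrite /testN dot_scalar mulr_ge0 ?dot_ge0 // invr_ge0 ltW.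
Qed.

Lemma testN_init : 0 <= \tr (testN *m invmx D) <= K.
Proof. by rewrite trace_testN -m0E; have [M1' K1'] := (M1, K1); case/andP: m0M => ? ?; lra. Qed.

Lemma testN_tame i w : tame i w -> [/\ \tr (testN *m res i w) <= K,
  \tr (testN *m (res i w *m res i w)) <= K &
  \tr (testN *m (res i w *m res i w *m (res i w *m res i w))) <= K].
Proof.
have [M1' K1'] := (M1, K1).
case/and4P=> h1 h2 h3 _; rewrite !trace_testN !ler_pdivrMr //; split => //.
by apply: le_trans h1 _; rewrite ler_pM2r //; lra.
Qed.

Section TestMatrixStep.
Variable S : 'M[R]_p.
Hypothesis pS : psdquad S.
Hypothesis S0 : 0 <= \tr (S *m invmx D) <= K.
Hypothesis tameS : forall i w, tame i w -> [/\ \tr (S *m res i w) <= K,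
  \tr (S *m (res i w *m res i w)) <= K &
  \tr (S *m (res i w *m res i w *m (res i w *m res i w))) <= K].

Definition noiseC : R := 3 + 2 * K ^+ 2 + quadK x * (K ^+ 4 + K ^+ 2).

(** In the mean the term in [X - tA] disappears, its coefficient depending on the other rows only;
    the remaining noise is bounded by the fourth moments of two quadratic forms in the row. *)
Lemma drift_step i (ep : R) : 0 < ep -> Ex P (drift S i.+1) <= Ex P (drift S i) +
  stepC K M / N * (Ex P (drift S i) + Ex P (drift testN i) +
    noiseC * (ep + N^-1 + (N * ep)^-1)).
Proof.
move=> ep0; have K0 : 0 <= K by have := K1; lra.
have M1' := M1; have Mp : 0 < 1 - M by lra.
pose J := other_rows i.
have iJ a b : (a < i)%N -> J (a, b) by rewrite /J /other_rows /= => ai ia; rewrite ia ltnn in ai.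
have [mW mWt] := res_meas iJ.
pose gb w : R := (safe i w)%:R.
pose A w := gb w *: (resS i w *m S *m resS i w).
pose B w := gb w *: resS i w.
pose mt w := \tr (resS i w) / N.
pose co w := gb w * (2 * (\tr (S *m res i w) - \tr (S *m invmx D)) / (1 - mt w) / N).
have mgb : measurable_fun (setT : set (sigJ x J)) gb.
  rewrite /gb (_ : (fun w => _) = fun w => if safe i w then 1 else 0).
    by apply: measurable_fun_ifT => //; exact: safe_meas.
  by apply/funext => w; case: (safe i w).
have mS : mxmeas (T := sigJ x J) (fun=> S) by exact: mxmeas_cst.
have mB : mxmeas (T := sigJ x J) B by apply: mxmeasZ.
have mA : mxmeas (T := sigJ x J) A.
  by apply: mxmeasZ => //; apply: mxmeasM => //; exact: mxmeasM.
have mco : measurable_fun (setT : set (sigJ x J)) co.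
  apply: measurable_funM => //; apply: measurable_funM => //; apply: measurable_funM.
    apply: measurable_funM => //; apply: measurable_funB => //.
    by apply: measurable_trace; exact: mxmeasM.
  apply: measurable_funV; apply: measurable_funB => //; apply: measurable_funM => //.
  exact: measurable_trace.
have mT0 (f : T -> R) : measurable_fun (setT : set (sigJ x J)) f -> measurable_fun setT f.
  exact: measurable_sigJ.
have gb01 w : 0 <= gb w <= 1 by rewrite /gb; case: (safe i w); rewrite ?lexx ?ler01.
pose CN := stepC K M / N.
have CN0 : 0 <= CN.
  rewrite divr_ge0 ?(ltW N0) //; apply: le_trans (stepC_ge M1 K0).
  by rewrite mulr_ge0 ?sqr_ge0 // addr_ge0 // mulr_ge0 ?sqr_ge0.
have facts w : [/\ (A w)^T = A w, 0 <= \tr (A w) <= K, \tr (A w *m A w) <= K ^+ 2,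
    (B w)^T = B w /\ 0 <= \tr (B w *m B w) <= K * N & `|co w| <= 2 * K / (1 - M) / N].
  rewrite /A /B /co /gb; have [si|_] := boolP (safe i w); last first.
    rewrite !scale0r trmx0 mul0mx mxtrace0 lexx mul0r normr0 !mulr_ge0 ?exprn_ge0 ?invr_ge0 ?(ltW N0) ?(ltW Mp) //.
  have [t1 t2 t3] := tameS (safe_tame si).
  have /and3P[h1 h2 _] := safe_tame si.
  have [[pA trA trA2 [T0 /andP[_ trWt]] trWt2] _] :=
    step_matrix (xrow x p i w) (safe_posdef si) pS N1 m0M M1 K0 cE S0 ep0 t1 t2 t3 h1 h2.
  rewrite !scale1r mul1r; split => //; first by case: pA.
    by split => //; case: (posdef_inv (shift_posdef (safe_posdef si) cN0)).
  have mtM : mt w <= M by rewrite ler_pdivrMr.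
  have Mt : 0 < 1 - mt w by lra.
  rewrite !normrM normr_nat [`|(1 - mt w)^-1|]gtr0_norm ?invr_gt0 // [`|N^-1|]gtr0_norm ?invr_gt0 //.
  rewrite ler_pM2r ?invr_gt0 //; apply: ler_pM; rewrite ?mulr_ge0 ?invr_ge0 ?(ltW Mt) //.
    rewrite ler_wpM2l //; case/andP: S0 => s0 s1.
    rewrite ler_norml; apply/andP; split; rewrite -/(res i w) in T0; lra.
  by rewrite lef_pV2 ?posrE //; lra.
pose Y w := dot (xrow x p i w *m A w) (xrow x p i w) - \tr (A w).
pose Z w := dot (xrow x p i w *m B w) (xrow x p i w) - \tr (B w).
pose V w := dot (xrow x p i w *m (co w *: A w)) (xrow x p i w) - \tr (co w *: A w).
pose H w := drift S i w + CN * (drift S i w + drift testN i w) + V w +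
  CN * ((ep + N^-1) * (2 + 2 * K ^+ 2 + gb w * Y w ^+ 4) +
        ep^-1 * ((N ^+ 3)^-1 * (gb w * Z w ^+ 4) + N^-1)).
have HV w : drift S i.+1 w <= H w.
  have Y40 : 0 <= gb w * Y w ^+ 4.
    by rewrite mulr_ge0 ?exprn_even_ge0 //; case/andP: (gb01 w).
  have Z40 : 0 <= (N ^+ 3)^-1 * (gb w * Z w ^+ 4).
    by rewrite mulr_ge0 ?invr_ge0 ?exprn_ge0 ?(ltW N0) // mulr_ge0 ?exprn_even_ge0 //; case/andP: (gb01 w).
  have epN : 0 <= ep + N^-1 by rewrite addr_ge0 ?invr_ge0 ?(ltW N0) ?(ltW ep0).
  have iN : 0 <= N^-1 by rewrite invr_ge0 ltW.
  have iep : 0 <= ep^-1 by rewrite invr_ge0 ltW.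
  have [si|nsi] := boolP (safe i w); last first.
    have gb0 : gb w = 0 by rewrite /gb (negPf nsi).
    have V0 : V w = 0 by rewrite /V /A gb0 scale0r scaler0 mulmx0 dot0l mxtrace0 subr0.
    rewrite /drift /= (negPf nsi) /= mul0r /H /drift (negPf nsi) V0 !mul0r !addr0 mulr0 !add0r.
    apply: (mulr_ge0 CN0); apply: addr_ge0.
      by apply: (mulr_ge0 epN); rewrite !addr_ge0 // mulr_ge0 ?sqr_ge0.
    by apply: mulr_ge0 => //; apply: addr_ge0.
  have [t1 t2 t3] := tameS (safe_tame si).
  have /and3P[h1 h2 _] := safe_tame si.
  have [[_ /andP[trA0 trA] _ [T0 _] _]] :=
    step_matrix (xrow x p i w) (safe_posdef si) pS N1 m0M M1 K0 cE S0 ep0 t1 t2 t3 h1 h2.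
  rewrite /= -/(resS i w) -/(res i w) -/(mt w) -/CN.
  have gb1 : gb w = 1 by rewrite /gb si.
  have AE : resS i w *m S *m resS i w = A w by rewrite /A gb1 scale1r.
  have BE : resS i w = B w by rewrite /B gb1 scale1r.
  rewrite AE in trA0 trA *.
  set rhs := (X in 0 <= X).
  have rhsH : rhs <= H w.
    have VE : V w = co w * (dot (xrow x p i w *m A w) (xrow x p i w) - \tr (A w)).
      by rewrite /V -scalemxAr dotZl (mxtraceZ (co w)) mulrBr.
    rewrite /rhs /H /drift si !mul1r trace_testN trace_testN -m0E VE.
    rewrite /co gb1 !mul1r.
    rewrite lerD2l ler_wpM2l //.
    have hX : 1 + dot (xrow x p i w *m A w) (xrow x p i w) ^+ 2 <= 2 + 2 * K ^+ 2 + Y w ^+ 4.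
      have -> : dot (xrow x p i w *m A w) (xrow x p i w) = Y w + \tr (A w) by rewrite /Y subrK.
      by apply: quartic_bound; rewrite trA0.
    (* The square is traded for a fourth power by [z <= z^2 N + 1 / N] with [z = Z^2 / N^2]; the
       fourth moment of [Z] is of order [N^2], so both terms are of order [1 / N]. *)
    have hZ : (dot (xrow x p i w *m resS i w) (xrow x p i w) / N - mt w) ^+ 2 <=
        (N ^+ 3)^-1 * Z w ^+ 4 + N^-1.
      rewrite /mt -mulrBl BE -/(Z w) expr_div_n.
      have -> : (N ^+ 3)^-1 * Z w ^+ 4 = Z w ^+ 2 / N ^+ 2 * (Z w ^+ 2 / N ^+ 2) * N.
        by field; rewrite gt_eqF.
      have N0' := N0; move: (Z w ^+ 2 / _) => z.
      rewrite -(@ler_pM2r _ N) // mulrDl mulVf ?gt_eqF // -subr_ge0.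
      rewrite (_ : _ - _ = (z * N - 2^-1) ^+ 2 + 3 / 4); last by field.
      by rewrite addr_ge0 ?sqr_ge0.
    rewrite [ep^-1 * _]mulrC.
    by apply: lerD; [exact: ler_wpM2l|exact: ler_wpM2r].
  move=> [rhs0 le_rhs]; rewrite /drift; have [si1|_] := boolP (safe i.+1 w); last first.
    by rewrite mul0r; apply: le_trans rhsH.
  rewrite mul1r; apply: le_trans rhsH; apply: le_rhs.
  by move: si1 => /= /and3P[].
have nA a b : nice P (fun w => A w a b).
  apply: (nice_bounded _ (a := K)) => [|w]; first exact: mT0.
  by have [sA _ A2 _ _] := facts w; exact: sym_entry_le.
have nB a b : nice P (fun w => B w a b).
  apply: (nice_bounded _ (a := Num.sqrt (K * N))) => [|w]; first exact: mT0.
  have [_ _ _ [sB /andP[_ B2]] _] := facts w; apply: sym_entry_le => //.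
  by rewrite sqr_sqrtr // mulr_ge0 // ltW.
have nco : nice P co.
  by apply: (nice_bounded _ (a := 2 * K / (1 - M) / N)) => [|w]; [exact: mT0|by have [] := facts w].
have ngb : nice P gb.
  by apply: (@nice_bounded _ _ _ _ _ 1) => [|w]; [exact: mT0|rewrite ger0_norm; case/andP: (gb01 w)].
have nx a : nice P (fun w => xrow x p i w 0 a) by exact: nice_xrow.
have ncA a b : nice P (fun w => (co w *: A w) a b).
  by under eq_fun do rewrite mxE; nice_tac.
have nq (F : T -> 'M[R]_p) : (forall a b, nice P (fun w => F w a b)) ->
    nice P (fun w => dot (xrow x p i w *m F w) (xrow x p i w)) /\ nice P (fun w => \tr (F w)).
  move=> nF; split; last by rewrite /mxtrace; nice_tac.
  under eq_fun do rewrite dotE; apply: nice_sum => a.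
  by apply: niceM => //; under eq_fun do rewrite mxE; nice_tac.
have nY : nice P Y by have [? ?] := nq A nA; apply: niceB.
have nZ : nice P Z by have [? ?] := nq B nB; apply: niceB.
have [nV1 nV2] := nq _ ncA.
have nV : nice P V by apply: niceB.
have EV : Ex P V = 0.
  rewrite ExB // (Ex_row_quad indx idx nx0 mean0 var1) ?subrr //.
  by apply: mxmeasZ.
have EY : Ex P (fun w => gb w * Y w ^+ 4) <= quadK x * K ^+ 4.
  apply: le_trans (Ex_row_quad4_rand indx idx nx0 mean0 var1 _ _ _ _ _ _) _ => //.
    by move=> w; have [] := facts w.
  rewrite ler_wpM2l ?quadK_ge0 // -(Ex_cst P (K ^+ 4)); apply: Ex_le.
  - by under eq_fun do rewrite /mxtrace; nice_tac; under eq_fun do rewrite mxE; nice_tac.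
  - exact: nice_cst.
  move=> w; have [_ /andP[trA0 _] A2 _ _] := facts w; have /andP[g0 g1] := gb01 w.
  have A20 : 0 <= \tr (A w *m A w).
    have [sA _ _ _ _] := facts w; rewrite -{1}sA /mxtrace sumr_ge0 // => a _.
    by rewrite mxE sumr_ge0 // => b _; rewrite mxE -expr2 sqr_ge0.
  apply: le_trans (_ : 1 * (K ^+ 2) ^+ 2 <= _); last by rewrite mul1r -exprM.
  by rewrite ler_pM ?sqr_ge0 // ler_pXn2r ?nnegrE ?sqr_ge0.
have EZ : Ex P (fun w => gb w * Z w ^+ 4) <= quadK x * (K * N) ^+ 2.
  apply: le_trans (Ex_row_quad4_rand indx idx nx0 mean0 var1 _ _ _ _ _ _) _ => //.
    by move=> w; have [_ _ _ []] := facts w.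
  rewrite ler_wpM2l ?quadK_ge0 // -(Ex_cst P ((K * N) ^+ 2)); apply: Ex_le.
  - by under eq_fun do rewrite /mxtrace; nice_tac; under eq_fun do rewrite mxE; nice_tac.
  - exact: nice_cst.
  move=> w; have [_ _ _ [_ /andP[B20 B2]] _] := facts w; have /andP[g0 g1] := gb01 w.
  rewrite -[leRHS]mul1r ler_pM ?sqr_ge0 // ler_pXn2r ?nnegrE //.
  exact: le_trans B2.
have [nd _] := drift_nice pS S0 tameS i; have [nd1 _] := drift_nice pS S0 tameS i.+1.
have [ndt _] := drift_nice testN_psd testN_init testN_tame i.
have nH : nice P H by rewrite /H; nice_tac.
apply: le_trans (Ex_le nd1 nH HV) _.
have -> : Ex P H = Ex P (drift S i) + CN * (Ex P (drift S i) + Ex P (drift testN i)) + 0 +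
   CN * ((ep + N^-1) * (2 + 2 * K ^+ 2 + Ex P (fun w => gb w * Y w ^+ 4)) +
        ep^-1 * ((N ^+ 3)^-1 * Ex P (fun w => gb w * Z w ^+ 4) + N^-1)).
  rewrite /H ExD; [|by nice_tac|by nice_tac].
  rewrite ExD; [|by nice_tac|by nice_tac].
  rewrite ExD; [|by nice_tac|by nice_tac].
  rewrite EV ExZ; last by nice_tac.
  rewrite ExD // ExZ; last by nice_tac.
  rewrite ExD; [|by nice_tac|by nice_tac].
  rewrite ExZ; last by nice_tac.
  rewrite ExD; [|by nice_tac|by nice_tac].
  rewrite ExZ; last by nice_tac.
  rewrite ExD; [|by nice_tac|by nice_tac].
  rewrite [Ex P (fun w => _ * _ + N^-1)]ExD; [|by nice_tac|by nice_tac].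
  by rewrite !Ex_cst ExZ //; nice_tac.
rewrite addr0 -/CN -[leLHS]addrA lerD2l -mulrDr ler_wpM2l // lerD2l.
have iep : 0 < ep^-1 by rewrite invr_gt0.
have iN : 0 < N^-1 by rewrite invr_gt0.
have Q0 := quadK_ge0 x.
rewrite [noiseC * _]mulrDr; apply: lerD.
  rewrite mulrC ler_wpM2r ?addr_ge0 ?(ltW ep0) ?(ltW iN) //.
  have := mulr_ge0 Q0 (sqr_ge0 K).
  by move: EY; rewrite /noiseC; move: (Ex _ _) (quadK x) => E1 Q; lra.
apply: le_trans (_ : ep^-1 * ((N ^+ 3)^-1 * (quadK x * (K * N) ^+ 2) + N^-1) <= _).
  rewrite ler_wpM2l ?(ltW iep) // lerD2r ler_wpM2l // invr_ge0 exprn_ge0 // (ltW N0) //.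
have -> : ep^-1 * ((N ^+ 3)^-1 * (quadK x * (K * N) ^+ 2) + N^-1) =
  (quadK x * K ^+ 2 + 1) * (N * ep)^-1 by field; rewrite !gt_eqF.
rewrite ler_wpM2r ?invr_ge0 ?mulr_ge0 ?(ltW ep0) //; first exact: ltW.
rewrite /noiseC; have h1 : 0 <= quadK x * K ^+ 4 by rewrite mulr_ge0 // exprn_ge0.
by have h2 := sqr_ge0 K; lra.
Qed.

End TestMatrixStep.

Definition testE : 'M[R]_p := e^T *m e.

Lemma trace_testE A : \tr (testE *m A) = dot (e *m A) e.
Proof. by rewrite /testE -mulmxA mxtrace_mulC /dot -trace_mx11. Qed.

Lemma testE_psd : psdquad testE.
Proof.
by split=> [|u]; [rewrite /testE trmx_mul trmxK|rewrite dot_outer sqr_ge0].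
Qed.

Hypothesis eK : dot (e *m invmx D) e <= K.

Lemma testE_init : 0 <= \tr (testE *m invmx D) <= K.
Proof. by rewrite trace_testE eK posdef_ge0 //; exact: posdef_inv. Qed.

Lemma testE_tame i w : tame i w -> [/\ \tr (testE *m res i w) <= K,
  \tr (testE *m (res i w *m res i w)) <= K &
  \tr (testE *m (res i w *m res i w *m (res i w *m res i w))) <= K].
Proof. by rewrite !trace_testE /tame => /and5P[_ _ _ ? /andP[]]. Qed.

Lemma noiseC_ge0 : 0 <= noiseC.
Proof.
have K0 : 0 <= K by have := K1; lra.
have Q0 := quadK_ge0 x; have h := sqr_ge0 K.
have h1 := mulr_ge0 Q0 (exprn_ge0 4 K0); have h2 := mulr_ge0 Q0 h.
by rewrite /noiseC mulrDr; lra.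
Qed.

(** Discrete Gronwall for the sum of both drifts and the noise level. Both drifts start at 0; adding
    the two recursions counts [drift testN] three times, hence the factor [1 + 3 * CN] per step, and
    at most [N] steps are made. *)
Lemma drift_small i (ep : R) : 0 < ep -> i%:R <= N ->
  Ex P (drift testE i) <=
  expR (3 * stepC K M) * (noiseC * (ep + N^-1 + (N * ep)^-1)).
Proof.
move=> ep0 iN; set s := noiseC * _.
have K0 : 0 <= K by have := K1; lra.
pose CN := stepC K M / N.
have C0 : 0 <= stepC K M.
  apply: le_trans (stepC_ge M1 K0).
  by rewrite mulr_ge0 ?sqr_ge0 // addr_ge0 // mulr_ge0 ?sqr_ge0.
have CN0 : 0 <= CN by rewrite divr_ge0 ?(ltW N0).
have s0 : 0 <= s.
  rewrite /s; apply: mulr_ge0; last by rewrite !addr_ge0 ?invr_ge0 ?mulr_ge0 ?(ltW N0) ?(ltW ep0).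
  exact: noiseC_ge0.
have ge0 S j : 0 <= Ex P (drift S j).
  by apply: Ex_ge0 => w; rewrite /drift mulr_ge0 ?sqr_ge0.
have H j : Ex P (drift testE j) + Ex P (drift testN j) + s <= (1 + 3 * CN) ^+ j * s.
  elim: j => [|j IH].
    rewrite expr0 mul1r gerDr (_ : drift testE 0 = fun=> 0).
      rewrite (_ : drift testN 0 = fun=> 0) ?Ex_cst ?addr0 //.
      by apply/funext => w; rewrite /drift /res /= subrr expr0n mulr0.
    by apply/funext => w; rewrite /drift /res /= subrr expr0n mulr0.
  have := drift_step testE_psd testE_init testE_tame j ep0.
  have := drift_step testN_psd testN_init testN_tame j ep0.
  rewrite -/CN -/s exprS -mulrA.
  have : (1 + 3 * CN) * (Ex P (drift testE j) + Ex P (drift testN j) + s) <=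
    (1 + 3 * CN) * ((1 + 3 * CN) ^+ j * s) by rewrite ler_wpM2l //; lra.
  have := mulr_ge0 CN0 (ge0 testE j); have := mulr_ge0 CN0 s0.
  move: (Ex P _) (Ex P _) (Ex P _) (Ex P _) (_ * (_ * s)) => e1 e2 e3 e4 z.
  lra.
have {H} := H i; have eN0 := ge0 testN i.
have : (1 + 3 * CN) ^+ i * s <= expR (3 * stepC K M) * s.
  rewrite ler_wpM2r //; apply: le_trans (_ : expR (3 * CN) ^+ i <= _).
    by rewrite lerXn2r ?nnegrE ?expR_ge0 ?expR_ge1Dx // addr_ge0 // mulr_ge0.
  rewrite -expRM_natl ler_expR /CN.
  have -> : i%:R * (3 * (stepC K M / N)) = 3 * stepC K M * (i%:R / N) by ring.
  by rewrite ler_piMr ?mulr_ge0 // ler_pdivrMr // mul1r.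
lra.
Qed.

Lemma flat_quad i w u : dot (u *m flat i w) u = dot (u *m D) u +
  i%:R * (c / N) * dot u u - N^-1 * \sum_(j < i) dot u (xrow x p j w) ^+ 2.
Proof.
elim: i => [|i IH] /=; first by rewrite big_ord0 !mul0r mulr0 subr0 addr0.
rewrite mulmxBr dotBl -scalemxAr dotZl dot_outer mulmxDr dotDl IH.
rewrite dot_scalar big_ord_recr /= -natr1; ring.
Qed.

End FlatProcess.

(** * Monotonicity of inverses and the lower estimate *)

Section SpikeBound.
Context {R : realType}.

(** [posdef_CS] for [A] with the vectors [u *m invmx B] and [u]: by hypothesis the first factor is
    at most the form of [invmx B] at [u], which cancels. *)
Lemma posdef_inv_mono p (A B : 'M[R]_p) : posdef A -> posdef B ->
  (forall u, dot (u *m A) u <= dot (u *m B) u) ->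
  forall u, dot (u *m invmx B) u <= dot (u *m invmx A) u.
Proof.
move=> pA pB AB u; have uB := posdef_unit pB.
have [->|u0] := eqVneq u 0; first by rewrite !mul0mx.
have b0 := (posdef_inv pB).2 u u0.
have := posdef_CS (u *m invmx B) u pA; rewrite expr2.
have := AB (u *m invmx B); rewrite mulmxKV // [dot u (u *m _)]dotC.
move=> h1 h2; rewrite -(ler_pM2l b0); apply: le_trans h2 _.
by rewrite ler_wpM2r // posdef_ge0 //; exact: posdef_inv.
Qed.

Lemma posdef_trace_mono p (A B : 'M[R]_p) :
  (forall u, dot (u *m A) u <= dot (u *m B) u) -> \tr A <= \tr B.
Proof.
move=> AB; apply: ler_sum => i _; have := AB (delta_mx 0 i).
by rewrite /dot !trmx_delta -!rowE -!colE !mxE.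
Qed.

(** [k1] dominates the eigenvalues of the inverse and is at least 1, so [k1 ^+ 4] serves every power
    up to the fourth. *)
Lemma inv_bounds p (B : 'M[R]_p) (kap k1 : R) (e : 'rV[R]_p) : 0 < kap ->
  k1 = 1 + kap^-1 -> dot e e = 1 ->
  B^T = B -> (forall u, kap * dot u u <= dot (u *m B) u) ->
  let W := invmx B in let W2 := W *m W in
  [/\ posdef B, \tr W2 <= k1 ^+ 4 * p%:R, \tr (W2 *m W2) <= k1 ^+ 4 * p%:R &
  [/\ dot (e *m W) e <= k1 ^+ 4, dot (e *m W2) e <= k1 ^+ 4 &
      dot (e *m (W2 *m W2)) e <= k1 ^+ 4]].
Proof.
move=> kap0 kE e1 sB kB W W2.
have pB : posdef B.
  by split=> // u u0; apply: lt_le_trans (kB u); rewrite mulr_gt0 // dot_gt0.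
have [Q [f [OQ BE f0]]] := posdef_sfun pB.
have kf i : kap <= f i by apply: (sfun_lower OQ); rewrite -BE.
have WE : W = sfun Q (fun i => (f i)^-1).
  by rewrite /W BE; have [|_ ->] := sfun_inv OQ (f := f) => // i; rewrite gt_eqF.
have ki : 0 <= kap^-1 by rewrite invr_ge0 ltW.
have w0 i : 0 <= (f i)^-1 by rewrite invr_ge0 ltW.
have wk i : (f i)^-1 <= k1.
  by rewrite kE; apply: le_trans (_ : kap^-1 <= _); [rewrite lef_pV2 ?posrE|lra].
have k11 : 1 <= k1 by rewrite kE; lra.
have wX i j : (j <= 4)%N -> (f i)^-1 ^+ j <= k1 ^+ 4.
  move=> j4; apply: le_trans (_ : k1 ^+ j <= _).
    by rewrite lerXn2r ?nnegrE //; lra.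
  by rewrite ler_weXn2l.
have W2E : W2 = sfun Q (fun i => (f i)^-1 ^+ 2).
  by rewrite /W2 WE sfunM //; congr (sfun Q _); apply/funext => i; rewrite expr2.
have W4E : W2 *m W2 = sfun Q (fun i => (f i)^-1 ^+ 4).
  by rewrite W2E sfunM //; congr (sfun Q _); apply/funext => i; rewrite -exprD.
have trb g : (forall i, g i <= k1 ^+ 4) -> \tr (sfun Q g) <= k1 ^+ 4 * p%:R.
  move=> gk; rewrite mxtrace_sfun //; apply: le_trans (ler_sum _ (fun i _ => gk i)) _.
  by rewrite sumr_const card_ord mulr_natr.
have dotb g : (forall i, g i <= k1 ^+ 4) -> dot (e *m sfun Q g) e <= k1 ^+ 4.
  move=> gk; apply: le_trans (sfun_le Q e gk) _.
  by rewrite sfun_scalar // dot_scalar e1 mulr1.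
rewrite W4E W2E WE; split => //; [by apply: trb => i; exact: wX|by apply: trb => i; exact: wX|].
split; apply: dotb => i; [|exact: wX|exact: wX].
by have := wX i 1%N; rewrite expr1; apply.
Qed.

End SpikeBound.

(** Positivity of the flat process comes from the barrier started at [D - g%:M]. Over the whole run
    the barrier gains at most [g - 2 * kap] through its larger shift and at most [kap] through its
    error, so the flat matrix stays above [kap] times the identity plus a positive matrix. *)
Lemma spike_bound {R : realType} {d} {T : measurableType d} {P : probability T R}
    {x : nat * nat -> {RV P >-> R}} (Y M1 kap rho s : R) :
  standard_array x -> 0 <= Y -> 0 <= M1 < 1 -> 0 < kap ->
  0 < rho -> 0 < s ->
  exists N0 : nat, forall (n p : nat) (D : 'M[R]_p) (e : 'rV[R]_p) (g m0 m1 : R),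
  (N0 <= n)%N -> p%:R <= Y * n%:R -> posdef D -> posdef (D - g%:M) ->
  dot e e = 1 -> m0 = \tr (invmx D) / n%:R -> \tr (invmx (D - g%:M)) <= m1 * n%:R ->
  m0 <= M1 -> m1 <= M1 -> 2 * kap <= g ->
  (1 - m1)^-1 <= (1 - m0)^-1 + g - 2 * kap ->
  exists G : set T, [/\ measurable G, 1 - rho <= Ex P \1_G &
    forall w, G w -> forall b : R, 0 < b ->
      (forall u, n%:R^-1 * \sum_(i < n) dot u (xrow x p i w) ^+ 2 <=
         dot (u *m D) u + ((1 - m0)^-1 - b) * dot u u) ->
      b * (dot (e *m invmx D) e - s) <= 1].
Proof.
move=> /[dup] sx [indx idx nx0 mean0 var1] Y0 /andP[M10 M11] kap0 rho0 s0.
have kM : 0 <= M1 < 1 by rewrite M10.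
have rho2 : 0 < rho / 2 by rewrite divr_gt0.
have [Nb barr] := barrier_bound sx kM kap0 rho2.
have [k1 k1E] : exists k1 : R, k1 = 1 + kap^-1 by exists (1 + kap^-1).
have ki : 0 < kap^-1 by rewrite invr_gt0.
have k11 : 1 <= k1 by rewrite k1E; lra.
pose K : R := (1 + Y) * k1 ^+ 4.
pose M : R := (1 + M1) / 2.
have M1' : M < 1 by rewrite /M; lra.
have k14 : 1 <= k1 ^+ 4 by exact: exprn_ege1.
have k40 : 0 <= k1 ^+ 4 by exact: le_trans k14.
have k1K : k1 ^+ 4 <= K by rewrite /K ler_peMl // lerDl.
have K1 : 1 <= K by exact: le_trans k1K.
pose E := expR (3 * stepC K M) * (noiseC x K + 1).
have E0 : 0 < E.
  by rewrite mulr_gt0 ?expR_gt0 // ltr_wpDl // noiseC_ge0.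
(* Makes [E * (2 * ep)] equal to [rho / 2 * s ^+ 2], the bound on the drift that Chebyshev needs. *)
have [ep epE] : exists ep : R, ep = rho * s ^+ 2 / 4 / E by exists (rho * s ^+ 2 / 4 / E).
have s2 : 0 < s ^+ 2 by rewrite exprn_gt0.
have ep0 : 0 < ep by rewrite epE !divr_gt0 // mulr_gt0.
(* From this rank on, [n^-1 + (n ep)^-1] is at most [ep]. *)
have [N1 hN1] : exists N1 : nat, (1 + ep^-1) / ep < N1%:R.
  exists (Num.bound ((1 + ep^-1) / ep)).
  by apply: archi_boundP; rewrite divr_ge0 ?addr_ge0 ?invr_ge0 ?(ltW ep0).
exists (maxn 1 (maxn Nb N1)) => n p D e g m0 m1.
rewrite !geq_max => /and3P[n0 nb n1] pY pD pDg e1 m0E trDg m0M m1M kg gap.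
have N0 : 0 < n%:R :> R by rewrite ltr0n.
have N1' : 1 <= n%:R :> R by rewrite ler1n.
have m00 : 0 <= m0.
  rewrite m0E divr_ge0 ?(ltW N0) //.
  have [Q [f [OQ -> f0]]] := posdef_sfun (posdef_inv pD).
  by rewrite mxtrace_sfun // sumr_ge0 // => i _; exact: ltW.
have m0M' : 0 <= m0 <= M by rewrite m00 /M; clear -M11 m0M; lra.
pose c := (1 - m0)^-1.
have [G [mG PG GH]] := barr n p (D - g%:M) m1 nb pDg trDg m1M.
have fq := @flat_quad _ _ _ P x p D n%:R c.
have quadDg u : dot (u *m (D - g%:M)) u = dot (u *m D) u - g * dot u u.
  by rewrite mulmxBr dotBl dot_scalar.
have cn (i : nat) : (i <= n)%N -> i%:R / n%:R * (1 - m1)^-1 <= i%:R * (c / n%:R) + (g - 2 * kap).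
  move=> ni; have r0 : 0 <= i%:R / n%:R :> R by rewrite divr_ge0.
  have r1 : i%:R / n%:R <= 1 :> R by rewrite ler_pdivrMr // mul1r ler_nat.
  rewrite (_ : i%:R * (c / n%:R) = i%:R / n%:R * c); last by field; rewrite gt_eqF.
  apply: le_trans (ler_wpM2l r0 gap) _; rewrite -addrA mulrDr lerD2l.
  by rewrite ler_piMl //; clear -kg; lra.
(* The flag is deterministic on [G]: the matrices [C] of the barrier lie below the flat ones, and
   inversion reverses the order, which bounds both the traces and the row forms. *)
have safeG w i : G w -> (i <= n)%N -> safe x D e n%:R c M K i w.
  move=> /GH[H1 H2].
  have lowB j : (j <= n)%N -> exists C, [/\ posdef C, \tr (invmx C) <= M * n%:R,
      forall u, dot (u *m C) u <= dot (u *m flat x D n%:R c j w) u &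
      forall u, kap * dot u u <= dot (u *m flat x D n%:R c j w) u].
    move=> jn; have [C [pC trC Cu]] := H1 j jn; exists C; split => // u.
      apply: le_trans (Cu u) _; rewrite fq quadDg.
      have := ler_wpM2r (dot_ge0 u) (cn j jn); have := mulr_ge0 (ltW kap0) (dot_ge0 u).
      clear; lra.
    have := posdef_ge0 u pC; have := Cu u; rewrite fq quadDg.
    have := ler_wpM2r (dot_ge0 u) (cn j jn); clear; lra.
  have symB j : (flat x D n%:R c j w)^T = flat x D n%:R c j w.
    elim: j => [|j IH] /=; first by case: pD.
    by rewrite linearB linearD /= linearZ /= trmx_mul trmxK tr_scalar_mx IH.
  have pB j : (j <= n)%N -> posdef (flat x D n%:R c j w).
    move=> jn; have [C [_ _ _ kC]] := lowB j jn.
    by have [] := inv_bounds kap0 k1E e1 (symB j) kC.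
  have tameG j : (j <= n)%N -> tame x D e n%:R c M K j w.
    move=> jn; have [C [pC trC CB kC]] := lowB j jn.
    have [_ t2 t4 [d1 d2 d4]] := inv_bounds kap0 k1E e1 (symB j) kC.
    have pK : k1 ^+ 4 * p%:R <= K * n%:R.
      rewrite mulrC; apply: le_trans (_ : Y * n%:R * k1 ^+ 4 <= _).
        by rewrite ler_wpM2r //; lra.
      rewrite /K mulrAC ler_wpM2r ?(ltW N0) // ler_wpM2r //; clear; lra.
    rewrite /tame; apply/and5P; split.
    - apply: le_trans trC; apply: posdef_trace_mono; apply: posdef_inv_mono => //.
      exact: pB.
    - exact: le_trans t2 pK.
    - exact: le_trans t4 pK.
    - exact: le_trans d1 k1K.
    - by rewrite (le_trans d2 k1K) (le_trans d4 k1K).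
  elim: i => [_|i IH iN]; first exact: tameG.
  rewrite /= (IH (ltnW iN)) tameG // andbT /= ler_pdivrMr //.
  have [C [pC xC Cu]] := H2 i iN.
  apply: le_trans (_ : dot (xrow x p i w *m invmx C) (xrow x p i w) <= _) => //.
  have cN0 : 0 <= c / n%:R by rewrite divr_ge0 ?(ltW N0) // invr_ge0; clear -M11 m0M; lra.
  apply: posdef_inv_mono => //; first by apply: shift_posdef => //; exact: pB (ltnW iN).
  move=> u; apply: le_trans (Cu u) _; rewrite quadDg mulmxDr dotDl dot_scalar fq.
  have := ler_wpM2r (dot_ge0 u) (cn i.+1 iN); have := mulr_ge0 (ltW kap0) (dot_ge0 u).
  by rewrite -[in i.+1%:R * _]natr1; clear; lra.
have eK : dot (e *m invmx D) e <= K.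
  have kD u : kap * dot u u <= dot (u *m D) u.
    have := posdef_ge0 u pDg; rewrite quadDg.
    have := ler_wpM2r (dot_ge0 u) kg; have := mulr_ge0 (ltW kap0) (dot_ge0 u); clear; lra.
  have [_ _ _ [d1 _ _]] := inv_bounds kap0 k1E e1 (proj1 pD) kD.
  exact: le_trans d1 k1K.
have small := drift_small indx idx nx0 mean0 var1 pD N1' m0M' M1' K1 erefl m0E eK ep0 (lexx _).
pose W w := res x D n%:R c n w.
pose G' := [set w | safe x D e n%:R c M K n w && ((dot (e *m W w) e - dot (e *m invmx D) e) ^+ 2 <= s ^+ 2)].
have mG' : measurable G'.
  have m1' := safe_meas (x := x) (J := setT) (i := n) D e n%:R c M K (fun _ _ _ => I).
  have [m2' _] := res_meas (J := setT) (i := n) x D n%:R c (fun _ _ _ => I).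
  have : measurable_fun (setT : set (sigJ x setT))
     (fun w => safe x D e n%:R c M K n w && ((dot (e *m W w) e - dot (e *m invmx D) e) ^+ 2 <= s ^+ 2)).
    apply: measurable_and => //; apply: measurable_fun_ler => //.
    apply: measurable_funX; apply: measurable_funB => //; apply: measurable_dot.
      by apply: mxmeasM => //; exact: mxmeas_cst.
    exact: mxmeas_cst.
  move=> /(@measurable_sigJ _ _ _ _ x _ _ setT) /(_ measurableT [set true]).
  by rewrite setTI; apply.
exists G'; split => //.
  have nd : nice P (drift x D e n%:R c M K (testE e) n).
    apply: (proj1 (drift_nice pD N1' m0M' M1' K1 erefl (testE_psd e) (testE_init pD eK) _ n)).
    by move=> i w; exact: testE_tame.
  (* Chebyshev: on [G] the flag holds, so leaving [G'] forces a squared displacement above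
     [s ^+ 2]. *)
  have := Ex_le (niceB (nice_indic P mG) (niceZ (s ^+ 2)^-1 nd)) (nice_indic P mG').
  rewrite ExB ?ExZ //; [|exact: nice_indic|exact: niceZ].
  move=> H; apply: le_trans (H _); last first.
    move=> w; rewrite !indicE; have [Gw|nGw] := boolP (w \in G); last first.
      rewrite sub0r; apply: (@le_trans _ _ 0) => //; rewrite oppr_le0 mulr_ge0 ?invr_ge0 ?(ltW s2) //.
      by rewrite mulr_ge0 ?sqr_ge0.
    have [|nG'] := boolP (w \in G').
      by move=> _; rewrite gerBl mulr_ge0 ?invr_ge0 ?(ltW s2) // mulr_ge0 ?sqr_ge0.
    rewrite inE in Gw; have sw := safeG w n Gw (leqnn n).
    rewrite /drift sw mul1r !trace_testE.
    move: nG'; rewrite notin_setE /G' /= sw /= => /negP; rewrite -ltNge -/(W w) => lt_s.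
    rewrite subr_le0 mulrC ler_pdivlMr // mul1r; exact: ltW.
  have : (s ^+ 2)^-1 * Ex P (drift x D e n%:R c M K (testE e) n) <= rho / 2.
    rewrite mulrC ler_pdivrMr //; apply: le_trans small _.
    apply: le_trans (_ : E * (2 * ep) <= _); last first.
      by rewrite epE le_eqVlt; apply/orP; left; apply/eqP; field; rewrite gt_eqF.
    rewrite /E -[leRHS]mulrA ler_wpM2l ?expR_ge0 //.
    have nC0 := noiseC_ge0 x K1.
    have nn : (1 + ep^-1) / ep <= n%:R by apply: le_trans (ltW hN1) _; rewrite ler_nat.
    have h : n%:R^-1 + (n%:R * ep)^-1 <= ep.
      rewrite invfM -{1}[n%:R^-1]mulr1 -mulrDr ler_pdivrMl //.
      by rewrite -ler_pdivrMr.
    have i1 : 0 <= n%:R^-1 :> R by rewrite invr_ge0 ltW.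
    have i2 : 0 <= (n%:R * ep)^-1 by rewrite invr_ge0 mulr_ge0 ?(ltW N0) ?(ltW ep0).
    by apply: ler_pM => //; clear -ep0 h i1 i2; lra.
  clear -PG; lra.
move=> w /andP[sw sq] b b0 Hb.
have pB := safe_posdef pD N1' m0M' M1' erefl sw.
have BQ u : dot (u *m b%:M) u <= dot (u *m flat x D n%:R c n w) u.
  rewrite dot_scalar fq; have := Hb u; rewrite -/c.
  rewrite (_ : n%:R * (c / n%:R) = c); last by field; rewrite gt_eqF.
  clear; lra.
have pb : posdef (b%:M : 'M[R]_p).
  by split=> [|u u0]; rewrite ?tr_scalar_mx // dot_scalar mulr_gt0 // dot_gt0.
have := posdef_inv_mono pb pB BQ e.
have -> : invmx (b%:M) = (b^-1)%:M :> 'M[R]_p.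
  exact: invmx_scalar.
rewrite dot_scalar e1 mulr1 -/(W w) => Wb.
have : - s <= dot (e *m W w) e - dot (e *m invmx D) e.
  have : `|dot (e *m W w) e - dot (e *m invmx D) e| <= s.
    by rewrite -(@ler_pXn2r _ 2) ?nnegrE ?(ltW s0) // real_normK ?num_real.
  by rewrite ler_norml => /andP[].
move=> h; apply: le_trans (_ : b * dot (e *m W w) e <= _).
  by rewrite ler_pM2l //; clear -h; lra.
by rewrite -(ler_pM2l b0) mulfV ?gt_eqF // in Wb.
Qed.

(** * Outlying eigenvalues *)

Section Outlier.
Context {R : realType}.

(** Passing from [m0] to [m1] moves [(1 - m)^-1] by about [c ^+ 2 * (m1 - m0)], whose main part
    [be / 2 * (c ^+ 2 * sg)] is at most [be / 2 * (1 - eps)]. Half of the saved [be * eps / 2]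
    absorbs the terms of order [(N * be)^-1]; the other half is the margin [2 * (be * eps / 8)]. *)
Lemma spike_gap (N c cm be eps m0 m1 A sg : R) : 0 < eps < 1 -> 0 < be ->
  1 <= c <= cm -> 0 < N -> A = 1 - c^-1 -> (N * be)^-1 <= eps / (192 * cm) ->
  (N * be)^-1 <= be * eps / (16 * cm ^+ 2) ->
  m0 <= A + (N * be)^-1 -> m1 <= A + 2 * (N * be)^-1 ->
  m1 - m0 <= (N * be)^-1 + be / 2 * sg -> 0 <= sg -> c ^+ 2 * sg <= (1 - eps) ^+ 2 ->
  [/\ m0 <= 1 - (2 * cm)^-1, m1 <= 1 - (2 * cm)^-1 &
      (1 - m1)^-1 <= (1 - m0)^-1 + be / 2 - 2 * (be * eps / 8)].
Proof.
move=> /andP[e0 e1] be0 /andP[c1 ccm] N0 AE u1 u2 h0 h1 h10 sg0 csg.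
have c0 : 0 < c by lra.
have cm0 : 0 < cm by lra.
have u0 : 0 < (N * be)^-1 by rewrite invr_gt0 mulr_gt0.
move: (N * be)^-1 u0 u1 u2 h0 h1 h10 => u u0 u1 u2 h0 h1 h10.
have {}u1 : 192 * (cm * u) <= eps.
  by move: u1; rewrite ler_pdivlMr ?mulr_gt0 // => u1; clear -u1; lra.
have {}u2 : 16 * (cm ^+ 2 * u) <= be * eps.
  by move: u2; rewrite ler_pdivlMr ?mulr_gt0 ?exprn_gt0 // => u2; lra.
have cu : c * u <= cm * u by rewrite ler_pM2r.
have ccu : c ^+ 2 * u <= cm ^+ 2 * u by rewrite ler_pM2r // ler_pXn2r ?nnegrE ?(ltW c0) ?(ltW cm0).
have cV : cm^-1 <= c^-1 by rewrite lef_pV2.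
have cmV : 0 < cm^-1 by rewrite invr_gt0.
have iV : (2 * cm)^-1 = cm^-1 / 2 by rewrite invfM mulrC.
have ucm : 2 * u <= cm^-1 / 2.
  rewrite -(@ler_pM2l _ cm) // [X in _ <= X]mulrA mulfV ?gt_eqF //; clear -e1 u1; lra.
have b0 : m0 <= 1 - (2 * cm)^-1 by rewrite iV; clear -AE cV h0 u0 ucm; lra.
have b1 : m1 <= 1 - (2 * cm)^-1 by rewrite iV; clear -AE cV h1 ucm; lra.
split => //.
have m0p : 0 < 1 - m0 by clear -AE cV h0 u0 ucm; lra.
have m1p : 0 < 1 - m1 by clear -AE cV h1 u0 ucm; lra.
pose t := 2 * (c * u).
have t0 : 0 < t by rewrite /t !mulr_gt0.
have te : 96 * t <= eps by rewrite /t; clear -cu u1; lra.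
have bnd (m : R) : m <= A + 2 * u -> 0 < 1 - m -> (1 - m)^-1 <= c * (1 + 2 * t).
  move=> hm mp; rewrite invf_ple ?posrE //; last by rewrite mulr_gt0 //; clear -t0; lra.
  apply: le_trans (_ : (1 - t) / c <= _).
    rewrite ler_pdivlMr // invfM mulrAC mulVf ?gt_eqF // mul1r.
    rewrite invf_ple ?posrE; [|clear -t0; lra|clear -e1 te; lra].
    by rewrite -(@ler_pM2r _ (1 - t)) ?mulVf ?gt_eqF;
      [clear -e1 t0 te; nra|clear -e0; lra|clear -e1 te; lra|clear -e1 te; lra].
  rewrite (_ : (1 - t) / c = c^-1 - 2 * u); last by rewrite /t; field; rewrite gt_eqF.
  clear -AE hm; lra.
have X0 := bnd m0 _ m0p; have X1 := bnd m1 h1 m1p.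
have {}X0 : (1 - m0)^-1 <= c * (1 + 2 * t) by apply: X0; clear -h0 u0; lra.
have XE : (1 - m1)^-1 - (1 - m0)^-1 = (m1 - m0) * ((1 - m0)^-1 * (1 - m1)^-1).
  by field; rewrite !gt_eqF.
have p0 : 0 < (1 - m0)^-1 by rewrite invr_gt0.
have p1 : 0 < (1 - m1)^-1 by rewrite invr_gt0.
have XX : (1 - m0)^-1 * (1 - m1)^-1 <= (c * (1 + 2 * t)) ^+ 2.
  by rewrite expr2 ler_pM ?(ltW p0) ?(ltW p1).
have q0 : 0 <= u + be / 2 * sg by rewrite addr_ge0 ?(ltW u0) // mulr_ge0 // divr_ge0 // (ltW be0).
have : (1 - m1)^-1 - (1 - m0)^-1 <= (u + be / 2 * sg) * (c * (1 + 2 * t)) ^+ 2.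
  rewrite XE; apply: le_trans (ler_wpM2r _ h10) _; first by rewrite mulr_ge0 ?(ltW p0) ?(ltW p1).
  by rewrite ler_wpM2l.
have -> : (u + be / 2 * sg) * (c * (1 + 2 * t)) ^+ 2 =
  (c ^+ 2 * u + be / 2 * (c ^+ 2 * sg)) * (1 + 2 * t) ^+ 2 by ring.
have T2 : (1 + 2 * t) ^+ 2 <= 1 + eps / 8 by clear -e1 t0 te; nra.
have ce : c ^+ 2 * sg <= 1 - eps by apply: le_trans csg _; clear -e0 e1; nra.
have q1 : c ^+ 2 * u + be / 2 * (c ^+ 2 * sg) <= be / 2 * (eps / 8 + (1 - eps)).
  have : be / 2 * (c ^+ 2 * sg) <= be / 2 * (1 - eps) by rewrite ler_pM2l // divr_gt0.
  clear -ccu u2; lra.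
have q2 : (c ^+ 2 * u + be / 2 * (c ^+ 2 * sg)) * (1 + 2 * t) ^+ 2 <=
    be / 2 * (eps / 8 + (1 - eps)) * (1 + eps / 8).
  apply: ler_pM => //; last by rewrite sqr_ge0.
  have be2 : 0 <= be / 2 by clear -be0; lra.
  exact: addr_ge0 (mulr_ge0 (sqr_ge0 _) (ltW u0)) (mulr_ge0 be2 (mulr_ge0 (sqr_ge0 _) sg0)).
have q3 : be / 2 * (eps / 8 + (1 - eps)) * (1 + eps / 8) <= be / 2 * (1 - eps / 2).
  by rewrite -mulrA ler_pM2l ?divr_gt0 //; clear -e0; nra.
clear -q2 q3; lra.
Qed.

Section Data.
Variables (p : nat) (N : R) (l : 'I_p -> R) (i1 : 'I_p) (a b0 eps xn Y : R).
Hypotheses (eps01 : 0 < eps < 1) (a0 : 0 < a) (lab : forall i, a <= l i <= b0).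
Hypotheses (N0 : 0 < N) (pY : p%:R <= Y * N) (xn0 : 0 < xn).
Hypotheses (lxn : forall i, i != i1 -> l i * xn < 1).
Hypothesis critE : \sum_(i | i != i1) (l i * xn / (1 - l i * xn)) ^+ 2 = N.
Hypothesis spike : (l i1)^-1 <= (1 - eps) * xn.

(* [hout (l i1)^-1] is the limiting position of the eigenvalue split off by the
   spike [l i1]; [hout] decreases up to the critical point [xn]. *)
Definition hout x : R := x^-1 + N^-1 * \sum_(i | i != i1) l i / (1 - l i * x).
Definition ratio x i : R := l i * x / (1 - l i * x).
Let xi := (l i1)^-1.

Let l0 i : 0 < l i. Proof. by apply: lt_le_trans a0 _; case/andP: (lab i). Qed.
Let xi0 : 0 < xi. Proof. by rewrite invr_gt0. Qed.

(** A single ratio at [xn] has no uniform bound, since [l i * xn] may be close to 1; a factor [k]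
    below, the bound [k / (1 - k)] is uniform, and the factor [k] carries over to the comparison
    with [ratio xn i]. *)
Lemma ratio_le (k x : R) i : 0 < k < 1 -> 0 < x -> x <= k * xn -> i != i1 ->
  [/\ 0 < l i * x <= k, 0 < ratio x i, ratio x i <= k / (1 - k) &
      ratio x i <= k * ratio xn i].
Proof.
move=> /andP[k0 k1] x0 xk ii; have lx := lxn ii.
have h1 : l i * x <= k * (l i * xn) by rewrite mulrCA ler_pM2l.
have h2 : 0 < l i * xn by rewrite mulr_gt0.
have h3 : k * (l i * xn) <= k by rewrite ler_piMr ?ltW.
have h4 : 0 < l i * x by rewrite mulr_gt0.
have h5 : 0 < 1 - l i * x by lra.
split; rewrite ?h4 /= /ratio.
- lra.
- by rewrite divr_gt0.
- rewrite ler_pdivrMr // mulrAC ler_pdivlMr ?subr_gt0 //; nra.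
rewrite ler_pdivrMr // mulrA mulrAC ler_pdivlMr ?subr_gt0 //.
have : 0 <= (k * (l i * xn) - l i * x) * 1 by rewrite mulr1 subr_ge0.
have : l i * x * (l i * xn) >= k * (l i * xn) * (l i * x) .
  rewrite (_ : k * _ * _ = k * (l i * x * (l i * xn))); last by ring.
  by rewrite ler_piMl ?(ltW k1) // mulr_ge0 ?(ltW h2) ?(ltW h4).
lra.
Qed.

Lemma sum_ratio_le (k x : R) : 0 < k < 1 -> 0 < x -> x <= k * xn ->
  N^-1 * \sum_(i | i != i1) ratio x i ^+ 2 <= k ^+ 2 /\
  0 <= N^-1 * \sum_(i | i != i1) ratio x i <= Y * (k / (1 - k)).
Proof.
move=> k01 x0 xk; have H i := ratio_le k01 x0 xk (i := i).
have k0 : 0 < k by case/andP: k01.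
have k1 : 0 < k / (1 - k) by case/andP: k01 => ? ?; rewrite divr_gt0 ?subr_gt0.
split.
  rewrite ler_pdivrMl // mulrC -critE mulr_sumr; apply: ler_sum => i ii.
  have [_ r0 _ rk] := H i ii; rewrite -exprMn ler_pXn2r ?nnegrE ?(ltW r0) //.
  by apply: le_trans rk; rewrite ltW.
apply/andP; split.
  rewrite mulr_ge0 ?invr_ge0 ?(ltW N0) // sumr_ge0 // => i ii.
  by have [_ r0 _ _] := H i ii; rewrite ltW.
rewrite ler_pdivrMl //; apply: le_trans (_ : \sum_(i | i != i1) (k / (1 - k)) <= _).
  by apply: ler_sum => i ii; have [_ _ ? _] := H i ii.
rewrite sumr_const -mulr_natl [leRHS]mulrA [N * Y]mulrC ler_pM2r //.
apply: le_trans pY; rewrite ler_nat -[leqRHS]card_ord; exact: max_card.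
Qed.

Lemma houtE (x : R) : 0 < x -> hout x = (1 + N^-1 * \sum_(i | i != i1) ratio x i) / x.
Proof.
move=> x0; rewrite /hout mulrDl mul1r -mulrA mulr_suml; congr (_ + _ * _).
by apply: eq_bigr => i _; rewrite /ratio mulrAC mulfK ?gt_eqF.
Qed.

(** By [critE] the derivative of [hout] vanishes at [xn]. Up to there the sum grows at rate at most
    [xn^-2], while the term [x^-1] falls by [(xi' - xi) / (xi * xi')]. Since
    [xi * xi' <= (1 - eps) * xn ^+ 2], a fraction [eps] of this fall survives, and the fall itself
    is [eps / (1 + eps) * l i1], at least [eps * a / 2]. *)
Lemma outlier_gap : eps ^+ 2 * a / 2 <= hout xi - hout ((1 + eps) * xi).
Proof.
have /andP[e0 e1] := eps01.
have [xi' xiE] : exists xi' : R, xi' = (1 + eps) * xi by exists ((1 + eps) * xi).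
have xi'0 : 0 < xi' by rewrite xiE mulr_gt0 //; lra.
have xixn : xi <= (1 - eps) * xn := spike.
have xixn1 : xi <= xn by have := xn0; nra.
have xi'xn : xi' <= (1 - eps ^+ 2) * xn.
  rewrite xiE (_ : 1 - eps ^+ 2 = (1 + eps) * (1 - eps)); last by ring.
  by rewrite -mulrA ler_pM2l //; lra.
have xi'xn1 : xi' <= xn.
  apply: le_trans xi'xn _; rewrite ler_piMl ?(ltW xn0) //; have := sqr_ge0 eps; lra.
rewrite -xiE /hout.
have dE : N^-1 * \sum_(i | i != i1) l i / (1 - l i * xi) -
    N^-1 * \sum_(i | i != i1) l i / (1 - l i * xi') >= - ((xi' - xi) / xn ^+ 2).
  rewrite -mulrBr -sumrB -[leLHS](mulKf (lt0r_neq0 N0)) ler_pM2l ?invr_gt0 //.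
  rewrite mulrN mulrC -critE mulr_sumr -sumrN; apply: ler_sum => i ii.
  have lx := lxn ii; have li := l0 i.
  have h1 : 0 < 1 - l i * xn by lra.
  have h2 : 1 - l i * xn <= 1 - l i * xi by rewrite lerD2l lerN2 ler_pM2l.
  have h3 : 1 - l i * xn <= 1 - l i * xi' by rewrite lerD2l lerN2 ler_pM2l.
  have h2' := lt_le_trans h1 h2; have h3' := lt_le_trans h1 h3.
  have -> : l i / (1 - l i * xi) - l i / (1 - l i * xi') =
    - ((xi' - xi) * (l i ^+ 2 / ((1 - l i * xi) * (1 - l i * xi')))).
    by field; rewrite !gt_eqF.
  rewrite lerN2.
  have -> : (xi' - xi) / xn ^+ 2 * (l i * xn / (1 - l i * xn)) ^+ 2 =
     (xi' - xi) * (l i ^+ 2 / ((1 - l i * xn) * (1 - l i * xn))).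
    by field; rewrite !gt_eqF.
  apply: ler_wpM2l; first by rewrite xiE; have := xi0; nra.
  apply: ler_wpM2l; first exact: sqr_ge0.
  rewrite lef_pV2 ?posrE ?mulr_gt0 //; apply: ler_pM => //; exact: ltW.
have main : xi^-1 - xi'^-1 - (xi' - xi) / xn ^+ 2 >= eps ^+ 2 * a / 2.
  have -> : xi^-1 - xi'^-1 - (xi' - xi) / xn ^+ 2 =
     (xi' - xi) / (xi * xi') * (1 - xi * xi' / xn ^+ 2).
    by field; rewrite !gt_eqF.
  have q : xi * xi' / xn ^+ 2 <= 1 - eps.
    rewrite ler_pdivrMr ?exprn_gt0 //.
    apply: le_trans (_ : (1 - eps) * xn * xn <= _); last by rewrite expr2 mulrA.
    by apply: ler_pM => //; exact: ltW.
  have -> : (xi' - xi) / (xi * xi') = eps / (1 + eps) * l i1.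
    by rewrite xiE /xi; field; rewrite !gt_eqF //; have := l0 i1; lra.
  have la : a <= l i1 by case/andP: (lab i1).
  have h1 : eps / 2 <= eps / (1 + eps) by rewrite ler_pM2l // lef_pV2 ?posrE //; lra.
  apply: le_trans (_ : eps / 2 * a * eps <= _); first by rewrite expr2; lra.
  apply: ler_pM; [|exact: ltW| |lra].
    by rewrite mulr_ge0 ?divr_ge0 ?(ltW e0) ?(ltW a0).
  by apply: ler_pM => //; [rewrite divr_ge0 ?(ltW e0)|exact: ltW].
move: dE main; move: (N^-1 * _) (N^-1 * _) => s1 s2; lra.
Qed.

End Data.
End Outlier.

Lemma inv_shift_bounds {R : realType} (v be : R) : 0 < v -> 0 < be ->
  (v^-1 + be)^-1 <= v /\ v - be * v ^+ 2 <= (v^-1 + be)^-1 /\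
  (v^-1 + be / 2)^-1 - (v^-1 + be)^-1 <= be / 2 * v ^+ 2.
Proof.
move=> v0 be0.
have E g : 0 < g -> (v^-1 + g)^-1 = v / (1 + g * v).
  by move=> g0; rewrite -invf_div mulrDl mul1r mulfK ?gt_eqF.
have be2 : 0 < be / 2 by lra.
have h1 : 0 < be * v by exact: mulr_gt0.
have h2 : 0 < be / 2 * v by exact: mulr_gt0.
rewrite !E //; split; [|split].
- by rewrite ler_pdivrMr; [rewrite ler_peMr ?(ltW v0) // lerDl ltW|lra].
- rewrite ler_pdivlMr; last lra.
  rewrite -subr_ge0 (_ : _ - _ = be ^+ 2 * v ^+ 3); last by ring.
  by rewrite mulr_ge0 ?exprn_ge0 ?(ltW be0) ?(ltW v0).
have -> : v / (1 + be / 2 * v) - v / (1 + be * v) =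
    be / 2 * v ^+ 2 * ((1 + be / 2 * v)^-1 * (1 + be * v)^-1).
  by field; rewrite !gt_eqF //; lra.
apply: ler_piMr; first exact: mulr_ge0 (ltW be2) (sqr_ge0 v).
apply: mulr_ile1; rewrite ?invr_ge0 ?invf_le1; lra.
Qed.

Lemma outlier_lower {R : realType} {d} {T : measurableType d}
    (P : probability T R) (x : nat * nat -> {RV P >-> R})
    (a b0 eps Y rho : R) :
  standard_array x -> 0 < eps < 1 -> 0 < a -> 0 < b0 -> 0 <= Y -> 0 < rho ->
  exists N0 : nat, forall (n p : nat) (Q : 'M[R]_p)
    (l : 'I_p -> R) (i1 : 'I_p) (xn : R),
  (N0 <= n)%N -> Q *m Q^T = 1%:M -> (forall i, a <= l i <= b0) ->
  p%:R <= Y * n%:R -> 0 < xn -> (forall i, i != i1 -> l i * xn < 1) ->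
  \sum_(i | i != i1) (l i * xn / (1 - l i * xn)) ^+ 2 = n%:R ->
  (l i1)^-1 <= (1 - eps) * xn ->
  exists G : set T, [/\ measurable G, 1 - rho <= Ex P \1_G &
    forall w, G w -> forall t : R,
      (forall u, n%:R^-1 * \sum_(i < n) dot u (xrow x p i w) ^+ 2 <=
         t * dot (u *m sfun Q (fun i => (l i)^-1)) u) ->
      hout n%:R l i1 (l i1)^-1 - eps ^+ 2 * a / 6 < t].
Proof.
move=> sx /[dup] eps01 /andP[e0 e1] a0 b00 Y0 rho0.
have [small smallE] : exists small : R, small = eps ^+ 2 * a / 6 by exists (eps ^+ 2 * a / 6).
have small0 : 0 < small by rewrite smallE divr_gt0 // mulr_gt0 // exprn_gt0.
rewrite -smallE.
(* Replacing [h] by a [t] that is lower by [small] lowers every [h / l i] by at least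
   [small / b0]. *)
have [b bE] : exists b : R, b = small / b0 by exists (small / b0).
have bp : 0 < b by rewrite bE divr_gt0.
(* [be] is the eigenvalue of [D] in the spike direction. With [s = (2 * be)^-1] the conclusion of
   [spike_bound] would read [b / (2 * be) <= 1], whereas [b = 4 * be] makes the left-hand side 2. *)
have [be beE] : exists be : R, be = b / 4 by exists (b / 4).
have be0 : 0 < be by rewrite beE divr_gt0.
have [cm cmE] : exists cm : R, cm = 1 + Y * ((1 - eps) / (1 - (1 - eps))).
  by exists (1 + Y * ((1 - eps) / (1 - (1 - eps)))).
have cm1 : 1 <= cm.
  rewrite cmE lerDl mulr_ge0 // divr_ge0 //; clear -eps01; lra.
have cm0 : 0 < cm by lra.
have kap0 : 0 < be * eps / 8 by rewrite divr_gt0 // mulr_gt0.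
have s0 : 0 < (2 * be)^-1 by rewrite invr_gt0 mulr_gt0.
have icm : 0 < (2 * cm)^-1 <= 1 / 2.
  by rewrite invr_gt0 mulr_gt0 //= invfM mul1r mulrC ler_piMl // invf_ple ?posrE // invr1.
(* The traces are [1 - c^-1] up to small terms, with [c <= cm]; half of the margin [cm^-1] is
   reserved for these. *)
have M1 : 0 <= 1 - (2 * cm)^-1 < 1 by case/andP: icm => ic0 ic1; apply/andP; split; clear -ic0 ic1; lra.
have [Nb spk] := spike_bound sx Y0 M1 kap0 rho0 s0.
have [tau [tau0 tau1 tau2]] : exists tau : R, [/\ 0 < tau, tau <= eps / (192 * cm) &
    tau <= be * eps / (16 * cm ^+ 2)].
  exists (Num.min (eps / (192 * cm)) (be * eps / (16 * cm ^+ 2))).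
  have c2 : 0 < cm ^+ 2 by exact: exprn_gt0.
  have q : 0 < 16 * cm ^+ 2 by exact: mulr_gt0.
  by rewrite lt_min !ge_min !lexx orbT !divr_gt0 ?mulr_gt0.
have [N1 hN1] : exists N1 : nat, (tau * be)^-1 < N1%:R.
  exists (Num.bound (tau * be)^-1).
  by apply: archi_boundP; rewrite invr_ge0 mulr_ge0 ?(ltW tau0) ?(ltW be0).
exists (maxn 1 (maxn Nb N1)) => n p Q l i1 xn.
rewrite !geq_max => /and3P[n0 nb n1] OQ lab pY xn0 lxn critE spike.
have N0 : 0 < n%:R :> R by rewrite ltr0n.
have l0 i : 0 < l i by apply: lt_le_trans a0 _; case/andP: (lab i).
have [xi xiE] : exists xi : R, xi = (l i1)^-1 by exists (l i1)^-1.
have xi0 : 0 < xi by rewrite xiE invr_gt0.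
have lxi : l i1 * xi = 1 by rewrite xiE mulfV // gt_eqF.
have k01 : 0 < 1 - eps < 1 by clear -e0 e1; apply/andP; split; lra.
rewrite -xiE in spike.
have [sq /andP[S0 S1]] := sum_ratio_le a0 lab N0 pY xn0 lxn critE k01 xi0 spike.
have hE := houtE n%:R l i1 xi0.
have rat i := ratio_le a0 lab xn0 lxn k01 xi0 spike (i := i).
have [c cE] : exists c : R, c = 1 + n%:R^-1 * \sum_(i | i != i1) ratio l xi i.
  by exists (1 + n%:R^-1 * \sum_(i | i != i1) ratio l xi i).
rewrite -cE in hE.
have c1 : 1 <= c <= cm by rewrite cE cmE lerDl S0 lerD2l.
have cp : 0 < c by clear -c1; case/andP: c1 => ? _; lra.
pose v i := ratio l xi i / c.
pose h := hout n%:R l i1 xi.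
(* The eigenvalues of [h Sigma^-1 - c + be]. At the spike [h / l i1 = c], so [be] remains; elsewhere
   they are [(v i)^-1 + be], and the normalized sum of the [v i] is exactly [1 - c^-1]. *)
pose dD i := h / l i - c + be.
have v0 i : i != i1 -> 0 < v i by move=> /rat[_ ? _ _]; rewrite divr_gt0.
have dD1 : dD i1 = be.
  by rewrite /dD /h hE -mulrA -invfM mulrC [xi * _]mulrC lxi invr1 mul1r subrr add0r.
have dDi i : i != i1 -> dD i = (v i)^-1 + be.
  move=> ii; have [/andP[h1 h2] _ _ _] := rat i ii.
  have h3 : 0 < 1 - l i * xi by clear -e0 h2; lra.
  by rewrite /dD /h hE /v /ratio; field; rewrite !gt_eqF.
have trf del : - be < del -> posdef (sfun Q (fun i => dD i + del)) /\
    \tr (invmx (sfun Q (fun i => dD i + del))) =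
    (be + del)^-1 + \sum_(i | i != i1) ((v i)^-1 + (be + del))^-1.
  move=> hd; have f0 i : 0 < dD i + del.
    have bd : 0 < be + del by rewrite addrC -[be]opprK subr_gt0.
    have [->|ii] := eqVneq i i1; first by rewrite dD1.
    by rewrite dDi // -addrA addr_gt0 // invr_gt0 v0.
  split; first exact: sfun_posdef.
  have [|_ ->] := sfun_inv OQ (f := fun i => dD i + del); first by move=> i; rewrite gt_eqF.
  rewrite mxtrace_sfun // (bigD1 i1) //= dD1; congr (_ + _).
  by apply: eq_bigr => i ii; rewrite dDi // addrA.
pose D := sfun Q dD.
have DE0 : D = sfun Q (fun i => dD i + 0) by rewrite /D; congr (sfun Q _); apply/funext => i; rewrite addr0.
have DgE : D - (be / 2)%:M = sfun Q (fun i => dD i + - (be / 2)).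
  by rewrite -raddfN /= -(sfun_scalar OQ) (sfunD Q).
have [|pD trD] := trf 0; first by rewrite oppr_lt0.
have [|pDg trDg] := trf (- (be / 2)); first by clear -be0; lra.
rewrite -DE0 addr0 in pD trD; rewrite -DgE in pDg trDg.
have hbe : be + - (be / 2) = be / 2 by clear; lra.
rewrite hbe in trDg.
pose m0 := \tr (invmx D) / n%:R; pose m1 := \tr (invmx (D - (be / 2)%:M)) / n%:R.
pose A : R := 1 - c^-1; pose sg : R := n%:R^-1 * \sum_(i | i != i1) v i ^+ 2.
have iN : 0 < n%:R^-1 :> R by rewrite invr_gt0.
have AE : A = n%:R^-1 * \sum_(i | i != i1) v i.
  have SE : n%:R^-1 * \sum_(i | i != i1) ratio l xi i = c - 1 by rewrite cE addrC addKr.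
  by rewrite /v -mulr_suml mulrA SE mulrBl mulfV ?gt_eqF // mul1r.
have sgE : c ^+ 2 * sg = n%:R^-1 * \sum_(i | i != i1) ratio l xi i ^+ 2.
  rewrite /sg mulrCA mulr_sumr; congr (_ * _); apply: eq_bigr => i _.
  by rewrite /v expr_div_n mulrC divfK // gt_eqF ?exprn_gt0.
have sg0 : 0 <= sg by rewrite mulr_ge0 ?(ltW iN) // sumr_ge0 // => i _; exact: sqr_ge0.
have vle g i (g0 : 0 < g) (ii : i != i1) := proj1 (inv_shift_bounds (v0 i ii) g0).
have vge i (ii : i != i1) := proj1 (proj2 (inv_shift_bounds (v0 i ii) be0)).
have vd i (ii : i != i1) := proj2 (proj2 (inv_shift_bounds (v0 i ii) be0)).
have NbE : (n%:R * be)^-1 = n%:R^-1 * be^-1 by rewrite invfM.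
have m0A : m0 <= A + (n%:R * be)^-1.
  rewrite /m0 trD mulrC mulrDr addrC AE NbE lerD2r ler_pM2l //.
  by apply: ler_sum => i ii; exact: vle.
have m1A : m1 <= A + 2 * (n%:R * be)^-1.
  rewrite /m1 trDg mulrC mulrDr addrC AE NbE; apply: lerD.
    by rewrite ler_pM2l //; apply: ler_sum => i ii; apply: vle => //; rewrite divr_gt0.
  by rewrite invf_div mulrA le_eqVlt mulrCA mulrA eqxx.
have m10 : m1 - m0 <= (n%:R * be)^-1 + be / 2 * sg.
  rewrite /m1 /m0 trD trDg -mulrBl opprD addrACA mulrDl NbE; apply: lerD.
    by rewrite le_eqVlt invf_div; apply/orP; left; apply/eqP; field; rewrite !gt_eqF.
  rewrite -sumrB mulrC /sg mulrCA ler_pM2l // mulr_sumr; apply: ler_sum => i ii.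
  exact: vd.
have m0ge : A - be * sg <= m0.
  have -> : m0 = n%:R^-1 * be^-1 + n%:R^-1 * \sum_(i | i != i1) ((v i)^-1 + be)^-1.
    by rewrite /m0 trD mulrC mulrDr.
  rewrite AE /sg mulrCA -mulrBr.
  apply: le_trans (_ : n%:R^-1 * \sum_(i | i != i1) ((v i)^-1 + be)^-1 <= _); last first.
    by rewrite lerDr mulr_ge0 ?(ltW iN) // invr_ge0 ltW.
  by rewrite ler_pM2l // mulr_sumr -sumrB; apply: ler_sum => i ii; exact: vge.
have u_tau : (n%:R * be)^-1 <= tau.
  have h1 : (tau * be)^-1 <= n%:R by apply: le_trans (ltW hN1) _; rewrite ler_nat.
  rewrite -[leRHS]invrK lef_pV2 ?posrE ?invr_gt0 ?mulr_gt0 //.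
  by rewrite -ler_pdivrMr // -invfM.
have csg : c ^+ 2 * sg <= (1 - eps) ^+ 2 by rewrite sgE.
have [m0M m1M gap] := spike_gap eps01 be0 c1 N0 erefl (le_trans u_tau tau1)
  (le_trans u_tau tau2) m0A m1A m10 sg0 csg.
have e11 : dot (row i1 Q) (row i1 Q) = 1 by rewrite dot_row_orth // eqxx.
have trDgm : \tr (invmx (D - (be / 2)%:M)) <= m1 * n%:R by rewrite /m1 divfK ?gt_eqF.
have kg : 2 * (be * eps / 8) <= be / 2.
  have : be * eps <= be by rewrite ler_piMr ?(ltW e1) ?(ltW be0).
  by clear -be0; lra.
have [G [mG PG GH]] := spk n p D (row i1 Q) (be / 2) m0 m1 nb pY pD pDg e11 erefl
  trDgm m0M m1M kg gap.
exists G; split => // w Gw t Ht; rewrite -xiE -/h ltNge; apply/negP => th.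
have m0p : 0 < 1 - m0 by clear -icm m0M; case/andP: icm => ? ?; lra.
(* The lift by [be] costs at most [be] in [(1 - m0)^-1], again because [c ^+ 2 * sg <= 1]. *)
have c0ge : c - be <= (1 - m0)^-1.
  have [cb|cb] := leP (c - be) 0; first by apply: le_trans cb _; rewrite invr_ge0 ltW.
  rewrite -[leRHS]mul1r ler_pdivlMr //.
  apply: le_trans (_ : (c - be) * (c^-1 + be * sg) <= _).
    by rewrite ler_pM2l //; rewrite /A in m0ge; clear -m0ge; lra.
  have sg1 : c ^+ 2 * sg <= 1.
    apply: le_trans csg _; rewrite -[leRHS](expr1n _ 2) ler_pXn2r ?nnegrE ?subr_ge0 ?(ltW e1) //.
    by rewrite gerBl ltW.
  rewrite -subr_ge0.
  have -> : 1 - (c - be) * (c^-1 + be * sg) = be / c * (1 - c ^+ 2 * sg) + be ^+ 2 * sg.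
    by field; rewrite gt_eqF.
  apply: addr_ge0; last exact: mulr_ge0 (sqr_ge0 _) sg0.
  by apply: mulr_ge0; [exact: divr_ge0 (ltW be0) (ltW cp)|rewrite subr_ge0].
have := GH w Gw b bp; have -> : dot (row i1 Q *m invmx D) (row i1 Q) = be^-1.
  rewrite DE0; have [|_ ->] := sfun_inv OQ (f := fun i => dD i + 0).
    move=> i; rewrite addr0 gt_eqF //; have [->|ii] := eqVneq i i1; first by rewrite dD1.
    by rewrite dDi // addr_gt0 // invr_gt0 v0.
  by rewrite row_sfun // dotZl e11 mulr1 dD1 addr0.
suff Hu : forall u, n%:R^-1 * \sum_(i < n) dot u (xrow x p i w) ^+ 2 <=
    dot (u *m D) u + ((1 - m0)^-1 - b) * dot u u.
  move=> /(_ Hu); have -> : b * (be^-1 - (2 * be)^-1) = 2.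
    by rewrite beE; field; rewrite gt_eqF.
  by rewrite -subr_ge0 -opprB oppr_ge0 (_ : 2 - 1 = 1 :> R) ?ler10 //; ring.
move=> u; apply: le_trans (Ht u) _.
rewrite /D (dot_coord OQ u) !(dot_sfun Q) !mulr_sumr -big_split /=.
apply: ler_sum => i _; rewrite mulrA -mulrDl ler_wpM2r ?sqr_ge0 //.
have lb : b <= (h - t) / l i.
  rewrite bE ler_pdivlMr // mulrAC ler_pdivrMr //.
  apply: ler_pM; rewrite ?(ltW small0) ?(ltW (l0 i)) //; last by case/andP: (lab i).
  by clear -th; lra.
by rewrite /dD; move: lb; rewrite mulrBl; move: (h / _) (t / _) => z1 z2; clear -c0ge; lra.
Qed.

(** Off the spike direction [hout x / l i - c] is positive for every subcritical [x], so each such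
    [x] yields an upper estimate by [hout x]. The point [(1 + eps) * (l i1)^-1] is a fixed factor
    beyond the spike and still below [(1 - eps ^+ 2) * xn]. *)
Lemma outlier_upper {R : realType} {d} {T : measurableType d}
    (P : probability T R) (x : nat * nat -> {RV P >-> R})
    (a b0 eps Y rho : R) :
  standard_array x -> 0 < eps < 1 -> 0 < a -> 0 < b0 -> 0 <= Y -> 0 < rho ->
  exists N0 : nat, forall (n p : nat) (Q : 'M[R]_p)
    (l : 'I_p -> R) (i1 : 'I_p) (xn : R),
  (N0 <= n)%N -> Q *m Q^T = 1%:M -> (forall i, a <= l i <= b0) ->
  p%:R <= Y * n%:R -> 0 < xn -> (forall i, i != i1 -> l i * xn < 1) ->
  \sum_(i | i != i1) (l i * xn / (1 - l i * xn)) ^+ 2 = n%:R ->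
  (l i1)^-1 <= (1 - eps) * xn ->
  exists G : set T, [/\ measurable G, 1 - rho <= Ex P \1_G &
    forall w, G w -> forall u, (u *m Q^T) 0 i1 = 0 ->
      n%:R^-1 * \sum_(i < n) dot u (xrow x p i w) ^+ 2 <=
      hout n%:R l i1 ((1 + eps) * (l i1)^-1) * dot (u *m sfun Q (fun i => (l i)^-1)) u +
      eps ^+ 2 * a / 6 / b0 * dot u u].
Proof.
move=> sx /[dup] eps01 /andP[e0 e1] a0 b00 Y0 rho0.
have [small smallE] : exists small : R, small = eps ^+ 2 * a / 6 by exists (eps ^+ 2 * a / 6).
have small0 : 0 < small by rewrite smallE divr_gt0 // mulr_gt0 // exprn_gt0.
rewrite -smallE.
have [b bE] : exists b : R, b = small / b0 by exists (small / b0).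
have bp : 0 < b by rewrite bE divr_gt0.
have e2 : 0 < 1 - eps ^+ 2 < 1.
  by rewrite subr_gt0 expr_lt1 ?(ltW e0) // e1 gtrBl exprn_gt0.
have [k kE] : exists k : R, k = 1 - eps ^+ 2 by exists (1 - eps ^+ 2).
rewrite -kE in e2; have /andP[k0 k1] := e2.
have [cm cmE] : exists cm : R, cm = 1 + Y * (k / (1 - k)) by exists (1 + Y * (k / (1 - k))).
have cm1 : 1 <= cm by rewrite cmE lerDl mulr_ge0 // divr_ge0 //; clear -e2; lra.
have cm0 : 0 < cm by lra.
have icm : 0 < (2 * cm)^-1 <= 1 / 2.
  by rewrite invr_gt0 mulr_gt0 //= invfM mul1r mulrC ler_piMl // invf_ple ?posrE // invr1.
have M1 : 0 <= 1 - (2 * cm)^-1 < 1 by case/andP: icm => ic0 ic1; apply/andP; split; clear -ic0 ic1; lra.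
have b2 : 0 < b / 2 by rewrite divr_gt0.
have [Nb upp] := upper_bound sx M1 b2 rho0.
(* The first summand makes the contribution [n^-1] to [m0] at most [(2 * cm)^-1]; the second makes
   [c^2 / (n - c)], the excess of [(1 - m0)^-1] over [c], at most [b / 2]. *)
have [N1 hN1] : exists N1 : nat, 2 * cm + 4 * cm ^+ 2 / b < N1%:R.
  exists (Num.bound (2 * cm + 4 * cm ^+ 2 / b)); apply: archi_boundP.
  by rewrite addr_ge0 ?divr_ge0 ?mulr_ge0 ?sqr_ge0 ?(ltW cm0) ?(ltW bp).
exists (maxn 1 (maxn Nb N1)) => n p Q l i1 xn.
rewrite !geq_max => /and3P[n0 nb n1] OQ lab pY xn0 lxn critE spike.
have N0 : 0 < n%:R :> R by rewrite ltr0n.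
have l0 i : 0 < l i by apply: lt_le_trans a0 _; case/andP: (lab i).
have [xi xiE] : exists xi : R, xi = (1 + eps) * (l i1)^-1 by exists ((1 + eps) * (l i1)^-1).
have xi0 : 0 < xi by rewrite xiE mulr_gt0 ?invr_gt0 //; clear -eps01; lra.
have xik : xi <= k * xn.
  rewrite xiE kE (_ : 1 - eps ^+ 2 = (1 + eps) * (1 - eps)); last by ring.
  by rewrite -mulrA ler_pM2l //; clear -eps01; lra.
rewrite -xiE.
have [_ /andP[S0 S1]] := sum_ratio_le a0 lab N0 pY xn0 lxn critE e2 xi0 xik.
have hE := houtE n%:R l i1 xi0.
have rat i := ratio_le a0 lab xn0 lxn e2 xi0 xik (i := i).
have [c cE] : exists c : R, c = 1 + n%:R^-1 * \sum_(i | i != i1) ratio l xi i.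
  by exists (1 + n%:R^-1 * \sum_(i | i != i1) ratio l xi i).
rewrite -cE in hE.
have c1 : 1 <= c by rewrite cE lerDl.
have ccm : c <= cm by rewrite cE cmE lerD2l.
have cp : 0 < c by clear -S0 cE; lra.
pose h := hout n%:R l i1 xi.
(* The vectors [u] considered have no spike component, so the value at [i1] only has to be positive;
   1 adds just [n^-1] to the normalized trace. *)
pose dD i := if i == i1 then 1 else h / l i - c.
have dDi i : i != i1 -> dD i = c / ratio l xi i /\ 0 < ratio l xi i.
  move=> ii; have [/andP[h1 h2] r0 _ _] := rat i ii; split => //.
  have h3 : 0 < 1 - l i * xi by clear -k1 h2; lra.
  by rewrite /dD (negPf ii) /h hE /ratio; field; rewrite !gt_eqF.
have f0 i : 0 < dD i.
  have [->|ii] := eqVneq i i1; first by rewrite /dD eqxx.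
  by have [-> r0] := dDi i ii; rewrite divr_gt0.
have pD : posdef (sfun Q dD) by exact: sfun_posdef.
have SE : n%:R^-1 * \sum_(i | i != i1) ratio l xi i = c - 1 by rewrite cE addrC addKr.
pose m0 : R := n%:R^-1 + (1 - c^-1).
have trD : \tr (invmx (sfun Q dD)) = m0 * n%:R.
  have [|_ ->] := sfun_inv OQ (f := dD); first by move=> i; rewrite gt_eqF.
  rewrite mxtrace_sfun // (bigD1 i1) //= {1}/dD eqxx invr1 /m0 mulrDl mulVf ?gt_eqF //.
  congr (_ + _); transitivity (\sum_(i | i != i1) ratio l xi i / c).
    by apply: eq_bigr => i ii; have [-> r0] := dDi i ii; rewrite invf_div.
  rewrite -mulr_suml -[\sum_(i | _) _](mulVKf (lt0r_neq0 N0)) SE.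
  by field; rewrite gt_eqF.
have nb1 : 2 * cm + 4 * cm ^+ 2 / b <= n%:R.
  by apply: le_trans (ltW hN1) _; rewrite ler_nat.
have q0 : 0 <= 4 * cm ^+ 2 / b by exact: divr_ge0 (mulr_ge0 (ler0n _ 4) (sqr_ge0 cm)) (ltW bp).
have ncm : 2 * cm <= n%:R by clear -nb1 q0; lra.
have nbc : 4 * cm ^+ 2 <= n%:R * b.
  by rewrite -ler_pdivrMr //; clear -nb1 cm0; lra.
have m0M : m0 <= 1 - (2 * cm)^-1.
  have h1 : n%:R^-1 <= (2 * cm)^-1 by rewrite lef_pV2 ?posrE // mulr_gt0.
  have h2 : cm^-1 <= c^-1 by rewrite lef_pV2.
  have h3 : (2 * cm)^-1 = cm^-1 / 2 by rewrite invfM mulrC.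
  by rewrite /m0; clear -h1 h2 h3; lra.
have trDle : \tr (invmx (sfun Q dD)) <= m0 * n%:R by rewrite trD.
have [G [mG PG GH]] := upp n p (sfun Q dD) m0 nb pD trDle m0M.
exists G; split => // w Gw u u1; apply: le_trans (GH w Gw u) _.
rewrite -bE.
have c0le : (1 - m0)^-1 <= c + b / 2.
  have nc : 0 < n%:R - c by clear -ncm ccm cm0; lra.
  have -> : (1 - m0)^-1 = c + c ^+ 2 / (n%:R - c).
    by rewrite /m0; field; rewrite !gt_eqF.
  rewrite lerD2l ler_pdivrMr //.
  have h1 : c ^+ 2 <= cm ^+ 2 by rewrite ler_pXn2r ?nnegrE ?(ltW cp) ?(ltW cm0).
  have h2 : n%:R / 2 <= n%:R - c by clear -ncm ccm; lra.
  have h3 : b / 2 * (n%:R / 2) <= b / 2 * (n%:R - c) by rewrite ler_pM2l.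
  by clear -h1 h3 nbc; lra.
have DE : dot (u *m sfun Q dD) u = h * dot (u *m sfun Q (fun i => (l i)^-1)) u - c * dot u u.
  rewrite (dot_coord OQ u) !(dot_sfun Q) !mulr_sumr -sumrB; apply: eq_bigr => i _.
  have [->|ii] := eqVneq i i1; first by rewrite u1 expr0n /= !mulr0 subrr.
  by rewrite /dD (negPf ii); ring.
rewrite DE -/h; have := ler_wpM2r (dot_ge0 u) c0le.
move: (dot u u) (h * _) => z1 z2; clear; lra.
Qed.

(** A crude bound from a multiple of the identity as initial barrier, with [m0 = 1/2]. It bounds the
    top sample eigenvalue and through it the estimated scale. *)
Lemma bulk_upper {R : realType} {d} {T : measurableType d}
    (P : probability T R) (x : nat * nat -> {RV P >-> R})
    (Y rho : R) : standard_array x -> 0 <= Y -> 0 < rho ->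
  exists N0 : nat, forall n p : nat, (N0 <= n)%N -> p%:R <= Y * n%:R ->
  exists G : set T, [/\ measurable G, 1 - rho <= Ex P \1_G &
    forall w, G w -> forall u,
      n%:R^-1 * \sum_(i < n) dot u (xrow x p i w) ^+ 2 <= (2 * Y + 4) * dot u u].
Proof.
move=> sx Y0 rho0; have M1 : 0 <= (2^-1 : R) < 1 by apply/andP; split; lra.
have [N0 upp] := upper_bound sx M1 ltr01 rho0.
exists N0 => n p nN pY; have d0 : 0 < 2 * Y + 1 by lra.
have pD : posdef ((2 * Y + 1)%:M : 'M[R]_p).
  by split=> [|u u0]; rewrite ?tr_scalar_mx // dot_scalar mulr_gt0 // dot_gt0.
have trD : \tr (invmx ((2 * Y + 1)%:M : 'M[R]_p)) <= 2^-1 * n%:R.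
  rewrite invmx_scalar mxtrace_scalar -[_ *+ p]mulr_natl ler_pdivrMr //.
  by apply: le_trans pY _; rewrite -mulrA [n%:R * _]mulrC mulrA ler_wpM2r //; lra.
have [G [mG PG GH]] := upp n p _ _ nN pD trD (lexx _); exists G; split => // w Gw u.
apply: le_trans (GH w Gw u) _; rewrite dot_scalar -mulrDl.
have -> : (1 - 2^-1)^-1 = 2 :> R by field.
by rewrite ler_wpM2r ?dot_ge0 //; lra.
Qed.

(** * The test statistic *)

Section Empirical.
Context {R : realType}.
Implicit Types s : seq R.

Lemma empiricalE s (A : set R) :
  empirical s A = ((size s)%:R^-1 * \sum_(i < size s) \1_A s`_i)%:E.
Proof.
rewrite /empirical /mscale /= /mscale /= /msum /= EFinM; congr (_ * _)%E.
by rewrite -sumEFin; apply: eq_bigr => i _; rewrite diracE indicE.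
Qed.

Lemma empirical_integral s (f : R -> R) : measurable_fun setT f ->
  (\int[empirical s]_x f x)%R = (size s)%:R^-1 * \sum_(i < size s) f s`_i.
Proof.
move=> mf.
have ge0 (g : R -> \bar R) : measurable_fun setT g -> (forall x, 0 <= g x)%E ->
  (\int[empirical s]_x g x = ((size s)%:R^-1)%:E * \sum_(i < size s) g s`_i)%E.
  move=> mg g0; rewrite /empirical ge0_integral_mscale //=; congr (_ * _)%E.
  rewrite ge0_integral_measure_sum //; apply: eq_bigr => i _.
  by rewrite integral_dirac // diracT mul1e.
have mEf : measurable_fun setT (EFin \o f) by exact/measurable_EFinP.
rewrite /Rintegral integralE !ge0 //; first last.
- exact: measurable_funepos.
- exact: measurable_funeneg.
have -> : (\sum_(i < size s) (EFin \o f)^\+ s`_i = (\sum_(i < size s) Num.max (f s`_i) 0)%:E)%E.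
  by rewrite -sumEFin; apply: eq_bigr => i _; rewrite funeposE EFin_max.
have -> : (\sum_(i < size s) (EFin \o f)^\- s`_i = (\sum_(i < size s) Num.max (- f s`_i) 0)%:E)%E.
  by rewrite -sumEFin; apply: eq_bigr => i _; rewrite funenegE /= EFin_max.
rewrite -!EFinM -EFinB /= -mulrBr -sumrB; congr (_ * _); apply: eq_bigr => i _.
case: (leP 0 (f s`_i)) => f0; first by rewrite max_r ?oppr_le0 // subr0.
by rewrite max_l ?oppr_ge0 ?(ltW f0) // sub0r opprK.
Qed.

Section Quantile.
Variables (s : seq R) (u : R).
Hypothesis u01 : 0 < u <= 1.
Hypothesis s0 : (0 < size s)%N.
Let N := (size s)%:R : R.
Let N0 : 0 < N. Proof. by rewrite ltr0n. Qed.
Let A : set R := [set y | (u%:E <= empirical s `]-oo, y]%classic)%E].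

Lemma quantile_set y : A y <-> u <= N^-1 * \sum_(i < size s) (s`_i <= y)%R%:R.
Proof.
rewrite /A /= empiricalE lee_fin.
suff -> : \sum_(i < size s) \1_`]-oo, y] s`_i = \sum_(i < size s) (s`_i <= y)%R%:R :> R by [].
by apply: eq_bigr => i _; rewrite indicE mem_setE in_itv.
Qed.

Let sum_pos (b : 'I_(size s) -> bool) : u <= N^-1 * \sum_i (b i)%:R -> exists i, b i.
Proof.
case/andP: u01 => u0 _ H; apply/existsP; apply: contraT; rewrite negb_exists => /forallP nb.
by move: H; rewrite big1 ?mulr0 ?leNgt ?u0 // => i _; rewrite (negPf (nb i)).
Qed.

Lemma quantile_set_lb z : (forall i, (i < size s)%N -> z <= s`_i) -> lbound A z.
Proof.
move=> zs y /quantile_set /sum_pos[i iy]; exact: le_trans (zs i (ltn_ord i)) iy.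
Qed.

Lemma quantile_set_nonempty : A !=set0.
Proof.
pose m := \big[Num.max/0]_(i < size s) s`_i.
exists m; apply/quantile_set; rewrite (eq_bigr (fun=> 1)); last first.
  by move=> i _; rewrite (le_bigmax _ (fun i : 'I_(size s) => s`_i) i).
rewrite sumr_const card_ord mulVf ?gt_eqF //; by case/andP: u01.
Qed.

Lemma quantile_ge z : (forall i, (i < size s)%N -> z <= s`_i) -> z <= quantile (empirical s) u.
Proof.
by move=> zs; apply: lb_le_inf; [exact: quantile_set_nonempty|exact: quantile_set_lb].
Qed.

(** The measure is a finite sum of atoms, so the largest atom below [x] already lies in the set
    whose infimum is taken. The event becomes a condition on finitely many comparisons, which gives
    measurability. *)
Lemma quantile_lt x : quantile (empirical s) u < x <->
  u <= N^-1 * \sum_(i < size s) (s`_i < x)%R%:R.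
Proof.
have hlb : has_lbound A.
  exists (\big[Num.min/0]_(i < size s) s`_i); apply: quantile_set_lb => i si.
  exact: (bigmin_le _ (Ordinal si) (fun i : 'I_(size s) => s`_i)).
split=> [qx|H].
  have [y /quantile_set Ay yx] : exists2 y, A y & y < x.
    exact: inf_lt quantile_set_nonempty qx.
  apply: le_trans Ay _; rewrite ler_pM2l ?invr_gt0 //; apply: ler_sum => i _.
  rewrite ler_nat; case: (ltP s`_i x) => // xs; case: (leP s`_i y) => // sy.
  by have := le_lt_trans sy yx; rewrite ltNge xs.
have [i0 i0x] := sum_pos H.
pose j := [arg max_(i > i0 | s`_i < x) s`_i]%O.
have [jx jmax] : s`_j < x /\ forall i : 'I_(size s), s`_i < x -> s`_i <= s`_j.
  by rewrite /j; case: arg_maxP.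
apply: le_lt_trans jx; apply: ge_inf => //; apply/quantile_set; apply: le_trans H _.
rewrite ler_pM2l ?invr_gt0 //; apply: ler_sum => i _; rewrite ler_nat.
by case: (ltP s`_i x) => // /jmax ->.
Qed.

End Quantile.
End Empirical.

(** * Measurability of eigenvalues and of the statistic *)

Section StatisticMeasurability.
Context {R : realType} {d : measure_display} {T : measurableType d}.

Lemma measurable_fun_lt (f : T -> R) :
  (forall a, measurable [set w | f w < a]) -> measurable_fun setT f.
Proof.
move=> H; apply: (measurability (@RGenInftyO.G R)) => [|/= _ [_] [a] -> <-].
  exact: RGenInftyO.measurableE.
by rewrite setTI (_ : _ @^-1` _ = [set w | f w < a]).
Qed.

Lemma eigval_perturb n (M M' : 'M[R]_n) (r : R) j : M^T = M -> M'^T = M' ->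
  (0 < j <= n)%N -> (forall a b, `|M a b - M' a b| <= r) ->
  eigval M j <= eigval M' j + n%:R * r.
Proof.
move=> sM sM' jn H; apply: eigval_weyl => // u.
rewrite -lerBlDl -dotBl -mulmxBr dotE.
have E i : (u *m (M - M')) 0 i * u 0 i = \sum_j u 0 j * (M j i - M' j i) * u 0 i.
  by rewrite mxE mulr_suml; apply: eq_bigr => k _; rewrite !mxE.
under eq_bigr do rewrite E.
apply: le_trans (_ : \sum_i \sum_k r / 2 * (u 0 k ^+ 2 + u 0 i ^+ 2) <= _).
  apply: ler_sum => i _; apply: ler_sum => k _; apply: le_trans (ler_norm _) _.
  rewrite !normrM mulrAC; apply: le_trans (_ : `|u 0 k| * `|u 0 i| * r <= _).
    by rewrite ler_wpM2l // mulr_ge0.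
  have r0 : 0 <= r := le_trans (normr_ge0 _) (H k i).
  rewrite mulrAC mulrC -mulrA [r * _]mulrC mulrA.
  rewrite -subr_ge0 -[u 0 k ^+ 2]real_normK ?num_real // -[u 0 i ^+ 2]real_normK ?num_real //.
  rewrite (_ : _ - _ = r / 2 * (`|u 0 k| - `|u 0 i|) ^+ 2); last by field.
  by rewrite mulr_ge0 ?sqr_ge0 // divr_ge0.
rewrite le_eqVlt; apply/orP; left; apply/eqP.
under eq_bigr do rewrite -mulr_sumr big_split /= sumr_const card_ord.
rewrite -mulr_sumr big_split /= sumr_const card_ord.
have -> : \sum_i u 0 i ^+ 2 *+ n = (\sum_i u 0 i ^+ 2) *+ n by rewrite sumrMnl.
have -> : dot u u = \sum_i u 0 i ^+ 2 by rewrite dotE; apply: eq_bigr => i _; rewrite expr2.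
move: (\sum_i _) => z; have -> : z *+ n = n%:R * z by rewrite mulr_natl.
by move: (n%:R : R) => N; field.
Qed.

(** Eigenvalues are Lipschitz in the entries, so the event that one is below [a] is a countable
    union of entrywise boxes with rational centres and radii; [qs] symmetrizes the centres so that
    the perturbation bound applies. *)
Lemma measurable_eigval n (g : T -> 'M[R]_n) j : mxmeas g ->
  (forall w, (g w)^T = g w) -> measurable_fun setT (fun w => eigval (g w) j).
Proof.
move=> mg sg.
(* [eigval M 0] and [eigval M 1] are the same entry of the list. *)
wlog j0 : j / (0 < j)%N.
  by case: j => [|j] H; [apply: (H 1%N)|apply: H].
have [jn|nj] := leqP j n; last first.
  rewrite (_ : (fun w => _) = cst 0); first exact: measurable_cst.
  by apply/funext => w; rewrite eigval_out.
have j0n : (0 < j <= n)%N by rewrite j0.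
apply: measurable_fun_lt => a.
pose qs (q : 'M[rat]_n) : 'M[R]_n := \matrix_(i, k) ((ratr (q i k) + ratr (q k i)) / 2).
have sqs q : (qs q)^T = qs q by apply/matrixP => i k; rewrite !mxE addrC.
pose box (q : 'M[rat]_n * rat) : set T :=
  \bigcap_(ik in [set: 'I_n * 'I_n]) [set w | `|g w ik.1 ik.2 - qs q.1 ik.1 ik.2| <= ratr q.2].
pose F (q : 'M[rat]_n * rat) := [set w | eigval (qs q.1) j + n%:R * ratr q.2 < a /\ box q w].
rewrite (_ : [set w | _] = \bigcup_q F q).
  apply: countable_bigcupT_measurable; first exact: countableP.
  move=> q; rewrite /F; have [lt_a|nlt] := boolP (eigval (qs q.1) j + n%:R * ratr q.2 < a).
    rewrite (_ : [set w | _] = box q); last by apply/seteqP; split => [w []|w].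
    apply: fin_bigcap_measurable => // -[i k] _ /=.
    have : measurable_fun setT (fun w => `|g w i k - qs q.1 i k| <= ratr q.2).
      apply: measurable_fun_ler => //; apply: measurableT_comp => //.
      exact: measurable_funB.
    by move=> /(_ measurableT [set true]); rewrite setTI; apply.
  by rewrite (_ : [set w | _] = set0) //; apply/seteqP; split => [w []|w].
apply/seteqP; split => [w /= wa|w [q _ [qa bw]]]; last first.
  apply: le_lt_trans qa; apply: eigval_perturb => // i k.
  exact: (bw (i, k)).
have [r [r0 ra]] : exists r : rat, 0 < r /\ eigval (g w) j + n%:R * ratr r + n%:R * ratr r < a.
  have e0 : 0 < (a - eigval (g w) j) / (2 * n%:R + 1).
    by rewrite divr_gt0 ?subr_gt0 // ltr_wpDl // mulr_ge0.
  have [r /[!in_itv] /= /andP[r0 r1]] := rat_in_itvoo e0.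
  exists r; split; first by rewrite ltr0q in r0.
  have n2 : 0 < 2 * n%:R + 1 :> R by rewrite ltr_wpDl // mulr_ge0.
  move: r1; rewrite ltr_pdivlMr // => r1.
  move: r0 r1; move: (ratr r : R) (eigval (g w) j) => z e z0 z1.
  by rewrite -addrA -mulrDl; lra.
have r0' : 0 < ratr r :> R by rewrite ltr0q.
have /choice[q qP] : forall ik : 'I_n * 'I_n, exists q : rat, `|g w ik.1 ik.2 - ratr q| <= ratr r.
  move=> ik; have lt : g w ik.1 ik.2 - ratr r < g w ik.1 ik.2 + ratr r by lra.
  have [q /[!in_itv] /= /andP[h1 h2]] := rat_in_itvoo lt.
  by exists q; rewrite ler_norml; apply/andP; split; clear -h1 h2; lra.
exists (\matrix_(i, k) q (i, k), r) => //.
have near i k : `|g w i k - qs (\matrix_(i, k) q (i, k)) i k| <= ratr r.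
  rewrite !mxE.
  have gC : g w k i = g w i k by rewrite -{1}sg mxE.
  have := qP (i, k); have := qP (k, i); rewrite /= gC !ler_norml => /andP[h1 h2] /andP[h3 h4].
  by apply/andP; split; clear -h1 h2 h3 h4; lra.
split; last by move=> -[i k] _; exact: near.
apply: le_lt_trans ra; rewrite lerD2r; apply: eigval_perturb => // i k.
by rewrite distrC near.
Qed.

Lemma nth_map_enum n (f : 'I_n -> R) (i : 'I_n) : [seq f k | k <- enum 'I_n]`_i = f i.
Proof. by rewrite (nth_map i) ?size_enum_ord // nth_ord_enum. Qed.

Lemma quantile_enum_lt p (t : 'rV[R]_p) u x : (0 < p)%N -> 0 < u <= 1 ->
  quantile (empirical [seq t 0 i | i <- enum 'I_p]) u < x <->
  u <= p%:R^-1 * \sum_(i < p) (t 0 i < x)%R%:R.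
Proof.
move=> p0 u01; have sz : size [seq t 0 i | i <- enum 'I_p] = p.
  by rewrite size_map size_enum_ord.
have sE : \sum_(i < size [seq t 0 i | i <- enum 'I_p])
      ([seq t 0 i | i <- enum 'I_p]`_i < x)%R%:R = \sum_(i < p) (t 0 i < x)%R%:R :> R.
  rewrite sz; apply: eq_bigr => i _; by rewrite nth_map_enum.
have s0 := p0; rewrite -{1}sz in s0.
by have := quantile_lt u01 s0 x; rewrite sE sz.
Qed.

Lemma quantile_enum_ge0 p (t : 'rV[R]_p) u : (0 < p)%N -> 0 < u <= 1 ->
  (forall i, 0 <= t 0 i) -> 0 <= quantile (empirical [seq t 0 i | i <- enum 'I_p]) u.
Proof.
move=> p0 u01 t0; have sz : size [seq t 0 i | i <- enum 'I_p] = p.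
  by rewrite size_map size_enum_ord.
apply: quantile_ge => //; rewrite sz // => i ip.
by rewrite (nth_map_enum _ (Ordinal ip)).
Qed.

Lemma measurable_quantile p (t : T -> 'rV[R]_p) u : (0 < p)%N -> 0 < u <= 1 ->
  mxmeas t ->
  measurable_fun setT (fun w => quantile (empirical [seq t w 0 i | i <- enum 'I_p]) u).
Proof.
move=> p0 u01 mt; apply: measurable_fun_lt => a.
rewrite (_ : [set w | _] = [set w | u <= p%:R^-1 * \sum_(i < p) (t w 0 i < a)%R%:R]); last first.
  by apply/seteqP; split => w /=; [move/quantile_enum_lt; apply|move=> H; apply/quantile_enum_lt].
have : measurable_fun setT (fun w => u <= p%:R^-1 * \sum_(i < p) (t w 0 i < a)%R%:R).
  apply: measurable_fun_ler => //; apply: measurable_funM => //.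
  apply: measurable_sum => i.
  rewrite (_ : (fun w => _) = fun w => if t w 0 i < a then 1 else 0); last first.
    by apply/funext => w; case: (t w 0 i < a).
  by apply: measurable_fun_ifT => //; exact: measurable_fun_ltr.
by move=> /(_ measurableT [set true]); rewrite setTI; apply.
Qed.

Section Statistic.
Variables (n p : nat) (Y : T -> 'M[R]_(n, p)) (t : T -> 'rV[R]_p) (eps : R).
Hypotheses (mY : mxmeas Y) (mt : mxmeas t).

Lemma sample_cov_sym (X : 'M[R]_(n, p)) : (sample_cov X)^T = sample_cov X.
Proof. by rewrite /sample_cov linearZ /= trmx_mul trmxK. Qed.

Lemma companion_cov_sym (X : 'M[R]_(n, p)) : (companion_cov X)^T = companion_cov X.
Proof. by rewrite /companion_cov linearZ /= trmx_mul trmxK. Qed.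

Lemma measurable_sample_eigval j :
  measurable_fun setT (fun w => eigval (sample_cov (Y w)) j).
Proof.
apply: measurable_eigval => [|w]; last exact: sample_cov_sym.
by apply: mxmeasZ => //; apply: mxmeasM => //; exact: mxmeas_tr.
Qed.

Lemma measurable_companion_eigval j :
  measurable_fun setT (fun w => eigval (companion_cov (Y w)) j).
Proof.
apply: measurable_eigval => [|w]; last exact: companion_cov_sym.
by apply: mxmeasZ => //; apply: mxmeasM => //; exact: mxmeas_tr.
Qed.

Lemma measurable_trimmed (z : T -> R) : measurable_fun setT z ->
  measurable_fun setT (fun w => trimmed_stieltjes (Y w) (z w)).
Proof.
move=> mz; apply: measurable_funM => //; apply: measurable_sum => j.
by apply: measurable_funV; apply: measurable_funB => //; exact: measurable_companion_eigval.
Qed.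

Lemma measurable_xi_hat : measurable_fun setT (fun w => xi_hat (Y w)).
Proof.
have m j := measurable_sample_eigval j.
apply: measurable_fun_ifT; first exact: measurable_fun_ltr.
- by apply: measurableT_comp => //; exact: measurable_trimmed.
- apply: measurableT_comp => //; apply: measurable_trimmed; exact: measurable_funD.
Qed.

Definition tilde_eigenval (X : 'M[R]_(n, p)) (s : 'rV[R]_p) (i : 'I_p) : R :=
  Num.min (quantile (empirical [seq s 0 i | i <- enum 'I_p]) (i.+1%:R / p%:R))
    (xi_hat X * (1 + eps))^-1.

Lemma measurable_cube_ratio (z : R) :
  measurable_fun setT (fun l : R => (l * z / (1 - l * z)) ^+ 3).
Proof.
apply: measurable_funX; apply: measurable_funM; first exact: measurable_funM.
by apply: measurable_funV; apply: measurable_funB => //; exact: measurable_funM.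
Qed.

Lemma tilde_integral X s :
  (\int[empirical (tilde_eigenvals eps X s)]_l
    (l * xi_hat X / (1 - l * xi_hat X)) ^+ 3)%R =
  p%:R^-1 * \sum_(i < p) (tilde_eigenval X s i * xi_hat X /
     (1 - tilde_eigenval X s i * xi_hat X)) ^+ 3.
Proof.
rewrite empirical_integral; last exact: measurable_cube_ratio.
have sz : size (tilde_eigenvals eps X s) = p by rewrite size_map size_iota.
rewrite sz; congr (_ * _); apply: eq_bigr => i _.
by rewrite /tilde_eigenvals (nth_map 0%N) ?size_iota // nth_iota // add1n.
Qed.

Lemma ratio01 (i : 'I_p) : 0 < (i.+1%:R / p%:R : R) <= 1.
Proof.
have p0 : (0 < p)%N by exact: leq_ltn_trans (ltn_ord i).
by rewrite divr_gt0 ?ltr0n //= ler_pdivrMr ?ltr0n // mul1r ler_nat.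
Qed.

Lemma measurable_test_stat : measurable_fun setT (fun w => test_stat eps (Y w) (t w)).
Proof.
have mxi := measurable_xi_hat.
have mtl i : measurable_fun setT (fun w => tilde_eigenval (Y w) (t w) i).
  apply: measurable_minr.
    apply: measurable_quantile => //; last exact: ratio01.
    exact: leq_ltn_trans (ltn_ord i).
  by apply: measurable_funV; exact: measurable_funM.
apply: measurable_funM; last by apply: measurable_funB; exact: measurable_sample_eigval.
apply: measurable_funM => //; apply: measurable_funV; rewrite /sigma_hat.
under eq_fun do rewrite tilde_integral.
apply: (measurableT_comp (measurable_powR 3^-1)); apply: measurable_funM.
  by apply: measurable_funV; exact: measurable_funX.
apply: measurable_funD => //; apply: measurable_funM => //; apply: measurable_funM => //.
apply: measurable_sum => i; apply: measurable_funX; apply: measurable_funM.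
  exact: measurable_funM.
by apply: measurable_funV; apply: measurable_funB => //; exact: measurable_funM.
Qed.

End Statistic.
End StatisticMeasurability.

(** * Deterministic bounds on the statistic *)

Section TestStatistic.
Context {R : realType}.

Lemma dot_sample_cov n p (Y : 'M[R]_(n, p)) v :
  dot (v *m sample_cov Y) v = n%:R^-1 * dot (v *m Y^T) (v *m Y^T).
Proof.
by rewrite /sample_cov -scalemxAr dotZl mulmxA [in LHS]dot_mull.
Qed.

Lemma dot_companion_cov n p (Y : 'M[R]_(n, p)) u :
  dot (u *m companion_cov Y) u = n%:R^-1 * dot (u *m Y) (u *m Y).
Proof.
by rewrite /companion_cov -scalemxAr dotZl mulmxA [in LHS]dot_mull trmxK.
Qed.

Lemma sample_eigval_ge0 n p (Y : 'M[R]_(n, p)) j : 0 <= eigval (sample_cov Y) j.+1.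
Proof.
apply: eigval_ge0 => [|u]; first exact: sample_cov_sym.
by rewrite dot_sample_cov mulr_ge0 ?dot_ge0.
Qed.

Lemma companion_eigval_ge0 n p (Y : 'M[R]_(n, p)) j : 0 <= eigval (companion_cov Y) j.+1.
Proof.
apply: eigval_ge0 => [|u]; first exact: companion_cov_sym.
by rewrite dot_companion_cov mulr_ge0 ?dot_ge0.
Qed.

(** Courant-Fischer for the companion on those [u] for which [v = u *m Y] is orthogonal to the top
    eigenvector of the sample covariance. Cauchy-Schwarz bounds [dot v v ^+ 2] by [dot u u] times
    the squared length of [v *m Y^T], in which the second eigenvalue enters, and one factor
    [dot v v] cancels. *)
Lemma companion_eigval2_le n p (Y : 'M[R]_(n, p)) : (1 < n)%N -> (1 < p)%N ->
  eigval (companion_cov Y) 2 <= eigval (sample_cov Y) 2.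
Proof.
move=> n1 p1; have [Q [d sp]] := sym_spectral (sample_cov_sym Y).
pose i1 : 'I_p := Ordinal (ltnW p1); pose i2 : 'I_p := Ordinal p1.
have l2E : eigval (sample_cov Y) 2 = d 0 i2 := eigval_spectral sp i2.
have n0 : 0 < n%:R :> R by rewrite ltr0n ltnW.
apply: (eigval_codim_le (m := 1) (L := Y *m (row i1 Q)^T)) => //.
  exact: companion_cov_sym.
move=> u uL; rewrite dot_companion_cov; set v := u *m Y.
have y1 : (v *m Q^T) 0 i1 = 0.
  have /matrixP/(_ 0 0) := uL; rewrite [RHS]mxE mulmxA -/v => <-.
  by rewrite !mxE; apply: eq_bigr => k _; rewrite !mxE.
have vS : dot (v *m sample_cov Y) v <= eigval (sample_cov Y) 2 * dot v v.
  rewrite (dot_spectral sp) -(dot_orthT sp) dotE mulr_sumr; apply: ler_sum => i _.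
  have [->|ii] := eqVneq i i1; first by rewrite y1 expr0n /= !mulr0.
  rewrite expr2 ler_wpM2r -?expr2 ?sqr_ge0 // l2E; case: sp => _ _; apply.
  by rewrite /= lt0n; apply: contraNneq ii => i0; apply/eqP/val_inj.
have [v0|v0] := eqVneq v 0.
  by rewrite v0 dot0l mulr0 mulr_ge0 ?dot_ge0 // sample_eigval_ge0.
rewrite -dot_gt0 in v0; rewrite ler_pdivrMl // -(ler_pM2l v0).
have : dot v v ^+ 2 <= dot u u * dot (v *m Y^T) (v *m Y^T).
  by rewrite {1}/v dot_mull; exact: dot_CS.
rewrite expr2 => /le_trans; apply.
move: vS; rewrite dot_sample_cov ler_pdivrMl // => vS.
apply: le_trans (ler_wpM2l (dot_ge0 u) vS) _.
by rewrite le_eqVlt; apply/orP; left; apply/eqP; ring.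
Qed.

(** Each of the [n - 1] terms of the trimmed transform contributes at least the inverse of the top
    eigenvalue, and [n - 1 >= n / 2]. A lower bound here is an upper bound for the leading factor of
    [sigma_hat]. *)
Lemma xi_hat_ge n p (Y : 'M[R]_(n, p)) : (1 < n)%N -> (1 < p)%N ->
  eigval (sample_cov Y) 2 < eigval (sample_cov Y) 1 ->
  (2 * eigval (sample_cov Y) 1)^-1 <= xi_hat Y.
Proof.
move=> n1 p1 l21; rewrite /xi_hat /= l21.
have l1p : 0 < eigval (sample_cov Y) 1 by apply: le_lt_trans l21; exact: sample_eigval_ge0.
have n0 : 0 < n%:R :> R by rewrite ltr0n ltnW.
rewrite /trimmed_stieltjes -mulrN -sumrN ler_pdivlMl //.
apply: le_trans (_ : \sum_(2 <= j < n.+1) (eigval (sample_cov Y) 1)^-1 <= _).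
  rewrite sumr_const_nat subSS -[leRHS]mulr_natl.
  have -> : n%:R / (2 * eigval (sample_cov Y) 1) = n%:R / 2 * (eigval (sample_cov Y) 1)^-1.
    by rewrite invfM mulrA.
  rewrite ler_pM2r ?invr_gt0 // ler_pdivrMr // -natrM ler_nat.
  by case: (n) n1 => [//|[//|m]] _ /=; rewrite subn1 /= muln2 -addnn addnS addSn ltnS ltnS leq_addr.
rewrite !big_nat; apply: ler_sum => j /andP[j2 jn].
rewrite -invrN opprB lef_pV2 ?posrE //; last first.
- rewrite subr_gt0; apply: le_lt_trans l21; apply: le_trans (companion_eigval2_le Y n1 p1).
  case: j j2 jn => [//|j] j2 jn; apply: eigval_sorted; first exact: companion_cov_sym.
  by rewrite -ltnS j2.
- by case: j j2 {jn} => [//|j] _; rewrite lerBlDr lerDl companion_eigval_ge0.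
Qed.

(** The truncation at [(xi_hat Y * (1 + eps))^-1] forces [q z <= (1 + eps)^-1], hence
    [q z / (1 - q z) <= eps^-1] whatever the nonnegative [t]; this bounds [sigma_hat] from above. *)
Lemma test_stat_ge n p (eps Yb C : R) (Y : 'M[R]_(n, p)) (t : 'rV[R]_p) :
  (1 < n)%N -> (1 < p)%N -> 0 < eps < 1 -> p%:R <= Yb * n%:R ->
  (forall i, 0 <= t 0 i) ->
  eigval (sample_cov Y) 2 < eigval (sample_cov Y) 1 -> eigval (sample_cov Y) 1 <= C ->
  n%:R `^ (2 / 3) / ((2 * C) ^+ 3 * (1 + Yb * (eps^-1) ^+ 3)) `^ (3^-1) *
    (eigval (sample_cov Y) 1 - eigval (sample_cov Y) 2) <= test_stat eps Y t.
Proof.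
move=> n1 p1 /andP[e0 e1] pY t0 l21 l1C; have xi_ge := xi_hat_ge n1 p1 l21.
have l1p : 0 < eigval (sample_cov Y) 1 by apply: le_lt_trans l21; exact: sample_eigval_ge0.
have n0 : 0 < n%:R :> R by rewrite ltr0n ltnW.
have p0 : 0 < p%:R :> R by rewrite ltr0n ltnW.
have xi0 : 0 < xi_hat Y.
  by apply: lt_le_trans xi_ge; rewrite invr_gt0 mulr_gt0.
have C0 : 0 < C := lt_le_trans l1p l1C.
have Yb0 : 0 <= Yb by rewrite -(pmulr_lge0 _ n0) (le_trans (ltW p0)).
rewrite /test_stat; apply: ler_wpM2r; first by rewrite subr_ge0 ltW.
apply: ler_wpM2l; first exact: powR_ge0.
set z := xi_hat Y in xi_ge xi0 *.
have tl (i : 'I_p) : let q := tilde_eigenval eps Y t i in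
    0 <= (q * z / (1 - q * z)) ^+ 3 <= (eps^-1) ^+ 3.
  move=> q; have q0 : 0 <= q.
    rewrite /q /tilde_eigenval le_min quantile_enum_ge0 //=; [|exact: ltnW|exact: ratio01].
    by rewrite invr_ge0 mulr_ge0 ?(ltW xi0) //; lra.
  have qz : q * z <= (1 + eps)^-1.
    have : q <= (z * (1 + eps))^-1 by rewrite /q /tilde_eigenval ge_min lexx orbT.
    move=> /(ler_wpM2r (ltW xi0)); rewrite invfM mulrAC mulVf ?gt_eqF // mul1r.
    exact.
  have qz0 : 0 <= q * z by rewrite mulr_ge0 ?(ltW xi0).
  have i1 : (1 + eps)^-1 < 1 by rewrite invf_lt1; clear -e0; lra.
  have d0 : 0 < 1 - q * z by lra.
  have r0 : 0 <= q * z / (1 - q * z) by rewrite divr_ge0 ?(ltW d0).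
  rewrite exprn_ge0 //= ler_pXn2r ?nnegrE ?invr_ge0 ?(ltW e0) //.
  rewrite ler_pdivrMr // -[leRHS]/(_ * _) ler_pdivlMl //.
  have : (1 + eps) * (q * z) <= 1 by rewrite -ler_pdivlMl ?mulr1 //; lra.
  lra.
rewrite /sigma_hat /= -/z; set I := \int[_]_l _.
have IE : 0 <= I <= (eps^-1) ^+ 3.
  rewrite /I tilde_integral -/z; apply/andP; split.
    by rewrite mulr_ge0 ?invr_ge0 ?(ltW p0) // sumr_ge0 // => i _; case/andP: (tl i).
  rewrite ler_pdivrMl // -[p%:R]/(p%:R : R) mulr_natl -[p in leRHS]card_ord -sumr_const.
  by apply: ler_sum => i _; case/andP: (tl i).
case/andP: IE => I0 I1.
have J0 : 0 <= p%:R / n%:R * I by rewrite !mulr_ge0 ?invr_ge0 ?(ltW p0) ?(ltW n0).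
have J1 : p%:R / n%:R * I <= Yb * eps^-1 ^+ 3.
  by apply: ler_pM => //; rewrite ler_pdivrMr.
have base0 : 0 < (z ^+ 3)^-1 * (1 + p%:R / n%:R * I).
  by rewrite mulr_gt0 ?invr_gt0 ?exprn_gt0 //; clear -J0; lra.
rewrite lef_pV2 ?posrE ?powR_gt0 //; last first.
  by rewrite mulr_gt0 ?exprn_gt0 ?mulr_gt0 //; clear -J0 J1; lra.
apply: ge0_ler_powR; rewrite ?nnegrE ?invr_ge0 ?(ltW base0) //.
  by rewrite mulr_ge0 ?exprn_ge0 ?mulr_ge0 ?(ltW C0) //; clear -J0 J1; lra.
apply: ler_pM; rewrite ?invr_ge0 ?exprn_ge0 ?(ltW xi0) //; [clear -J0; lra| |clear -J1; lra].
rewrite -exprVn ler_pXn2r ?nnegrE ?invr_ge0 ?mulr_ge0 ?(ltW C0) ?(ltW xi0) //.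
rewrite invf_ple ?posrE ?mulr_gt0 //; apply: le_trans xi_ge.
by rewrite lef_pV2 ?posrE ?mulr_gt0 // ler_pM2l.
Qed.

End TestStatistic.

(** * The critical parameter and the empirical spectrum *)

Section Deterministic.
Context {R : realType}.

(** Intermediate values show that the set behind [crit] is nonempty, so the chosen element is a
    solution and not the default 0. *)
Lemma critP n p (S : 'M[R]_p) : S^T = S -> (0 < n)%N -> (1 < p)%N ->
  (forall j, (j < p)%N -> 0 < eigval S j.+1) ->
  0 < crit n S 1 < (eigval S 2)^-1 /\
  \sum_(2 <= j < p.+1)
    (eigval S j * crit n S 1 / (1 - eigval S j * crit n S 1)) ^+ 2 = n%:R.
Proof.
move=> symS n0 p1 e0; have p0 : 0 < p%:R :> R by rewrite ltr0n ltnW.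
pose f x : R := \sum_(2 <= j < p.+1) (eigval S j * x / (1 - eigval S j * x)) ^+ 2.
suff : exists x : R, 0 < x < (eigval S 2)^-1 /\ p%:R^-1 * f x = n%:R / p%:R.
  move=> /(xgetPex 0)[c01 cE]; split; first exact: c01.
  move: cE; rewrite mulrC => /(congr1 ( *%R^~ p%:R)).
  by rewrite /= !divfK ?gt_eqF.
have e2 : 0 < eigval S 2 := e0 1%N p1.
have N0 : 0 < n%:R :> R by rewrite ltr0n.
(* Chosen so that [q / (1 - q) = n]: at [b = q / eigval S 2] the term [j = 2] alone is [n ^+ 2],
   while the poles stay to the right of [b]. *)
pose q : R := n%:R / n.+1%:R.
have qE : 1 - q = n.+1%:R^-1.
  by rewrite -{1}(@divff _ n.+1%:R) ?pnatr_eq0 // -mulrBl -natr1 addrAC subrr add0r mul1r.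
have q0 : 0 < q by rewrite divr_gt0.
have q1 : q < 1 by rewrite -subr_gt0 qE invr_gt0 ltr0n.
pose b := q / eigval S 2; have b0 : 0 < b by rewrite divr_gt0.
have eb j : (2 <= j < p.+1)%N -> eigval S j <= eigval S 2.
  by case: j => [//|j] j2; apply: eigval_sorted.
have ex x j : (2 <= j < p.+1)%N -> x <= b -> 0 <= x -> eigval S j * x < 1.
  move=> jp xb x0; apply: le_lt_trans q1.
  have -> : q = eigval S 2 * b by rewrite /b mulrC divfK // gt_eqF.
  apply: le_trans (ler_wpM2r x0 (eb j jp)) _.
  by rewrite ler_pM2l.
have [||c /andP[c0 cb] fc] := @IVT _ f 0 b n%:R (ltW b0).
- apply: continuous_in_subspaceT => x; rewrite inE /= in_itv /= => /andP[x0 xb].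
  rewrite /f /continuous_at; under eq_fun do rewrite big_nat.
  rewrite big_nat; apply: cvg_big => [|j jp]; first exact: add_continuous.
  have dx : 1 - eigval S j * x != 0 by rewrite subr_eq0 gt_eqF // ex.
  have cx : (fun y : R => eigval S j * y) @ x --> eigval S j * x.
    by apply: cvgM; [exact: cvg_cst|exact: cvg_id].
  apply: (continuous_comp
    (f := fun y : R => eigval S j * y / (1 - eigval S j * y)) (g := fun z => z ^+ 2)).
    apply: cvgM => //; apply: cvgV => //; apply: cvgB => //; exact: cvg_cst.
  exact: exprn_continuous.
- have f0 : f 0 = 0.
    by rewrite /f big1 // => j _; rewrite mulr0 mul0r expr0n.
  have fb : n%:R <= f b.
    have E : eigval S 2 * b = q by rewrite /b mulrC divfK // gt_eqF.
    rewrite /f big_ltn // E qE invrK /q divfK ?pnatr_eq0 //.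
    apply: le_trans (_ : n%:R ^+ 2 <= _).
      by rewrite expr2 ler_peMr ?ler0n // ler1n.
    by rewrite lerDl sumr_ge0 // => j _; exact: sqr_ge0.
  have fb0 : 0 <= f b := le_trans (ltW N0) fb.
  by rewrite f0 min_l // max_r // ltW.
exists c; split; last by rewrite fc mulrC.
apply/andP; split.
  move: c0; rewrite /= bnd_simp le_eqVlt => /orP[/eqP c0|//].
  move: fc; rewrite -c0 /f big1 => [/esym/eqP|j _]; first by rewrite gt_eqF.
  by rewrite mulr0 mul0r expr0n.
move: cb; rewrite /= bnd_simp => cb; apply: le_lt_trans cb _.
by rewrite /b gtr_pMl ?invr_gt0.
Qed.

Lemma msupport_empirical (s : seq R) i : (i < size s)%N -> msupport (empirical s) s`_i.
Proof.
move=> si U oU Ui; rewrite empiricalE lte_fin mulr_gt0 ?invr_gt0 ?ltr0n ?(leq_ltn_trans _ si) //.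
rewrite (bigD1 (Ordinal si)) //= indicE mem_set // ltr_pwDl //.
by rewrite sumr_ge0.
Qed.

Lemma sum_spectral p (S Q : 'M[R]_p) d (F : R -> R) (i1 : 'I_p) : spectral S Q d ->
  i1 = 0%N :> nat ->
  \sum_(2 <= j < p.+1) F (eigval S j) = \sum_(i | i != i1) F (d 0 i).
Proof.
move=> sp i10; apply: (addrI (F (eigval S 1))).
have p1 : (1 < p.+1)%N by rewrite ltnS (leq_ltn_trans _ (ltn_ord i1)).
rewrite -(@big_ltn _ 0 +%R 1 p.+1 (fun j => F (eigval S j)) p1) big_add1 big_mkord.
transitivity (\sum_(i < p) F (d 0 i)).
  by apply: eq_bigr => i _; rewrite (eigval_spectral sp).
rewrite (bigD1 i1) //=; congr (F _ + _).
by rewrite -(eigval_spectral sp) i10.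
Qed.

End Deterministic.

(** * From the sample covariance to the form of the rows *)

Section Reduction.
Context {R : realType} {d : measure_display} {T : measurableType d} {P : probability T R}.
Variable x : nat * nat -> {RV P >-> R}.

Lemma dot_data_cov n p (S : 'M[R]_p) w v : psd S ->
  dot (v *m sample_cov (data_matrix x n S w)) v =
  n%:R^-1 * \sum_(i < n) dot (v *m psd_sqrt S) (xrow x p i w) ^+ 2.
Proof.
move=> /psd_sqrtP[symR _]; rewrite dot_sample_cov /data_matrix trmx_mul symR mulmxA.
congr (_ * _); rewrite dotE; apply: eq_bigr => i _.
rewrite -expr2; congr (_ ^+ 2); rewrite dotE !mxE; apply: eq_bigr => k _.
by rewrite !mxE.
Qed.

Variables (n p : nat) (S Q : 'M[R]_p) (l : 'rV[R]_p) (w : T).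
Hypotheses (psdS : psd S) (sp : spectral S Q l) (l0 : forall i, 0 < l 0 i).
Let Z u := n%:R^-1 * \sum_(i < n) dot u (xrow x p i w) ^+ 2.
Let iS := sfun Q (fun i => (l 0 i)^-1).
Let Rt := psd_sqrt S.

Let symR : Rt^T = Rt. Proof. by case: (psd_sqrtP psdS). Qed.

Let Rt_iS : iS *m Rt *m Rt = 1%:M.
Proof.
have [OQ _ _] := sp; have [_ SE] := spectral_sfun sp.
have [_ RR] := psd_sqrtP psdS; rewrite -mulmxA RR [in X in _ *m X = _]SE /iS sfunM //.
rewrite -(sfun_scalar OQ 1); congr (sfun Q _); apply/funext => i.
by rewrite mulVf // gt_eqF.
Qed.

Let dot_iS v : dot (v *m Rt *m iS) (v *m Rt) = dot v v.
Proof.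
rewrite [LHS]dotC [LHS]dot_mull symR -(mulmxA _ iS) -(mulmxA v Rt).
have -> : Rt *m (iS *m Rt) = 1%:M by exact: mulmx1C Rt_iS.
by rewrite mulmx1.
Qed.

Let dot_sqrt v : dot (v *m Rt) (v *m Rt) = dot (v *m S) v.
Proof. by have [_ RR] := psd_sqrtP psdS; rewrite dot_mull symR dotC -mulmxA RR. Qed.

Let dot_sqrt_le b0 v : (forall i, l 0 i <= b0) ->
  dot (v *m Rt) (v *m Rt) <= b0 * dot v v.
Proof.
move=> lb; rewrite dot_sqrt (dot_spectral sp) -(dot_orthT sp) dotE mulr_sumr.
by apply: ler_sum => i _; rewrite -expr2 ler_wpM2r ?sqr_ge0.
Qed.

(** Substituting [u = v *m Rt] turns the eigenvalue bound into a comparison of the form of the rows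
    with a multiple of the inverse of [S], the shape of the hypothesis in [outlier_lower]. *)
Lemma sample_eigval1_bound u :
  Z u <= eigval (sample_cov (data_matrix x n S w)) 1 * dot (u *m iS) u.
Proof.
have [v ->] : exists v, u = v *m Rt.
  by exists (u *m (iS *m Rt)); rewrite -mulmxA Rt_iS mulmx1.
rewrite dot_iS /Z /Rt -dot_data_cov //; apply: eigval1_ge; exact: sample_cov_sym.
Qed.

Lemma sample_eigval1_le (C b0 : R) : 0 <= C -> (forall i, l 0 i <= b0) -> 0 <= b0 ->
  (forall u, Z u <= C * dot u u) ->
  eigval (sample_cov (data_matrix x n S w)) 1 <= C * b0.
Proof.
move=> C0 lb b0p ZC; apply: eigval1_le => [||v].
- exact: sample_cov_sym.
- exact: mulr_ge0.
rewrite dot_data_cov //; apply: le_trans (ZC _) _; rewrite -mulrA ler_wpM2l //.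
exact: dot_sqrt_le.
Qed.

Lemma sample_eigval2_le (i1 : 'I_p) (h c b0 : R) : (1 < p)%N ->
  0 <= c -> (forall i, l 0 i <= b0) ->
  (forall u, (u *m Q^T) 0 i1 = 0 -> Z u <= h * dot (u *m iS) u + c * dot u u) ->
  eigval (sample_cov (data_matrix x n S w)) 2 <= h + c * b0.
Proof.
move=> p1 c0 lb Zu.
apply: (eigval_codim_le (m := 1) (L := Rt *m (row i1 Q)^T)) => //.
  exact: sample_cov_sym.
move=> v vL; rewrite dot_data_cov //.
have y1 : (v *m Rt *m Q^T) 0 i1 = 0.
  have /matrixP/(_ 0 0) := vL; rewrite [RHS]mxE mulmxA => <-.
  by rewrite !mxE; apply: eq_bigr => k _; rewrite !mxE.
apply: le_trans (Zu _ y1) _; rewrite dot_iS mulrDl lerD2l -mulrA ler_wpM2l //.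
exact: dot_sqrt_le.
Qed.

End Reduction.

(** * The gap event and the power of the test *)

Section GapEvent.
Context {R : realType} {d : measure_display} {T : measurableType d} {P : probability T R}.

(** Each positive power is controlled by one member of the supremum: its prefactor is positive, so
    an infinite moment would make that member infinite. *)
Lemma standard_arrayP (x : nat * nat -> {RV P >-> R}) : iid_array x ->
  ('E_P[x (0%N, 0%N)] = 0)%E ->
  ('E_P[fun w => (x (0%N, 0%N) w ^+ 2)%R] = 1)%E ->
  (exists2 beta : R, 0 < beta &
    (ereal_sup [set ((q `^ (- beta^-1))%R%:E *
        ('E_P[fun w => (`|x (0%N, 0%N) w| `^ q)%R]) `^ (q^-1)%R)%E
      | q in [set q : R | (1 <= q)%R]] < +oo)%E) ->
  standard_array x.
Proof.
move=> [indx idx] mean0 var1 [be be0 supf]; set X := x (0, 0)%N in mean0 var1 supf *.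
have mX : measurable_fun setT (X : T -> R) by exact: measurable_funPT.
split => //.
- split=> // k; case: k => [|k].
    under eq_fun do rewrite expr0; exact: finite_measure_integrable_cst.
  apply/integrableP; split; first by apply/measurable_EFinP; exact: measurable_funX.
  pose q : R := k.+1%:R; have q1 : 1 <= q by rewrite ler1n.
  have {supf} : ((q `^ (- be^-1))%R%:E *
      ('E_P[fun w => (`|X w| `^ q)%R]) `^ (q^-1)%R < +oo)%E.
    by apply: le_lt_trans supf; apply: ereal_sup_ubound; exists q.
  have E0 : (0 <= 'E_P[fun w => (`|X w| `^ q)%R])%E.
    by rewrite unlock; apply: integral_ge0 => w _; rewrite lee_fin powR_ge0.
  have EE : (\int[P]_w `|(X w ^+ k.+1)%:E| = 'E_P[fun w => (`|X w| `^ q)%R])%E.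
    rewrite unlock; apply: eq_integral => w _.
    by rewrite /q powR_mulrn // -normrX.
  rewrite EE; move: E0; case: ('E_P[_])%E => [r _ _|_|//]; first exact: ltry.
  rewrite poweRyr ?invr_eq0 ?gt_eqF ?(lt_le_trans ltr01) //.
  by rewrite gt0_muley ?lte_fin ?powR_gt0 ?(lt_le_trans ltr01).
- by move: mean0; rewrite unlock /Ex /Rintegral => ->.
- by move: var1; rewrite unlock /Ex /Rintegral => ->.
Qed.

Lemma Ex_indicI (A B : set T) (s t : R) : measurable A -> measurable B ->
  1 - s <= Ex P \1_A -> 1 - t <= Ex P \1_B -> 1 - (s + t) <= Ex P \1_(A `&` B).
Proof.
move=> mA mB sA tB; have mAB := measurableI _ _ mA mB.
have : Ex P (fun w => \1_A w + \1_B w) <= Ex P (fun w => 1 + \1_(A `&` B) w).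
  apply: Ex_le => [||w]; try by apply: niceD; try exact: nice_indic; exact: nice_cst.
  rewrite !indicE in_setI; case: (w \in A); case: (w \in B) => /=; rewrite ?addr0 ?add0r //.
rewrite !ExD ?Ex_cst; try exact: nice_indic; last exact: nice_cst.
lra.
Qed.

Variables (x : nat * nat -> {RV P >-> R}) (a b0 eps Y rho : R).

(** The gap [eps ^+ 2 * a / 2] of [outlier_gap] is cut into three equal parts: one is lost in the
    lower estimate, one in the upper, and one remains. The probability [rho] is shared among three
    events in the same way. *)
Lemma gap_event : standard_array x -> 0 < eps < 1 -> 0 < a -> 0 < b0 -> 0 <= Y -> 0 < rho ->
  exists N0 : nat, forall (n p : nat) (S : 'M[R]_p),
  (N0 <= n)%N -> (1 < p)%N -> psd S ->
  (forall j, (j < p)%N -> a <= eigval S j.+1 <= b0) -> p%:R <= Y * n%:R ->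
  ((1 - eps) * crit n S 1)^-1 <= eigval S 1 ->
  exists G : set T, [/\ measurable G, 1 - rho <= fine (P G) &
    forall w, G w -> let l := eigval (sample_cov (data_matrix x n S w)) in
      l 2 + eps ^+ 2 * a / 6 <= l 1 /\ l 1 <= (2 * Y + 4) * b0].
Proof.
move=> sx eps01 a0 b00 Y0 rho0; have r30 : 0 < rho / 3 by rewrite divr_gt0.
have [N1 h1] := outlier_lower sx eps01 a0 b00 Y0 r30.
have [N2 h2] := outlier_upper sx eps01 a0 b00 Y0 r30.
have [N3 h3] := bulk_upper sx Y0 r30.
exists (maxn 1 (maxn N1 (maxn N2 N3))) => n p S.
rewrite !geq_max => /and4P[n0 n1 n2 n3] p1 psdS eab pY alt.
have symS : S^T = S by case: psdS.
have e0 j : (j < p)%N -> 0 < eigval S j.+1 by move=> /eab/andP[/(lt_le_trans a0)].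
have [Q [l sp]] := sym_spectral symS.
have lE i : l 0 i = eigval S i.+1 by rewrite (eigval_spectral sp).
have lab i : a <= l 0 i <= b0 by rewrite lE eab.
have l0 i : 0 < l 0 i by rewrite lE e0.
have [OQ _ lsort] := sp.
have [/andP[xn0 xn1] critE] := critP symS n0 p1 e0.
have N0 : 0 < n%:R :> R by rewrite ltr0n.
move: xn0 xn1 critE alt; set xn := crit n S 1 => xn0 xn1 critE alt.
pose i1 : 'I_p := Ordinal (ltnW p1); pose i2 : 'I_p := Ordinal p1.
rewrite (sum_spectral (fun e => (e * xn / (1 - e * xn)) ^+ 2) (i1 := i1) sp) // in critE.
have lxn i : i != i1 -> l 0 i * xn < 1.
  move=> ii; apply: le_lt_trans (_ : eigval S 2 * xn < 1); last first.
    by rewrite mulrC -ltr_pdivlMr ?e0 // div1r.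
  rewrite ler_pM2r // lE; apply: eigval_sorted => //; rewrite ltn_ord andbT lt0n.
  by apply: contraNneq ii => ii; apply/eqP/val_inj.
have spike : (l 0 i1)^-1 <= (1 - eps) * xn.
  have e1 : 0 < 1 - eps by case/andP: eps01; rewrite subr_gt0.
  by rewrite invf_ple ?posrE ?mulr_gt0 // lE.
have gap := outlier_gap eps01 a0 lab N0 xn0 lxn critE spike.
have [G1 [mG1 PG1 HG1]] := h1 n p Q (l 0) i1 xn n1 OQ lab pY xn0 lxn critE spike.
have [G2 [mG2 PG2 HG2]] := h2 n p Q (l 0) i1 xn n2 OQ lab pY xn0 lxn critE spike.
have [G3 [mG3 PG3 HG3]] := h3 n p n3 pY.
exists (G1 `&` (G2 `&` G3)); split.
- by apply: measurableI => //; exact: measurableI.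
- rewrite -Ex_indic; last by apply: measurableI => //; exact: measurableI.
  have PG23 := Ex_indicI mG2 mG3 PG2 PG3.
  have := Ex_indicI mG1 (measurableI _ _ mG2 mG3) PG1 PG23.
  by apply: le_trans; rewrite lerD2l lerN2; lra.
move=> w [/HG1 w1 [/HG2 w2 /HG3 w3]] /=; split; last first.
  apply: (sample_eigval1_le psdS sp) => [|i||]; last exact: w3.
  - by rewrite addr_ge0 // mulr_ge0.
  - by case/andP: (lab i).
  - exact: ltW.
have lo := w1 _ (sample_eigval1_bound x n w psdS sp l0).
have up : eigval (sample_cov (data_matrix x n S w)) 2 <=
    hout n%:R (l 0) i1 ((1 + eps) * (l 0 i1)^-1) + eps ^+ 2 * a / 6 / b0 * b0.
  apply: (sample_eigval2_le psdS sp l0 (i1 := i1)) => //.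
  - apply: divr_ge0 (ltW b00); apply: divr_ge0 => //.
    by rewrite mulr_ge0 ?sqr_ge0 ?(ltW a0).
  - by move=> i; case/andP: (lab i).
rewrite (divfK (lt0r_neq0 b00)) in up.
move: gap lo up; move: (hout _ _ _ _) (hout _ _ _ _) (eigval _ 1) (eigval _ 2) (eps ^+ 2 * a).
clear; move=> *; lra.
Qed.

End GapEvent.

Lemma powR_gt_near {R : realType} (q c : R) : 0 < q ->
  \forall n \near \oo, c < n%:R `^ q.
Proof.
move=> q0; near=> n.
have h : (Num.max c 1) `^ q^-1 < n%:R by near: n; exact: nbhs_infty_gtr.
have c1 : 0 < Num.max c 1 by rewrite lt_max ltr01 orbT.
apply: le_lt_trans (_ : Num.max c 1 < _); first by rewrite le_max lexx.
have -> : Num.max c 1 = (Num.max c 1 `^ q^-1) `^ q.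
  by rewrite -powRrM mulVf ?gt_eqF // powRr1 // ltW.
by apply: gt0_ltr_powR; rewrite ?nnegrE ?powR_ge0.
Unshelve. all: by end_near. Qed.

Theorem theorem2 (R : realType)
  (eps alpha : R) (K : nat)
  (d : measure_display) (T : measurableType d) (P : probability T R)
  (x : nat * nat -> {RV P >-> R})
  (p : nat -> nat) (y : R)
  (Sigma : forall n : nat, 'M[R]_(p n))
  (H : probability R R)
  (tau : forall n : nat, T -> 'rV[R]_(p n))
  (spike : nat -> R)
  (TW : probability (R * R)%type R)
  (heps : 0 < eps < 1) (halpha : 0 < alpha < 1) (hK : (1 <= K)%N)
  (hSigma : forall n, psd (Sigma n))
  (* (A1) *)
  (hy : (p n)%:R / n%:R @[n --> \oo] --> y) (hy0 : 0 < y) (hy1 : y != 1)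
  (* (A2) *)
  (hiid : iid_array x)
  (hmean : ('E_P[x (0%N, 0%N)] = 0)%E)
  (hvar : ('E_P[fun w => (x (0%N, 0%N) w ^+ 2)%R] = 1)%E)
  (hmoments : exists2 beta : R, 0 < beta &
    (ereal_sup [set ((q `^ (- beta^-1))%R%:E *
        ('E_P[fun w => (`|x (0%N, 0%N) w| `^ q)%R]) `^ (q^-1)%R)%E
      | q in [set q : R | (1 <= q)%R]] < +oo)%E)
  (* (A3) *)
  (hweak : weak_cvg (fun n => empirical (eigenvals (Sigma n))) H)
  (hsupp : exists2 s : seq (R * R), all (fun I => 0 < I.1 <= I.2) s &
    msupport H = \bigcup_(I in [set` s]) `[I.1, I.2]%classic)
  (hcompact : exists a b : R, 0 < a /\
    \forall n \near \oo,
      msupport (empirical (eigenvals (Sigma n))) `<=` `[a, b]%classic)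
  (* QuEST *)
  (htau_meas : forall n (i : 'I_(p n)),
    measurable_fun setT (fun w => tau n w 0 i))
  (htau : forall n w, (0 < n)%N ->
    quest_minimizer (data_matrix x n (Sigma n) w) (tau n w))
  (* critical value *)
  (hTW : tracy_widom2 TW)
  (* alternative *)
  (hspike : forall i j : nat, (1 <= i < j)%N -> (j <= K)%N ->
    spike j < spike i)
  (hfixed : \forall n \near \oo, forall j : nat, (1 <= j <= K)%N ->
    eigval (Sigma n) j = spike j)
  (hH1 : \forall n \near \oo, alternative n eps K (Sigma n)) :
  P [set w | gap_quantile TW (1 - alpha) <
             test_stat eps (data_matrix x n (Sigma n) w) (tau n w)]
    @[n --> \oo] --> 1%E.
Proof.
case: hcompact => a [b [a0 hab]].
have sx := standard_arrayP hiid hmean hvar hmoments.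
pose b0 : R := `|b| + 1; have b00 : 0 < b0 by rewrite ltr_wpDl.
pose Y : R := y + 1; have Y0 : 0 < Y by rewrite addr_gt0.
pose small : R := eps ^+ 2 * a / 6.
have [e0 e1] := andP heps.
have small0 : 0 < small by rewrite divr_gt0 // mulr_gt0 // exprn_gt0.
pose C : R := (2 * Y + 4) * b0.
have C0 : 0 < C by rewrite mulr_gt0 // addr_gt0 // mulr_gt0.
(* An upper bound for [sigma_hat] that is free of [n]: [C] bounds the top sample eigenvalue and [Y]
   bounds [p n / n] for large [n]. *)
pose D : R := ((2 * C) ^+ 3 * (1 + Y * eps^-1 ^+ 3)) `^ 3^-1.
have D0 : 0 < D.
  apply: powR_gt0; apply: mulr_gt0; first by rewrite exprn_gt0 // mulr_gt0.
  by rewrite addr_gt0 // mulr_gt0 // exprn_gt0 // invr_gt0.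
set c := gap_quantile TW (1 - alpha).
pose E n : set T := [set w | c < test_stat eps (data_matrix x n (Sigma n) w) (tau n w)].
have mE n : measurable (E n).
  have mX : mxmeas (data_matrix x n (Sigma n)).
    apply: mxmeasM; last exact: mxmeas_cst.
    move=> i j; rewrite (_ : (fun w => _) = x (i : nat, j : nat)); first exact: measurable_funPT.
    by apply/funext => w; rewrite !mxE.
  have mt : mxmeas (tau n) by move=> i j; rewrite ord1; exact: htau_meas.
  rewrite -[E n]setTI (_ : E n =
    (fun w => test_stat eps (data_matrix x n (Sigma n) w) (tau n w)) @^-1` `]c, +oo[).
    exact: measurable_test_stat.
  by apply/seteqP; split=> w; rewrite /E /= in_itv /= andbT.
apply/fine_cvgP; split; first by near=> n; apply: fin_num_measure; exact: mE.
apply/cvgrPdist_le => /= rho rho0.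
have [N0 HN0] := gap_event sx heps a0 b00 (ltW Y0) rho0.
near=> n.
have n0 : (1 < n)%N by near: n; exact: nbhs_infty_gt.
have nR : 0 < n%:R :> R by rewrite ltr0n ltnW.
have pY : (p n)%:R <= Y * n%:R.
  by rewrite -ler_pdivrMr //; near: n; apply: (cvgr_le _ hy); rewrite ltrDl.
(* As [y > 0], [p n] grows with [n]; eventually [p n > 1], and the second eigenvalue is a genuine
   one rather than the default 0. *)
have py : y / 2 <= (p n)%:R / n%:R.
  by near: n; apply: (cvgr_ge _ hy); rewrite ltr_pdivrMr // ltr_pMr // ltr1n.
have ny : 2 / (y / 2) < n%:R by near: n; exact: nbhs_infty_gtr.
have p1 : (1 < p n)%N.
  rewrite -(ltr_nat R); apply: lt_le_trans (_ : (2 : R) <= _); first by rewrite ltr1n.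
  move: ny; rewrite ltr_pdivrMr ?divr_gt0 // => /ltW /le_trans; apply.
  by rewrite mulrC -ler_pdivlMr.
have nN : (N0 <= n)%N by near: n; exact: nbhs_infty_ge.
have sab : msupport (empirical (eigenvals (Sigma n))) `<=` `[a, b]%classic by near: n.
have alt : alternative n eps K (Sigma n) by near: n.
have symS : (Sigma n)^T = Sigma n by case: (hSigma n).
have eab j : (j < p n)%N -> a <= eigval (Sigma n) j.+1 <= b0.
  move=> jp; have /sab : msupport (empirical (eigenvals (Sigma n))) (eigenvals (Sigma n))`_j.
    by apply: msupport_empirical; rewrite size_eigenvals.
  rewrite /= in_itv /= => /andP[h1 h2]; rewrite /eigval /= h1 (le_trans h2) //.
  by rewrite /b0 (le_trans (ler_norm b)) // lerDl.
have [G [mG PG HG]] := HN0 n (p n) (Sigma n) nN p1 (hSigma n) eab pY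
  (proj1 alt 1%N (introT andP (conj isT hK))).
have GE : G `<=` E n.
  move=> w /HG /= [gapw upw]; rewrite /E /=.
  set l1 := eigval _ 1 in gapw upw; set l2 := eigval _ 2 in gapw.
  have l21 : l2 < l1 by apply: lt_le_trans gapw; rewrite ltrDl.
  have [t0 _] := htau n w (ltnW n0).
  apply: lt_le_trans (test_stat_ge n0 p1 heps pY t0 l21 upw); rewrite -/D -/l1 -/l2.
  (* The critical value [c] is one fixed real number, so any positive multiple of [n ^ (2/3)]
     eventually exceeds it. *)
  apply: lt_le_trans (_ : n%:R `^ (2 / 3) / D * small <= _); last first.
    by rewrite ler_wpM2l ?divr_ge0 ?powR_ge0 ?(ltW D0) // lerBrDl.
  rewrite -mulrA mulrC -ltr_pdivrMl ?mulr_gt0 ?invr_gt0 //.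
  by near: n; apply: powR_gt_near; rewrite divr_gt0.
have PE1 : fine (P (E n)) <= 1.
  by rewrite -lee_fin fineK ?fin_num_measure // probability_le1.
have PGE : fine (P G) <= fine (P (E n)).
  by rewrite fine_le ?fin_num_measure // le_measure // inE.
rewrite ger0_norm ?subr_ge0 //; apply: le_trans (_ : 1 - fine (P G) <= _).
  by rewrite lerD2l lerN2.
by rewrite lerBlDr -lerBlDl.
Unshelve. all: by end_near. Qed.
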